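(* Let $\Lambda$ be an Artin algebra. The following conditions are equivalent: (i) $\Lambda$ is a $1$-Gorenstein $\Omega_{\mathcal{G}}$-algebra. (ii) $\mathrm{rad}\,\Lambda\oplus\Lambda$ generates $\mathrm{Gprj}\text{-}\Lambda$, i.e. $\mathrm{Gprj}\text{-}\Lambda=\mathrm{add}(\mathrm{rad}\,\Lambda\oplus\Lambda)$.
   Context: Modules are finitely generated right modules. $\mathrm{add}(M)$ is the category of all modules isomorphic to direct summands of finite direct sums of copies of $M$. A $\Lambda$-module is Gorenstein projective if it is isomorphic to a syzygy of an acyclic complex $P^\bullet$ of finitely generated projectives such that $\mathrm{Hom}_\Lambda(P^\bullet,\Lambda)$ is also acyclic. $\mathrm{Gprj}\text{-}\Lambda$ is the full subcategory of these modules and $\underline{\mathrm{Gprj}}\text{-}\Lambda$ its stable category (morphisms modulo those factoring through projectives). $\mathrm{mod}\text{-}\mathcal{X}$ denotes finitely presented contravariant additive functors $\mathcal{X}\to\mathrm{Ab}$. An Artin algebra $\Lambda$, with $\mathrm{Gprj}\text{-}\Lambda$ contravariantly finite in $\mathrm{mod}\text{-}\Lambda$, is an $\Omega_{\mathcal{G}}$-algebra if $\mathrm{mod}\text{-}(\underline{\mathrm{Gprj}}\text{-}\Lambda)$ is a semisimple abelian category (all objects projective). $\Lambda$ is $1$-Gorenstein if the injective dimension of $\Lambda$ as a left and as a right module is at most one. *)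

(* Defs.v *)
(* A right module over [A] is an [lmodType A^c], where [A^c] is the converse
   ring; the module notions below are stated for left modules over a ring [S]
   and are meant to be used with [S := A^c]. The right regular module of [A]
   is [(A^c)^o] and its left regular module is [A^o]. *)
From HB Require Import structures.
From mathcomp Require Import all_boot all_algebra ring_quotient boolp.

Set Implicit Arguments.
Unset Strict Implicit.
Unset Printing Implicit Defensive.

Import GRing.Theory.
Local Open Scope ring_scope.
Local Open Scope quotient_scope.

Definition finitely_generated (S : pzRingType) (M : lmodType S) : Prop :=
  exists (n : nat) (g : 'I_n -> M),
    forall x : M, exists c : 'I_n -> S, x = \sum_i c i *: g i.

Definition isomorphic (S : pzRingType) (M N : lmodType S) : Prop :=
  exists f : {linear M -> N}, bijective f.

Definition surjective (T U : Type) (f : T -> U) : Prop :=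
  forall y, exists x, f x = y.

Definition projective (S : pzRingType) (P : lmodType S) : Prop :=
  forall (M N : lmodType S) (p : {linear M -> N}) (f : {linear P -> N}),
    surjective p -> exists g : {linear P -> M}, forall x, p (g x) = f x.

Definition injective_module (S : pzRingType) (I : lmodType S) : Prop :=
  forall (M N : lmodType S) (i : {linear M -> N}) (f : {linear M -> I}),
    injective i -> exists g : {linear N -> I}, forall x, g (i x) = f x.

Definition fg_projective (S : pzRingType) (P : lmodType S) : Prop :=
  finitely_generated P /\ projective P.

Definition short_exact (S : pzRingType) (L M N : lmodType S)
    (i : {linear L -> M}) (p : {linear M -> N}) : Prop :=
  [/\ injective i, surjective p & forall x, p x = 0 <-> exists y, i y = x].

(* [injdim_le n M] says that M has an injective resolution
   0 -> M -> I_0 -> ... -> I_n -> 0, cut into short exact sequences. *)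
Fixpoint injdim_le (S : pzRingType) (n : nat) (M : lmodType S) : Prop :=
  match n with
  | 0 => injective_module M
  | n'.+1 => exists (I C : lmodType S)
      (i : {linear M -> I}) (p : {linear I -> C}),
      [/\ injective_module I, short_exact i p & injdim_le n' C]
  end.

(* N is isomorphic to a direct summand of M^n for some n. *)
Definition in_add (S : pzRingType) (M N : lmodType S) : Prop :=
  exists (n : nat) (X : lmodType S),
    isomorphic (N * X)%type {ffun 'I_n -> M}.

Definition submodule (S : pzRingType) (M : lmodType S) (I : M -> Prop) : Prop :=
  I 0 /\ forall a x y, I x -> I y -> I (a *: x + y).

Definition maximal_submodule (S : pzRingType) (M : lmodType S)
    (I : M -> Prop) : Prop :=
  [/\ submodule I, exists x, ~ I x
    & forall J : M -> Prop, submodule J -> (forall x, I x -> J x) ->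
        (exists x, ~ J x) -> forall x, J x -> I x].

(* The radical of a module is the intersection of its maximal submodules; for
   the regular module, whose submodules are the one-sided ideals, it is the
   Jacobson radical of the ring, regarded as a module. *)
Section Radical.
Context {S : pzRingType} (M : lmodType S).

Definition in_radical : {pred M} :=
  fun x => `[< forall I : M -> Prop, maximal_submodule I -> I x >].

Lemma in_radical_submod_closed : submod_closed in_radical.
Proof.
split; first by apply/asboolP => I [[]].
move=> a x y /asboolP Hx /asboolP Hy; apply/asboolP => I mI.
by case: (mI) => -[_ +] _ _; apply; [apply: Hx | apply: Hy].
Qed.

HB.instance Definition _ :=
  GRing.isSubmodClosed.Build S M in_radical in_radical_submod_closed.

Record radical : predArgType := MkRadical {
  radical_val : M;
  _ : radical_val \in in_radical
}.

HB.instance Definition _ := [isSub for radical_val].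
HB.instance Definition _ := [Choice of radical by <:].
HB.instance Definition _ := [SubChoice_isSubLmodule of radical by <:].
End Radical.

Definition artinian (k : comPzRingType) : Prop :=
  forall I : nat -> k^o -> Prop,
    (forall n, submodule (I n)) -> (forall n x, I n.+1 x -> I n x) ->
    exists n, forall m, (n <= m)%N -> forall x, I n x -> I m x.

(* The k-algebra structure is given by a central ring morphism rather than by
   an [algType k], because the latter excludes the zero ring. *)
Definition artin_algebra (A : pzRingType) : Prop :=
  exists (k : comPzRingType) (phi : {rmorphism k -> A}),
    [/\ artinian k,
        forall (c : k) (a : A), phi c * a = a * phi c
      & exists (n : nat) (g : 'I_n -> A),
          forall a : A, exists c : 'I_n -> k, a = \sum_i phi (c i) * g i].

Definition one_gorenstein (A : pzRingType) : Prop :=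
  injdim_le 1 (A^o : lmodType A) /\ injdim_le 1 ((A^c)^o : lmodType A^c).

(* d i goes from P i to P (i + 1); the last condition is the acyclicity of
   Hom(P, S), at the spot Hom(P (i + 1), S). *)
Definition totally_acyclic (S : pzRingType) (P : int -> lmodType S)
    (d : forall i, {linear P i -> P (i + 1)}) : Prop :=
  [/\ forall i, fg_projective (P i),
      forall i (x : P (i + 1)), d (i + 1) x = 0 <-> exists y, d i y = x
    & forall i (f : {linear P (i + 1) -> S^o}),
        (forall x, f (d i x) = 0) <->
        exists g : {linear P (i + 1 + 1) -> S^o}, forall x, g (d (i + 1) x) = f x].

(* The syzygy isomorphic to G is the kernel of d i, which is the image of j. *)
Definition gorenstein_projective (S : pzRingType) (G : lmodType S) : Prop :=
  exists (P : int -> lmodType S) (d : forall i, {linear P i -> P (i + 1)}),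
    totally_acyclic d /\
    exists (i : int) (j : {linear G -> P i}),
      injective j /\ forall x, d i x = 0 <-> exists y, j y = x.

Definition gprj_contravariantly_finite (S : pzRingType) : Prop :=
  forall M : lmodType S, finitely_generated M ->
    exists (G : lmodType S) (f : {linear G -> M}),
      gorenstein_projective G /\
      forall (G' : lmodType S) (g : {linear G' -> M}), gorenstein_projective G' ->
        exists h : {linear G' -> G}, forall x, f (h x) = g x.

Record preadditive := Preadditive {
  pob :> Type;
  phom : pob -> pob -> zmodType;
  pid : forall X, phom X X;
  pcomp : forall X Y Z, phom Y Z -> phom X Y -> phom X Z;
  pcompA : forall W X Y Z (h : phom Y Z) (g : phom X Y) (f : phom W X),
    pcomp h (pcomp g f) = pcomp (pcomp h g) f;
  pcomp1l : forall X Y (f : phom X Y), pcomp (pid Y) f = f;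
  pcomp1r : forall X Y (f : phom X Y), pcomp f (pid X) = f;
  pcompDl : forall X Y Z (g g' : phom Y Z) (f : phom X Y),
    pcomp (g + g') f = pcomp g f + pcomp g' f;
  pcompDr : forall X Y Z (g : phom Y Z) (f f' : phom X Y),
    pcomp g (f + f') = pcomp g f + pcomp g f'
}.

(* Contravariant additive functors from C to abelian groups. *)
Record cofunctor (C : preadditive) := Cofunctor {
  cf_ob :> C -> zmodType;
  cf_map : forall X Y : C, phom X Y -> {additive cf_ob Y -> cf_ob X};
  cf_map1 : forall (X : C) x, cf_map (pid X) x = x;
  cf_mapM : forall (X Y Z : C) (g : phom Y Z) (f : phom X Y) z,
    cf_map (pcomp g f) z = cf_map f (cf_map g z);
  cf_mapD : forall (X Y : C) (f g : phom X Y) y,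
    cf_map (f + g) y = cf_map f y + cf_map g y
}.

Record nattrans (C : preadditive) (F G : cofunctor C) := NatTrans {
  nt_app :> forall X : C, {additive F X -> G X};
  nt_natural : forall (X Y : C) (f : phom X Y) (y : F Y),
    nt_app X (cf_map F f y) = cf_map G f (nt_app Y y)
}.

Section Representable.
Variables (C : preadditive) (Z : C).

Definition pre_comp (X Y : C) (f : phom X Y) (g : phom Y Z) : phom X Z :=
  pcomp g f.

Lemma pre_comp_zmod_morphism X Y (f : phom X Y) : zmod_morphism (pre_comp f).
Proof.
move=> g h; rewrite /pre_comp; apply: (addIr (pcomp h f)).
by rewrite -pcompDl !subrK.
Qed.

HB.instance Definition _ X Y (f : phom X Y) :=
  GRing.isZmodMorphism.Build (phom Y Z) (phom X Z) (pre_comp f)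
    (pre_comp_zmod_morphism f).

Definition representable : cofunctor C := {|
  cf_ob := fun X => phom X Z;
  cf_map := fun X Y f => pre_comp f;
  cf_map1 := fun X => @pcomp1r C X Z;
  cf_mapM := fun X Y W g f z => @pcompA C X Y W Z z g f;
  cf_mapD := fun X Y f g y => @pcompDr C X Y Z y f g |}.
End Representable.

(* There is an exact sequence Hom(-, X) -> Hom(-, Y) -> F -> 0. *)
Definition finitely_presented (C : preadditive) (F : cofunctor C) : Prop :=
  exists (X Y : C) (a : nattrans (representable X) (representable Y))
         (b : nattrans (representable Y) F),
    (forall Z, surjective (b Z)) /\
    (forall Z (y : representable Y Z), b Z y = 0 <-> exists x, a Z x = y).

Record category := Category {
  cob :> Type;
  chom : cob -> cob -> Type;
  cid : forall X, chom X X;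
  ccomp : forall X Y Z, chom Y Z -> chom X Y -> chom X Z;
  ccompA : forall W X Y Z (h : chom Y Z) (g : chom X Y) (f : chom W X),
    ccomp h (ccomp g f) = ccomp (ccomp h g) f;
  ccomp1l : forall X Y (f : chom X Y), ccomp (cid Y) f = f;
  ccomp1r : forall X Y (f : chom X Y), ccomp f (cid X) = f
}.

Section AbelianCategory.
Variable C : category.

Definition zero_object (Z : C) : Prop :=
  forall X : C, (exists! f : chom X Z, True) /\ (exists! f : chom Z X, True).

Definition zero_morphism (X Y : C) (f : chom X Y) : Prop :=
  exists (Z : C) (h : chom Z Y) (g : chom X Z), zero_object Z /\ f = ccomp h g.

Definition monomorphism (X Y : C) (f : chom X Y) : Prop :=
  forall (W : C) (g h : chom W X), ccomp f g = ccomp f h -> g = h.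

Definition epimorphism (X Y : C) (f : chom X Y) : Prop :=
  forall (Z : C) (g h : chom Y Z), ccomp g f = ccomp h f -> g = h.

Definition is_kernel (K X Y : C) (k : chom K X) (f : chom X Y) : Prop :=
  zero_morphism (ccomp f k) /\
  forall (W : C) (w : chom W X), zero_morphism (ccomp f w) ->
    exists! u : chom W K, ccomp k u = w.

Definition is_cokernel (X Y Q : C) (q : chom Y Q) (f : chom X Y) : Prop :=
  zero_morphism (ccomp q f) /\
  forall (W : C) (w : chom Y W), zero_morphism (ccomp w f) ->
    exists! u : chom Q W, ccomp u q = w.

Definition has_products : Prop :=
  forall X Y : C, exists (P : C) (p : chom P X) (q : chom P Y),
    forall (W : C) (f : chom W X) (g : chom W Y),
      exists! u : chom W P, ccomp p u = f /\ ccomp q u = g.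

Definition has_coproducts : Prop :=
  forall X Y : C, exists (P : C) (i : chom X P) (j : chom Y P),
    forall (W : C) (f : chom X W) (g : chom Y W),
      exists! u : chom P W, ccomp u i = f /\ ccomp u j = g.

(* Freyd's axioms, which do not mention the addition of morphisms. *)
Record abelian_category : Prop := AbelianCategory {
  abelian_zero : exists Z : C, zero_object Z;
  abelian_products : has_products;
  abelian_coproducts : has_coproducts;
  abelian_kernels : forall (X Y : C) (f : chom X Y),
    exists (K : C) (k : chom K X), is_kernel k f;
  abelian_cokernels : forall (X Y : C) (f : chom X Y),
    exists (Q : C) (q : chom Y Q), is_cokernel q f;
  abelian_mono : forall (X Y : C) (f : chom X Y), monomorphism f ->
    exists (Z : C) (g : chom Y Z), is_kernel f g;
  abelian_epi : forall (X Y : C) (f : chom X Y), epimorphism f ->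
    exists (W : C) (g : chom W X), is_cokernel f g
}.

Definition projective_object (P : C) : Prop :=
  forall (X Y : C) (p : chom X Y) (f : chom P Y), epimorphism p ->
    exists g : chom P X, ccomp p g = f.

Definition semisimple_abelian : Prop :=
  abelian_category /\ forall P : C, projective_object P.
End AbelianCategory.

Section FinitelyPresented.
Variable C : preadditive.

Lemma nattrans_ext (F G : cofunctor C) (a b : nattrans F G) :
  (forall X x, a X x = b X x) -> a = b.
Proof.
case: a => [a an]; case: b => [b bn] /= ab.
have e : a = b.
  apply: functional_extensionality_dep => X.
  move: (ab X); case: (a X) => [f [[f1]]]; case: (b X) => [g [[g1]]] /= fg.
  have e : f = g by apply: funext.
  by subst g; rewrite (Prop_irrelevance f1 g1).
by subst b; rewrite (Prop_irrelevance an bn).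
Qed.

Definition nt_id (F : cofunctor C) : nattrans F F :=
  {| nt_app := fun X => idfun; nt_natural := fun X Y f y => erefl |}.

Lemma nt_comp_natural (F G H : cofunctor C) (b : nattrans G H)
    (a : nattrans F G) (X Y : C) (f : phom X Y) (y : F Y) :
  (b X \o a X) (cf_map F f y) = cf_map H f ((b Y \o a Y) y).
Proof. by rewrite /= !nt_natural. Qed.

Definition nt_comp (F G H : cofunctor C) (b : nattrans G H)
    (a : nattrans F G) : nattrans F H :=
  {| nt_app := fun X => b X \o a X; nt_natural := nt_comp_natural b a |}.

Lemma nt_compA (E F G H : cofunctor C) (c : nattrans G H) (b : nattrans F G)
    (a : nattrans E F) : nt_comp c (nt_comp b a) = nt_comp (nt_comp c b) a.
Proof. exact: nattrans_ext. Qed.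

Lemma nt_comp1l (F G : cofunctor C) (a : nattrans F G) : nt_comp (nt_id G) a = a.
Proof. exact: nattrans_ext. Qed.

Lemma nt_comp1r (F G : cofunctor C) (a : nattrans F G) : nt_comp a (nt_id F) = a.
Proof. exact: nattrans_ext. Qed.

Record fp_functor := FpFunctor {
  fp_val :> cofunctor C;
  fp_prop : finitely_presented fp_val
}.

(* mod-C, a full subcategory of the contravariant additive functors on C. *)
Definition mod_category : category := {|
  cob := fp_functor;
  chom := fun F G => nattrans F G;
  cid := fun F => nt_id F;
  ccomp := fun F G H b a => nt_comp b a;
  ccompA := fun E F G H => @nt_compA E F G H;
  ccomp1l := fun F G => @nt_comp1l F G;
  ccomp1r := fun F G => @nt_comp1r F G |}.
End FinitelyPresented.

Section ProjectiveSum.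
Variable S : pzRingType.

Definition pair_map (L M N : lmodType S) (f : {linear L -> M})
  (g : {linear L -> N}) (x : L) : M * N := (f x, g x).

Lemma pair_map_linear (L M N : lmodType S) (f : {linear L -> M})
  (g : {linear L -> N}) : linear (pair_map f g).
Proof. by move=> a x y; rewrite /pair_map !linearP. Qed.

HB.instance Definition _ (L M N : lmodType S) (f : {linear L -> M})
    (g : {linear L -> N}) :=
  GRing.isLinear.Build S L (M * N)%type _ (pair_map f g)
    (pair_map_linear f g).

Lemma fg_projective_prod (P Q : lmodType S) :
  fg_projective P -> fg_projective Q -> fg_projective (P * Q)%type.
Proof.
move=> [[m [u uP]] prP] [[n [v vQ]] prQ]; split.
  exists (m + n)%N, (fun i => match split i with
                              | inl j => (u j, 0) | inr j => (0, v j) end).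
  move=> [x y]; have [c ->] := uP x; have [d ->] := vQ y.
  exists (fun i => match split i with inl j => c j | inr j => d j end).
  have sl (i : 'I_m) : split (lshift n i) = inl i := unsplitK (inl i).
  have sr (i : 'I_n) : split (rshift m i) = inr i := unsplitK (inr i).
  rewrite big_split_ord [RHS]surjective_pairing.
  congr (_, _); rewrite linearD !linear_sum /=.
    rewrite [X in _ + X]big1 ?addr0 => [|i _]; last by rewrite sr scaler0.
    by apply: eq_bigr => i _; rewrite sl.
  rewrite [X in X + _]big1 ?add0r => [|i _]; last by rewrite sl scaler0.
  by apply: eq_bigr => i _; rewrite sr.
move=> M N p f sp.
have [g gE] := prP _ _ p (f \o pair_map idfun \0) sp.
have [h hE] := prQ _ _ p (f \o pair_map \0 idfun) sp.
exists ((g \o fst) \+ (h \o snd)) => -[x y] /=.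
rewrite linearD gE hE /= -linearD; congr (f _).
by congr (_, _); rewrite ?addr0 ?add0r.
Qed.
End ProjectiveSum.

Section StableHom.
Context {S : pzRingType}.

Definition lhom (M N : lmodType S) : Type := {linear M -> N}.

Section Zmodule.
Variables M N : lmodType S.

HB.instance Definition _ := gen_eqMixin (lhom M N).
HB.instance Definition _ := gen_choiceMixin (lhom M N).

Lemma lhom_ext (f g : lhom M N) : f =1 g -> f = g.
Proof.
case: f => [f [[f1] [f2]]]; case: g => [g [[g1] [g2]]] /= fg.
have e : f = g by apply: funext.
by subst g; rewrite (Prop_irrelevance f1 g1) (Prop_irrelevance f2 g2).
Qed.

Definition lhom0 : lhom M N := (\0 : {linear M -> N}).
Definition lhom_add (f g : lhom M N) : lhom M N := (f \+ g : {linear M -> N}).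
Definition lhom_opp (f : lhom M N) : lhom M N := (\- f : {linear M -> N}).

Lemma lhom_addA : associative lhom_add.
Proof. by move=> f g h; apply: lhom_ext => x /=; rewrite addrA. Qed.
Lemma lhom_addC : commutative lhom_add.
Proof. by move=> f g; apply: lhom_ext => x /=; rewrite addrC. Qed.
Lemma lhom_add0 : left_id lhom0 lhom_add.
Proof. by move=> f; apply: lhom_ext => x /=; rewrite add0r. Qed.
Lemma lhom_addN : left_inverse lhom0 lhom_opp lhom_add.
Proof. by move=> f; apply: lhom_ext => x /=; rewrite addNr. Qed.

HB.instance Definition _ := GRing.isZmodule.Build (lhom M N)
  lhom_addA lhom_addC lhom_add0 lhom_addN.

Definition factors_through_projective : {pred lhom M N} :=
  fun f => `[< exists (P : lmodType S) (h : {linear P -> N}) (g : {linear M -> P}),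
                 fg_projective P /\ forall x, f x = h (g x) >].

Lemma factors_zmod_closed : zmod_closed factors_through_projective.
Proof.
split.
  apply/asboolP; exists {ffun 'I_0 -> S^o}, \0, \0; split=> //; split.
    exists 0%N, (fun=> 0) => x; exists (fun=> 0); rewrite big_ord0.
    by apply/ffunP => -[].
  move=> L K p f _; exists \0 => x.
  by rewrite (_ : x = 0) ?linear0 //; apply/ffunP => -[].
move=> f f' /asboolP[P [h [g [pP fE]]]] /asboolP[P' [h' [g' [pP' f'E]]]].
apply/asboolP; exists (P * P')%type, ((h \o fst) \- (h' \o snd)), (pair_map g g').
by split; [apply: fg_projective_prod | move=> x /=; rewrite -fE -f'E].
Qed.

HB.instance Definition _ :=
  GRing.isZmodClosed.Build (lhom M N) factors_through_projective
    factors_zmod_closed.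

Definition stable_hom : zmodType := Quotient.quot factors_through_projective.

Definition stable_class (f : {linear M -> N}) : stable_hom :=
  \pi_(Quotient.quot factors_through_projective) (f : lhom M N).

Lemma stable_classP (f g : {linear M -> N}) :
  stable_class f = stable_class g <->
  ((f : lhom M N) - (g : lhom M N)) \in factors_through_projective.
Proof.
by rewrite Quotient.idealrBE; split=> /eqP.
Qed.

Lemma stable_classD (f g : {linear M -> N}) :
  stable_class (f \+ g) = stable_class f + stable_class g.
Proof. exact: Quotient.pi_add. Qed.

Lemma stable_classW (u : stable_hom) : exists f, u = stable_class f.
Proof. by exists (repr u); rewrite /stable_class reprK. Qed.
End Zmodule.

Definition stable_comp (L M N : lmodType S) (g : stable_hom M N)
    (f : stable_hom L M) : stable_hom L N :=
  stable_class ((repr g : {linear M -> N}) \o (repr f : {linear L -> M})).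

Lemma stable_compE (L M N : lmodType S) (g : {linear M -> N})
    (f : {linear L -> M}) :
  stable_comp (stable_class g) (stable_class f) = stable_class (g \o f).
Proof.
rewrite /stable_comp; set g' := repr _; set f' := repr _.
have /stable_classP/asboolP[P [h [k [pP gE]]]] : stable_class g' = stable_class g.
  by rewrite /stable_class reprK.
have /stable_classP/asboolP[Q [h' [k' [pQ fE]]]] : stable_class f' = stable_class f.
  by rewrite /stable_class reprK.
apply/stable_classP/asboolP.
exists (P * Q)%type, ((h \o fst) \+ ((g \o h') \o snd)),
  (pair_map (k \o (f' : {linear L -> M})) k').
split=> [|x /=]; first exact: fg_projective_prod.
by rewrite -gE -fE /= linearB addrA subrK.
Qed.
End StableHom.

Section StableCategory.
Variable S : pzRingType.

Record gprj := Gprj {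
  gprj_val :> lmodType S;
  gprj_prop : gorenstein_projective gprj_val
}.

Lemma stable_compA (K L M N : lmodType S) (h : stable_hom M N)
    (g : stable_hom L M) (f : stable_hom K L) :
  stable_comp h (stable_comp g f) = stable_comp (stable_comp h g) f.
Proof.
have [h' ->] := stable_classW h; have [g' ->] := stable_classW g.
have [f' ->] := stable_classW f; rewrite !stable_compE.
by congr stable_class; apply: lhom_ext.
Qed.

Lemma stable_comp1l (M N : lmodType S) (f : stable_hom M N) :
  stable_comp (stable_class idfun) f = f.
Proof.
have [f' ->] := stable_classW f; rewrite stable_compE.
by congr stable_class; apply: lhom_ext.
Qed.

Lemma stable_comp1r (M N : lmodType S) (f : stable_hom M N) :
  stable_comp f (stable_class idfun) = f.
Proof.
have [f' ->] := stable_classW f; rewrite stable_compE.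
by congr stable_class; apply: lhom_ext.
Qed.

Lemma stable_compDl (L M N : lmodType S) (g g' : stable_hom M N)
    (f : stable_hom L M) :
  stable_comp (g + g') f = stable_comp g f + stable_comp g' f.
Proof.
have [h ->] := stable_classW g; have [h' ->] := stable_classW g'.
have [f' ->] := stable_classW f.
rewrite -stable_classD !stable_compE -stable_classD.
by congr stable_class; apply: lhom_ext.
Qed.

Lemma stable_compDr (L M N : lmodType S) (g : stable_hom M N)
    (f f' : stable_hom L M) :
  stable_comp g (f + f') = stable_comp g f + stable_comp g f'.
Proof.
have [h ->] := stable_classW g; have [u ->] := stable_classW f.
have [v ->] := stable_classW f'.
rewrite -stable_classD !stable_compE -stable_classD.
by congr stable_class; apply: lhom_ext => x /=; rewrite linearD.
Qed.

Definition stable_gprj : preadditive := {|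
  pob := gprj;
  phom := fun G H => stable_hom G H;
  pid := fun G => stable_class idfun;
  pcomp := fun G H K v u => stable_comp v u;
  pcompA := fun G H K L => @stable_compA G H K L;
  pcomp1l := fun G H => @stable_comp1l G H;
  pcomp1r := fun G H => @stable_comp1r G H;
  pcompDl := fun G H K => @stable_compDl G H K;
  pcompDr := fun G H K => @stable_compDr G H K |}.
End StableCategory.

Definition omega_G_algebra (A : pzRingType) : Prop :=
  gprj_contravariantly_finite A^c /\
  semisimple_abelian (mod_category (stable_gprj A^c)).

(* Main.v *)
(* Write S for the converse ring of A, so that right A-modules are left
   S-modules, and J for its radical.

   If A is 1-Gorenstein, an exact complex of finitely generated projectives stays
   exact after dualizing, so the Gorenstein projective modules are the finitely
   generated torsionless ones. Let G be one of them without projective summand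
   and j : G -> S^n a left approximation by projectives. Then j lands in J^n;
   write i for the map G -> J^n. Semisimplicity gives i = i u i modulo maps
   factoring through projectives, whence j (1 - u i) = phi j with the image of phi
   in J^n; so 1 - phi is injective, u i is an automorphism and G is a summand
   of J^n.

   Conversely, if all Gorenstein projectives are summands of (J + S)^n, then J
   is Gorenstein projective. So is every maximal left ideal I of S, because it is
   a summand of J + S, and adding composition factors S / I one at a time every
   submodule of S^n satisfies the homological conditions expressing that both
   injective dimensions are at most one.

   For the semisimplicity it is enough that every stable morphism f is regular,
   f = f u f. The point is that a submodule L of a Gorenstein projective K without
   projective summand splits off as soon as K / L is torsionless: L is a summand
   of (J + S)^n, maps from L to S extend to K, and maps from K to S land in J.
   Using this, a map f : N -> H in the radical of the module category is shown to
   be stably zero by induction on the length of N: if C is the pullback of f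
   along a projective F ->> H, then up to projective summands C -> N factors through
   a proper submodule of N, so it is stably zero, which forces N to be projective. *)

(* The Artin hypothesis enters through one fact: finitely generated modules over [A] and over its
   converse ring have finite length. A Gorenstein projective module is witnessed by a complex
   infinite in both directions, which is awkward to carry over to a summand or an extension. The
   converse therefore works with [ext1_coreflexive]: [Ext^1(-, S)] vanishes, and the module is a
   kernel between projectives in a way that survives dualizing. Finite diagram chases move these two
   conditions along retracts and extensions. Once every torsionless module has them, [A] is
   1-Gorenstein, and complexes come back by splicing syzygies and cosyzygies. There the left
   injective dimension makes the cosyzygy sequences exact, the right one the dualized complex. Left
   and right modules meet through matrices: a map of free modules and its dual are transposes of
   each other. Since injective dimension is defined by resolutions, bounding it requires an
   injective module containing the ring; it is coinduced from Q/Z. Regularity controls mod-C because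
   a presentation by [f = f u f] splits: all functors become retracts of representables, and kernels
   and cokernels are images of idempotents. *)
From HB Require Import structures.
From mathcomp Require Import all_boot all_order all_algebra ring_quotient boolp.
From mathcomp Require Import classical_sets.
Require Import Defs.
Set Implicit Arguments.
Unset Strict Implicit.
Unset Printing Implicit Defensive.
Import GRing.Theory.
Local Open Scope ring_scope.

(** * Submodules, quotients and factorization of linear maps *)
Section LinearTools.
Variable S : pzRingType.
Implicit Types M N L : lmodType S.

(** Maps found by diagram chasing are given below as relations; linearity reduces single-valuedness
    to the fibre over 0. *)
Lemma linear_of_graph M N (R : M -> N -> Prop) :
  (forall x, exists y, R x y) ->
  (forall a x y x' y', R x y -> R x' y' -> R (a *: x + x') (a *: y + y')) ->
  (forall y, R 0 y -> y = 0) ->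
  exists g : {linear M -> N}, forall x, R x (g x).
Proof.
move=> tot lin fun0; have [g gP] := choice tot.
have uniq x y y' : R x y -> R x y' -> y = y'.
  move=> Ry Ry'; apply/subr0_eq/fun0.
  by have := lin (-1) _ _ _ _ Ry' Ry; rewrite !scaleN1r addNr addrC.
have glin : linear g by move=> a x y; apply: (uniq (a *: x + y)) => //; apply: lin.
pose h : {linear M -> N} := HB.pack g (GRing.isLinear.Build S M N *:%R g glin).
by exists h.
Qed.

Record submod_type M (I : submodClosed M) : predArgType :=
  MkSubmod { submod_val : M; _ : submod_val \in I }.

Section SubmodType.
Variables (M : lmodType S) (I : submodClosed M).
HB.instance Definition _ := [isSub for @submod_val M I].
HB.instance Definition _ := [Choice of submod_type I by <:].
HB.instance Definition _ := [SubChoice_isSubLmodule of submod_type I by <:].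
End SubmodType.

Section SubmodPred.
Variables (M : lmodType S) (I : M -> Prop) (hI : submodule I).
Definition submod_pred : {pred M} := fun x => `[< I x >].
Lemma submod_pred_closed : submod_closed submod_pred.
Proof.
case: hI => I0 IP; split; first exact/asboolP.
by move=> a x y /asboolP Ix /asboolP Iy; apply/asboolP/IP.
Qed.
Definition submod_of : submodClosed M :=
  HB.pack submod_pred (GRing.isSubmodClosed.Build S M submod_pred submod_pred_closed).
End SubmodPred.

Lemma sub_exists M (I : M -> Prop) : submodule I ->
  exists (N : lmodType S) (i : {linear N -> M}),
    injective i /\ forall x, I x <-> exists y, i y = x.
Proof.
move=> hI; pose N := submod_type (submod_of hI).
exists N, (val : N -> M); split; first exact: val_inj.
move=> x; split=> [Ix|[[y hy] <-]]; last exact/asboolP.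
have h : x \in submod_of hI by apply/asboolP.
by exists (MkSubmod h).
Qed.

End LinearTools.

Section Quotient.
Variables (S : pzRingType) (M : lmodType S) (I : M -> Prop) (hI : submodule I).
Local Open Scope quotient_scope.

Let quot_zmod_closed : zmod_closed (submod_pred I).
Proof.
case: hI => I0 IP; split=> [|x y /asboolP Ix /asboolP Iy]; apply/asboolP => //.
by rewrite addrC -scaleN1r; apply: IP.
Qed.
Definition quot_zmod : zmodClosed M :=
  HB.pack (submod_pred I)
    (GRing.isZmodClosed.Build M (submod_pred I) quot_zmod_closed).
Definition quot_mod : Type := Quotient.quot quot_zmod.
HB.instance Definition _ := GRing.Zmodule.on quot_mod.

Definition quot_pi (x : M) : quot_mod := \pi_(Quotient.quot quot_zmod) x.
Lemma quot_piP x y : quot_pi x = quot_pi y <-> I (x - y).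
Proof.
split=> [/eqP|Ixy]; first by rewrite -Quotient.idealrBE => /asboolP.
by apply/eqP; rewrite -Quotient.idealrBE; apply/asboolP.
Qed.
Lemma quot_piD x y : quot_pi (x + y) = quot_pi x + quot_pi y.
Proof. exact: Quotient.pi_add. Qed.
Lemma quot_piW (u : quot_mod) : exists x, u = quot_pi x.
Proof. by exists (repr u); rewrite /quot_pi reprK. Qed.

Definition quot_scale (a : S) (u : quot_mod) : quot_mod :=
  quot_pi (a *: (repr (u : Quotient.quot quot_zmod) : M)).
Lemma quot_piZ a x : quot_pi (a *: x) = quot_scale a (quot_pi x).
Proof.
apply/quot_piP; rewrite -scalerBr.
have : I (x - repr (quot_pi x : Quotient.quot quot_zmod)).
  by apply/quot_piP; rewrite /quot_pi reprK.
by case: hI => I0 IP Ix; rewrite -[_ *: _]addr0; apply: IP.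
Qed.
Lemma quot_scaleA a b v : quot_scale a (quot_scale b v) = quot_scale (a * b) v.
Proof. by have [x ->] := quot_piW v; rewrite -!quot_piZ scalerA. Qed.
Lemma quot_scale1 v : quot_scale 1 v = v.
Proof. by have [x ->] := quot_piW v; rewrite -!quot_piZ scale1r. Qed.
Lemma quot_scaleDr : right_distributive quot_scale +%R.
Proof.
move=> a u v; have [x ->] := quot_piW u; have [y ->] := quot_piW v.
by rewrite -quot_piD -!quot_piZ -quot_piD scalerDr.
Qed.
Lemma quot_scaleDl v : {morph quot_scale^~ v : a b / a + b}.
Proof.
by move=> a b; have [x ->] := quot_piW v; rewrite -!quot_piZ -quot_piD scalerDl.
Qed.
HB.instance Definition _ :=
  GRing.Zmodule_isLmodule.Build S quot_mod quot_scaleA quot_scale1 quot_scaleDr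
    quot_scaleDl.
Lemma quot_pi_linear : linear quot_pi.
Proof. by move=> a x y; rewrite quot_piD quot_piZ. Qed.
HB.instance Definition _ :=
  GRing.isLinear.Build S M quot_mod *:%R quot_pi quot_pi_linear.
End Quotient.

Section Factor.
Variable S : pzRingType.
Implicit Types M N L : lmodType S.

Lemma quot_exists M (I : M -> Prop) : submodule I ->
  exists (N : lmodType S) (p : {linear M -> N}),
    surjective p /\ forall x, p x = 0 <-> I x.
Proof.
move=> hI; exists (quot_mod hI), (@quot_pi S M I hI).
split=> [u|x]; first by have [x ->] := quot_piW u; exists x.
by rewrite -[0](linear0 (@quot_pi S M I hI)) quot_piP subr0.
Qed.

Lemma factor_mono M N L (i : {linear N -> M}) (f : {linear L -> M}) :
  injective i -> (forall x, exists y, i y = f x) ->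
  exists g : {linear L -> N}, forall x, i (g x) = f x.
Proof.
move=> inji fi; apply: (@linear_of_graph _ _ _ (fun x y => i y = f x)) => //.
  by move=> a x y x' y' e e'; rewrite !linearP e e'.
by move=> y; rewrite linear0 => iy; apply: inji; rewrite linear0.
Qed.

Lemma factor_epi M N L (p : {linear M -> N}) (f : {linear M -> L}) :
  surjective p -> (forall x, p x = 0 -> f x = 0) ->
  exists g : {linear N -> L}, forall x, g (p x) = f x.
Proof.
move=> sp fp.
have [||y|g gP] := @linear_of_graph _ _ _ (fun y z => exists2 x, p x = y & f x = z).
- by move=> y; have [x <-] := sp y; exists (f x), x.
- move=> a x y x' y' [z <- <-] [z' <- <-]; exists (a *: z + z'); by rewrite linearP.
- by case=> x px <-; apply: fp.
exists g => x; have [x' px' <-] := gP (p x).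
by apply/subr0_eq; rewrite -linearB fp // linearB px' subrr.
Qed.

Lemma submodule_ker M N (f : {linear M -> N}) : submodule (fun x => f x = 0).
Proof.
by split=> [|a x y fx fy]; rewrite ?linear0 // linearP fx fy scaler0 addr0.
Qed.

Lemma submodule_im M N (f : {linear M -> N}) : submodule (fun y => exists x, f x = y).
Proof.
split=> [|a _ _ [x <-] [y <-]]; first by exists 0; rewrite linear0.
by exists (a *: x + y); rewrite linearP.
Qed.

Lemma submoduleT M : @submodule S M (fun _ => True). Proof. by []. Qed.

Lemma submoduleD M (I : M -> Prop) x y : submodule I -> I x -> I y -> I (x + y).
Proof. by move=> [_ h] Ix Iy; rewrite -[x]scale1r; apply: h. Qed.

Lemma submoduleZ M (I : M -> Prop) a x : submodule I -> I x -> I (a *: x).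
Proof. by move=> [h0 h] Ix; rewrite -[_ *: x]addr0; apply: h. Qed.

Lemma submoduleN M (I : M -> Prop) x : submodule I -> I x -> I (- x).
Proof. by move=> hI Ix; rewrite -scaleN1r; apply: submoduleZ. Qed.

Lemma submoduleB M (I : M -> Prop) x y : submodule I -> I x -> I y -> I (x - y).
Proof. by move=> hI Ix Iy; apply: submoduleD => //; apply: submoduleN. Qed.

Lemma submodule_sum M (I : M -> Prop) (T : finType) (F : T -> M) :
  submodule I -> (forall i, I (F i)) -> I (\sum_i F i).
Proof. by move=> hI IF; apply: big_ind => //; [case: hI | move=> x y; apply: submoduleD]. Qed.

Lemma submoduleI M (I J : M -> Prop) :
  submodule I -> submodule J -> submodule (fun x => I x /\ J x).
Proof. by move=> [I0 hI] [J0 hJ]; split=> // a x y [? ?] [? ?]; split; [apply: hI | apply: hJ]. Qed.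

Lemma submodule_preim M N (f : {linear M -> N}) (I : N -> Prop) :
  submodule I -> submodule (fun x => I (f x)).
Proof.
move=> hI; split; first by rewrite linear0; case: hI.
by move=> a x y; rewrite linearP; case: hI => _; apply.
Qed.

Lemma submodule_image M N (f : {linear M -> N}) (I : M -> Prop) :
  submodule I -> submodule (fun y => exists2 x, I x & f x = y).
Proof.
move=> [I0 hI]; split=> [|a _ _ [x Ix <-] [y Iy <-]].
  by exists 0; rewrite ?linear0.
by exists (a *: x + y); [apply: hI | rewrite linearP].
Qed.

Lemma submodule_add M (I J : M -> Prop) : submodule I -> submodule J ->
  submodule (fun x => exists y z, [/\ I y, J z & x = y + z]).
Proof.
move=> [I0 hI] [J0 hJ]; split; first by exists 0, 0; rewrite addr0.
move=> a x y [u [v [Iu Jv ->]]] [u' [v' [Iu' Jv' ->]]].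
exists (a *: u + u'), (a *: v + v'); split; [exact: hI | exact: hJ |].
by rewrite scalerDr addrACA.
Qed.

Lemma submodule_cyclic M (x : M) : submodule (fun y => exists a : S, y = a *: x).
Proof.
split=> [|b _ _ [a ->] [a' ->]]; first by exists 0; rewrite scale0r.
by exists (b * a + a'); rewrite scalerDl scalerA.
Qed.

Definition linear_mulr (M : lmodType S) (x : M) (a : S^o) : M := @GRing.scale S M a x.
Lemma linear_mulr_linear M (x : M) : linear (linear_mulr x).
Proof. by move=> a b c; rewrite /linear_mulr scalerDl; congr (_ + _); rewrite -scalerA. Qed.
HB.instance Definition _ M (x : M) :=
  GRing.isLinear.Build S S^o M *:%R (linear_mulr x) (linear_mulr_linear x).

End Factor.

(** * Modules of finite length *)
(* [length_le n I]: every strict chain of submodules of [I] has at most [n] steps. *)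
Fixpoint length_le (S : pzRingType) (M : lmodType S) n (I : M -> Prop) : Prop :=
  match n with
  | 0 => forall x, I x -> x = 0
  | n'.+1 => forall J : M -> Prop, submodule J -> (forall x, J x -> I x) ->
      (exists2 x, I x & ~ J x) -> length_le n' J
  end.

Definition finite_length (S : pzRingType) (M : lmodType S) : Prop :=
  exists n, length_le n (fun _ : M => True).

Section Length.
Variable S : pzRingType.
Implicit Types M N L : lmodType S.

Lemma length_leW M n (I J : M -> Prop) :
  (forall x, J x -> I x) -> length_le n I -> length_le n J.
Proof.
case: n => [|n] /= JI h; first by move=> x /JI/h.
by move=> K hK KJ [x Jx Kx]; apply: h => //; [move=> y /KJ/JI | exists x => //; apply: JI].
Qed.

(** A proper submodule of [I] either misses part of the kernel of [p], which lowers [a], or contains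
    that kernel and has a smaller image, which lowers [b]. *)
Lemma length_le_ext M N (p : {linear M -> N}) a b (I : M -> Prop) : submodule I ->
  length_le a (fun x => I x /\ p x = 0) ->
  length_le b (fun y => exists2 x, I x & p x = y) -> length_le (a + b) I.
Proof.
move eab : (a + b)%N => n; elim: n => [|n IHn] in a b eab I *.
  case: a b eab => // -[] // _ hI /= h h' x Ix; apply: h; split=> //.
  by apply: h'; exists x.
move=> hI h h' J hJ JI [x Ix Jx].
have [sub|/existsNP[z /not_implyP[[Iz pz] Jz]]] :=
    pselect (forall x, I x /\ p x = 0 -> J x); last first.
  case: a => [|a] in eab h *; first by case: Jz; rewrite (h z) //; case: hJ.
  apply: (IHn a b) => //; first by case: eab.
    apply: h; first by apply: submoduleI => //; apply: submodule_ker.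
      by move=> u [Ju pu]; split=> //; apply: JI.
    by exists z => // -[].
  by apply: length_leW h' => _ [u Ju <-]; exists u => //; apply: JI.
have Jpx : ~ exists2 y, J y & p y = p x.
  move=> [y Jy pxy]; apply: Jx; rewrite -[x](subrK y); apply: submoduleD => //.
  by apply: sub; split; [apply: submoduleB => //; apply: JI | rewrite linearB pxy subrr].
case: b => [|b] in eab h' *.
  case: Jpx; exists 0; first by case: hJ.
  by rewrite linear0 (h' (p x)) //; exists x.
apply: (IHn a b) => //; first by move: eab; rewrite addnS => -[].
  by apply: length_leW h => u [Ju pu]; split=> //; apply: JI.
apply: h'; first exact: submodule_image.
  by move=> _ [u Ju <-]; exists u => //; apply: JI.
by exists (p x) => //; exists x.
Qed.

Lemma length_le_inj M N (i : {linear M -> N}) n (I : M -> Prop) : submodule I ->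
  injective i -> length_le n (fun y => exists2 x, I x & i x = y) -> length_le n I.
Proof.
move=> hI ii h; rewrite -[n]add0n; apply: length_le_ext h => //.
by move=> x [_]; rewrite -{1}(linear0 i) => /ii.
Qed.

Lemma minimal_submodule M (F : (M -> Prop) -> Prop) n I :
  (forall J, F J -> submodule J) -> F I -> length_le n I ->
  exists2 J, F J & forall K, F K -> (forall x, K x -> J x) -> forall x, J x -> K x.
Proof.
move=> hF; elim: n I => [|n IHn] I FI lI.
  exists I => // K FK KI x /lI ->; by case: (hF K FK).
have [min|nmin] := pselect (forall K, F K -> (forall x, K x -> I x) -> forall x, I x -> K x).
  by exists I.
have [K nK] : exists K, ~ (F K -> (forall x, K x -> I x) -> forall x, I x -> K x).
  by apply/existsNP.
move: nK => /not_implyP[FK /not_implyP[KI /existsNP[x /not_implyP[Ix nKx]]]].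
by apply: (IHn K) => //; apply: lI => //; [apply: hF | exists x].
Qed.

(** Without a maximal member one could climb forever, reaching members whose length exceeds any
    given bound. *)
Lemma maximal_element M (F : (M -> Prop) -> Prop) I : finite_length M ->
  (forall J, F J -> submodule J) -> F I ->
  exists2 J, F J & forall K, F K -> (forall x, J x -> K x) -> forall x, K x -> J x.
Proof.
move=> [n lM] hF FI; apply: contrapT => nmax.
have up J : F J -> exists K, [/\ F K, forall x, J x -> K x & exists2 x, K x & ~ J x].
  move=> FJ; apply: contrapT => nK; apply: nmax; exists J => // K FK JK x Kx.
  by apply: contrapT => Jx; apply: nK; exists K; split=> //; exists x.
have [J FJ []] : exists2 J, F J & ~ length_le n J; last by apply: length_leW lM.
elim: n {lM} => [|n [J FJ lJ]].
  have [K [FK _ [x Kx Ix]]] := up I FI; exists K => // l0.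
  by apply: Ix; rewrite (l0 x Kx); case: (hF I FI).
have [K [FK JK [x Kx Jx]]] := up J FJ; exists K => // lK.
by apply: lJ; apply: lK => //; [apply: hF | exists x].
Qed.

Lemma finite_length_sub M N (i : {linear N -> M}) :
  injective i -> finite_length M -> finite_length N.
Proof.
move=> ii [n lM]; exists n; apply: (length_le_inj _ ii) => //.
by apply: length_leW lM.
Qed.

Lemma finite_length_ind (P : lmodType S -> Prop) :
  (forall M, finite_length M ->
     (forall N (i : {linear N -> M}), injective i -> ~ surjective i -> P N) -> P M) ->
  forall M, finite_length M -> P M.
Proof.
move=> h M [n lM]; elim: n M lM => [|n IHn] M lM; apply: h; try by eexists; eassumption.
  by move=> N i _ []; move=> y; exists 0; rewrite linear0 (lM y).
move=> N i ii ni; apply: IHn; apply: (length_le_inj _ ii) => //.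
have [y ny] : exists y, ~ exists x, i x = y by apply/existsNP.
apply: lM => //; first exact: (submodule_image i (@submoduleT S N)).
by exists y => // -[x _ ix]; apply: ny; exists x.
Qed.

Definition fg_submodule M (I : M -> Prop) : Prop :=
  exists n (g : 'I_n -> M), forall x, I x <-> exists c : 'I_n -> S, x = \sum_i c i *: g i.

(** A maximal finitely generated submodule of [I] is all of [I], since one more generator can always
    be added. *)
Lemma finite_length_fg_submodule M (I : M -> Prop) :
  finite_length M -> submodule I -> fg_submodule I.
Proof.
move=> fM hI.
pose F J := [/\ submodule J, fg_submodule J & forall x, J x -> I x].
have F0 : F (fun x => x = 0).
  split; first by split=> // a x y -> ->; rewrite scaler0 addr0.
    exists 0%N, (fun=> 0) => x; split=> [->|[c ->]]; last by rewrite big_ord0.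
    by exists (fun=> 0); rewrite big_ord0.
  by move=> x ->; case: hI.
have [J [hJ [n [g gP]] JI] max] := maximal_element fM (fun J (FJ : F J) => let: And3 h _ _ := FJ in h) F0.
suff IJ x : I x -> J x by exists n, g => x; rewrite -gP; split=> [/IJ|/JI].
move=> Ix.
pose K y := exists u v, [/\ J u, exists a : S, v = a *: x & y = u + v].
have hK : submodule K by apply: submodule_add => //; apply: submodule_cyclic.
have Kx : K x by exists 0, x; rewrite add0r; split=> //; [case: hJ | exists 1; rewrite scale1r].
apply: (max K) => // [|u Ju]; last first.
  by exists u, 0; rewrite addr0; split=> //; exists 0; rewrite scale0r.
split=> // [|_ [u [v [Ju [a ->] ->]]]]; last first.
  by apply: submoduleD => //; [apply: JI | apply: submoduleZ].
exists n.+1, (fun i => if unlift ord_max i is Some j then g j else x) => y.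
have ew (i : 'I_n) : unlift ord_max (widen_ord (leqnSn n) i) = Some i.
  have -> : widen_ord (leqnSn n) i = lift ord_max i by apply: val_inj; rewrite /= /bump leqNgt ltn_ord.
  by rewrite liftK.
have sumE (c : 'I_n.+1 -> S) : \sum_i c i *: (if unlift ord_max i is Some j then g j else x)
    = \sum_(i < n) c (widen_ord (leqnSn n) i) *: g i + c ord_max *: x.
  rewrite big_ord_recr /= unlift_none; congr (_ + _).
  by apply: eq_bigr => i _; rewrite ew.
split=> [[u [v [/gP[c ->] [a ->] ->]]]|[c ->]].
  exists (fun i => if unlift ord_max i is Some j then c j else a).
  by rewrite sumE unlift_none; congr (_ + _); apply: eq_bigr => i _; rewrite ew.
rewrite sumE; exists (\sum_(i < n) c (widen_ord (leqnSn n) i) *: g i), (c ord_max *: x).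
by split=> //; [apply/gP; exists (fun i => c (widen_ord (leqnSn n) i)) | exists (c ord_max)].
Qed.

Lemma fgP M : finitely_generated M <->
  exists n (p : {linear 'rV[S]_n -> M}), surjective p.
Proof.
split=> [[n [g gP]]|[n [p sp]]]; last first.
  exists n, (fun i => p (delta_mx 0 i)) => x; have [c <-] := sp x.
  exists (fun i => c 0 i); rewrite {1}[c]row_sum_delta linear_sum.
  by apply: eq_bigr => i _; rewrite linearZ.
pose f (c : 'rV[S]_n) := \sum_i c 0 i *: g i.
have fl : linear f.
  move=> a c d; rewrite /f scaler_sumr -big_split; apply: eq_bigr => i _ /=.
  by rewrite !mxE scalerDl scalerA.
pose h : {linear 'rV[S]_n -> M} := HB.pack f (GRing.isLinear.Build S _ _ *:%R f fl).
exists n, h => x; have [c ->] := gP x; exists (\row_i c i).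
by apply: eq_bigr => i _; rewrite mxE.
Qed.

Lemma finite_length_fg M : finite_length M -> finitely_generated M.
Proof.
move=> fM; have [n [g gP]] := finite_length_fg_submodule fM (@submoduleT S M).
by exists n, g => x; apply/gP.
Qed.

Lemma fg_quotient M N (p : {linear M -> N}) :
  surjective p -> finitely_generated M -> finitely_generated N.
Proof.
move=> sp /fgP[n [q sq]]; apply/fgP; exists n, (p \o q) => y.
by have [x <-] := sp y; have [c <-] := sq x; exists c.
Qed.

Lemma rV_fg n : finitely_generated 'rV[S]_n.
Proof. by apply/fgP; exists n, idfun => x; exists x. Qed.

End Length.

(* The rings of the two modules may differ: this transfers finite length
   from the base ring of an Artin algebra. *)
Lemma length_le_transfer (R S : pzRingType) (N : lmodType R) (M : lmodType S)
    (t : {additive N -> M}) n (I : M -> Prop) :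
  (forall J, submodule J -> submodule (fun x => J (t x))) -> surjective t ->
  length_le n (fun x => I (t x)) -> length_le n I.
Proof.
move=> ht st; elim: n I => [|n IHn] I /= h.
  by move=> y; have [x <-] := st y => /h ->; rewrite raddf0.
move=> J hJ JI [y Iy Jy]; apply: IHn; apply: h; first exact: ht.
  by move=> x /JI.
by have [x tx] := st y; exists x; rewrite tx.
Qed.

(** * Artin algebras have finite length *)
Lemma artinian_minimal (k : comPzRingType) (F : (k^o -> Prop) -> Prop) I :
  artinian k -> (forall J, F J -> submodule J) -> F I ->
  exists2 J, F J & forall K, F K -> (forall x, K x -> J x) -> forall x, J x -> K x.
Proof.
move=> ak hF FI; apply: contrapT => nmin.
have down (J : {J | F J}) : exists K : {K | F K},
    (forall x, sval K x -> sval J x) /\ exists2 x, sval J x & ~ sval K x.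
  case: J => J FJ /=; apply: contrapT => nK; apply: nmin; exists J => // K FK KJ x Jx.
  apply: contrapT => Kx; apply: nK; exists (exist _ K FK).
  by split=> //; exists x.
have [next nextP] := choice down.
pose s n := sval (iter n next (exist _ I FI)).
have [||n nP] := ak s.
- by move=> n; apply: hF; exact: svalP.
- by move=> n x; rewrite /s iterS => h; have [+ _] := nextP (iter n next (exist _ I FI)); apply.
have [_ [x Ix nx]] := nextP (iter n next (exist _ I FI)).
by apply: nx; apply: (nP n.+1 (leqnSn n) x Ix).
Qed.

Lemma maximal_submodule_in (k : pzRingType) (M : lmodType k) (B ok : M -> Prop) :
  submodule B -> (forall x, B x -> ok x) ->
  exists W : M -> Prop, [/\ submodule W, forall x, B x -> W x, forall x, W x -> ok x
    & forall J, submodule J -> (forall x, W x -> J x) -> (forall x, J x -> ok x) ->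
      forall x, J x -> W x].
Proof.
move=> hB Bok.
(* Taking [B \/ A] instead of [A] makes the empty chain harmless: its union then stands for [B]. *)
pose P (A : set M) := let A' x := B x \/ A x in submodule A' /\ forall x, A' x -> ok x.
have [|A [[hA Aok] Amax]] := @Zorn_bigcup M P; last first.
  exists (fun x => B x \/ A x); split; [exact: hA | by left | exact: Aok |].
  move=> J hJ WJ Jok x Jx; right; apply: contrapT => nAx.
  apply: (Amax J).
    by split=> [y Ay|/(_ x Jx)//]; apply: WJ; right.
  have JE : (fun x => B x \/ J x) = J.
    by apply/predeqP => y; split=> [[By|//]|Jy]; [apply: WJ; left | right].
  by split; [rewrite JE | move=> y [/Bok|/Jok]].
move=> F FP tot.
have [->|/set0P[A0 FA0]] := eqVneq F set0.
  rewrite bigcup_set0; have BE : (fun x => B x \/ set0 x) = B.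
    by apply/funext => x; apply/propext; split=> [[|[]]|Bx] //; left.
  by split; [rewrite BE | move=> x [/Bok|[]]].
split; last by move=> x [/Bok//|[A FA Ax]]; have [_ h] := FP A FA; apply: h; right.
split=> [|a x y hx hy]; first by left; case: hB.
have [A [FA hAx hAy]] : exists A, [/\ F A, B x \/ A x & B y \/ A y].
  case: hx => [Bx|[A FA Ax]]; case: hy => [By|[A' FA' Ay]].
  - by exists A0; split=> //; left.
  - by exists A'; split=> //; [left|right].
  - by exists A; split=> //; [right|left].
  - have [sub|sub] := tot A A' FA FA'; [exists A' | exists A]; split=> //; right => //; exact: sub.
have [[_ h] _] := FP A FA.
by case: (h a x y hAx hAy) => [|hA]; [left | right; exists A].
Qed.

(* The smallest ideal with quotient of finite length is zero: otherwise it
   would have a maximal proper subideal. *)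
Lemma artinian_finite_length (k : comPzRingType) : artinian k -> finite_length k^o.
Proof.
move=> ak.
pose F (I : k^o -> Prop) := exists (N : lmodType k) (p : {linear k^o -> N}),
  [/\ surjective p, finite_length N & forall x, I x <-> p x = 0].
have hF J : F J -> submodule J.
  move=> [N [p [_ _ JP]]]; have [h0 h] := submodule_ker p.
  by split=> [|a x y]; rewrite !JP; [ | apply: h].
have FT : F (fun _ => True).
  have [N [p [sp pP]]] := quot_exists (@submoduleT k k^o).
  exists N, p; split=> [//||x]; last by rewrite pP.
  exists 0%N => y _; have [x <-] := sp y; exact/pP.
have [I0 FI0 I0min] := artinian_minimal ak hF FT.
have hI0 := hF _ FI0.
suff I00 x : I0 x -> x = 0.
  have [N [p [sp [n lN] pP]]] := FI0.
  exists n; rewrite -[n]add0n; apply: (length_le_ext (p := p)) => //.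
    by move=> x [_ /pP]; apply: I00.
  by apply: length_leW lN.
move=> I0x; apply: contrapT => x0.
pose F2 (J : k^o -> Prop) := submodule J /\ exists y z : k, [/\ J y, I0 z & y * z <> 0].
have F2T : F2 (fun _ => True) by split=> //; exists 1, x; rewrite mul1r.
have [J [hJ [y [z [Jy I0z yz]]]] Jmin] :=
  artinian_minimal ak (fun J (FJ : F2 J) => let: conj h _ := FJ in h) F2T.
(* [J] is minimal among the ideals that do not annihilate [I0], and [p] is the annihilator of
   [y I0]. Minimality makes every element outside [p] invertible modulo [p], so [k / p] is a
   field. *)
pose p (r : k) := forall w : k, I0 w -> r * y * w = 0.
have pinv r : ~ p r -> exists s, p (1 - s * r).
  move=> /existsNP[w /not_implyP[I0w ryw]].
  have [s ys] : exists s : k, (y : k^o) = s *: (r * y : k^o).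
    apply: (Jmin (fun v => exists a : k, v = a *: (r * y : k^o))) => //.
      split; first exact: submodule_cyclic.
      by exists (r * y), w; split=> //; exists 1; rewrite scale1r.
    by move=> _ [a ->]; apply: submoduleZ => //; apply: (submoduleZ r hJ Jy).
  exists s => u _; have ys' : y = s * (r * y) := ys.
  by rewrite mulrBl mul1r -mulrA -ys' subrr mul0r.
(* Since [p I0] lies in [B], the quotient [I0 / B] is a vector space over [k / p]. A subspace
   maximal among those missing the nonzero class of [z] is a hyperplane; this is the [W] below. *)
pose B (w : k^o) := I0 w /\ y * w = 0.
have hB : submodule B.
  split=> [|a u v [Iu yu] [Iv yv]]; first by rewrite /B mulr0; case: hI0.
  split; first by apply: submoduleD => //; apply: submoduleZ.
  by rewrite mulrDr yv addr0 [a *: u](_ : _ = a * u) // mulrCA yu mulr0.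
(* Zorn on the ideals between [B] and [I0] that avoid [z] *)
have [|W [hW BW WIz Wmax0]] := @maximal_submodule_in k k^o B (fun w => I0 w /\ w <> z) hB.
  by move=> w [I0w yw]; split=> // wz; apply: yz; rewrite -wz.
have WI0 w : W w -> I0 w by case/WIz.
have Wz : ~ W z by case/WIz.
have Wmax K : submodule K -> (forall w, W w -> K w) -> (forall w, K w -> I0 w) -> ~ K z ->
    forall w, K w -> W w.
  move=> hK WK KI Kz; apply: Wmax0 => // w Kw; split; first exact: KI.
  by move=> wz; apply: Kz; rewrite -wz.
(* [k / W] extends [k / I0] by the simple module [I0 / W], so its length grows by at most one.
   Minimality of [I0] then forces [z] into [W]. *)
have FW : F W.
  have [N [q [sq [n lN] qP]]] := FI0.
  have [N' [q' [sq' q'P]]] := quot_exists hW.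
  exists N', q'; split=> // [|w]; last by split=> /q'P.
  have [|g gP] := factor_epi (f := q) sq'; first by move=> w /q'P/WI0/qP.
  exists (1 + n)%N; apply: (length_le_ext (p := g)) => //; last first.
    by apply: length_leW lN.
  move=> K hK KI [v [_ gv] Kv] /= t Kt.
  have [v' vE] := sq' v; have [t' tE] := sq' t.
  rewrite -tE; apply/q'P; apply: contrapT => nWt.
  have sub u : K (q' u) -> W u.
    apply: (Wmax (fun u => K (q' u))) => //.
    - exact: submodule_preim.
    - by move=> w /q'P ->; case: hK.
    - by move=> w /KI[_]; rewrite gP => /qP.
    move=> Kz; apply: Kv; rewrite -vE.
    have I0v : I0 v' by apply/qP; rewrite -gP vE.
    have hKq := submodule_preim q' hK.
    have WK w : W w -> K (q' w) by move=> /q'P ->; case: hK.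
    have [Wv|nWv] := pselect (W v'); first exact: WK.
    (* [W + k v'] is strictly larger than [W], hence contains [z] *)
    have [w [_ [Ww [r ->] zE]]] : exists w u, [/\ W w, exists a : k, u = a *: (v' : k^o) & z = w + u].
      apply: contrapT => nz; apply: nWv.
      apply: (Wmax (fun z => exists w u, [/\ W w, exists a : k, u = a *: (v' : k^o) & z = w + u])) => //.
      - by apply: submodule_add => //; apply: submodule_cyclic.
      - by move=> w Ww; exists w, 0; rewrite addr0; split=> //; exists 0; rewrite scale0r.
      - move=> _ [w [_ [Ww [a ->] ->]]]; apply: submoduleD => //; first exact: WI0.
        exact: submoduleZ.
      by exists 0, v'; rewrite add0r; split=> //; [case: hW | exists 1; rewrite scale1r].
    have npr : ~ p r.
      move=> pr; apply: Wz; rewrite zE; apply: submoduleD => //; apply: BW; split.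
        exact: submoduleZ.
      by rewrite [r *: v'](_ : _ = r * v') // mulrCA mulrA pr.
    have [s ps] := pinv r npr.
    have -> : v' = (1 - s * r) *: (v' : k^o) + s *: ((z : k^o) - w).
      by rewrite zE addrAC subrr add0r scalerA -scalerDl subrK scale1r.
    apply: (submoduleD hKq); last first.
      by apply: (submoduleZ s hKq); apply: (submoduleB hKq) => //; apply: WK.
    apply: WK; apply: BW; split; first exact: submoduleZ.
    by rewrite [_ *: v'](_ : _ = (1 - s * r) * v') // mulrCA mulrA ps.
  by apply: nWt; apply: sub; rewrite tE.
by apply: Wz; apply: (I0min W FW).
Qed.

Lemma finite_length_rV (k : pzRingType) n : finite_length k^o -> finite_length 'rV[k]_n.
Proof.
move=> [a la]; elim: n => [|n [b lb]].
  by exists 0%N => x _; apply/rowP => -[].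
pose p (x : 'rV[k]_(1 + n)) : k^o := x 0 0.
have pl : linear p by move=> c x y; rewrite /p !mxE.
pose h : {linear 'rV[k]_(1 + n) -> k^o} := HB.pack p (GRing.isLinear.Build k _ _ *:%R p pl).
exists (b + a)%N; apply: (length_le_ext (p := h)) => //; last by apply: length_leW la.
pose q (x : 'rV[k]_(1 + n)) : 'rV[k]_n := rsubmx x.
have ql : linear q by move=> c x y; rewrite /q linearP.
pose h' : {linear 'rV[k]_(1 + n) -> 'rV[k]_n} := HB.pack q (GRing.isLinear.Build k _ _ *:%R q ql).
rewrite -[b]add0n; apply: (length_le_ext (p := h')).
- by apply: submoduleI => //; apply: submodule_ker.
- move=> x [[_ hx] h'x]; have x0 : x 0 0 = 0 by exact: hx.
  have q0 : rsubmx x = 0 by exact: h'x.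
  apply/rowP => i; rewrite -(splitK i); case: (split i) => j /=.
    by rewrite ord1 mxE -x0; congr (x _ _); apply: val_inj.
  by have := congr1 (fun y : 'rV_n => y 0 j) q0; rewrite !mxE => ->.
by apply: length_leW lb.
Qed.

(** The products [g i *: h j] generate [M] over [k], so [M] is a semilinear image of [k^(n m)].
    [phi] is a bare function so that one statement covers both [A] and its converse ring; it is
    multiplicative into the latter because [k] is commutative. *)
Lemma finite_length_over (k : comPzRingType) (R : pzRingType) (phi : k -> R) n (g : 'I_n -> R)
    (M : lmodType R) :
  (forall a b, phi (a + b) = phi a + phi b) -> (forall a b, phi (a * b) = phi a * phi b) ->
  (forall a, exists c : 'I_n -> k, a = \sum_i phi (c i) * g i) ->
  artinian k -> finitely_generated M -> finite_length M.
Proof.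
move=> phiD phiM gP ak [m [h hP]].
have phi0 : phi 0 = 0 by apply: (addIr (phi 0)); rewrite -phiD !add0r.
pose t (x : 'rV[k]_(n * m)) : M := \sum_i \sum_j (phi (vec_mx x i j) * g i) *: h j.
have tP a x y : t (a *: x + y) = phi a *: t x + t y.
  rewrite /t scaler_sumr -big_split; apply: eq_bigr => i _.
  rewrite scaler_sumr -big_split; apply: eq_bigr => j _ /=.
  by rewrite linearP !mxE phiD phiM mulrDl scalerDl !scalerA mulrA.
have t0 : t 0 = 0.
  by rewrite /t big1 // => i _; rewrite big1 // => j _; rewrite linear0 mxE phi0 mul0r scale0r.
have phi1 x : phi 1 *: t x = t x by have := tP 1 x 0; rewrite scale1r !addr0 t0 addr0.
have tadd : zmod_morphism t.
  move=> x y; rewrite [x - y]addrC -scaleN1r tP addrC; congr (_ + _).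
  apply: (addIr (t y)); rewrite addNr -[X in _ + X]phi1 -scalerDl -phiD addNr phi0 scale0r //.
pose T : {additive 'rV[k]_(n * m) -> M} := HB.pack t (GRing.isZmodMorphism.Build _ _ t tadd).
have [l lk] := finite_length_rV (n * m) (artinian_finite_length ak).
exists l; apply: (length_le_transfer (t := T)) => //.
  move=> J hJ; split; first by rewrite raddf0; case: hJ.
  by move=> a x y Jx Jy; have := tP a x y; rewrite -[t (_ + _)]/(T _) => ->; case: hJ => _; apply.
move=> x; have [c ->] := hP x.
have [d dP] := choice (fun j => gP (c j)).
exists (mxvec (\matrix_(i, j) d j i)); rewrite [LHS]/(t _) /t exchange_big.
apply: eq_bigr => j _; rewrite mxvecK [in RHS]dP scaler_suml.
by apply: eq_bigr => i _; rewrite mxE.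
Qed.

Lemma artin_algebra_finite_length (A : pzRingType) : artin_algebra A ->
  (forall M : lmodType A, finitely_generated M -> finite_length M) /\
  (forall M : lmodType A^c, finitely_generated M -> finite_length M).
Proof.
move=> [k [phi [ak phiC [n [g gP]]]]]; split=> M fgM.
  by apply: (finite_length_over (phi := phi) (g := g)) => //; [apply: rmorphD | apply: rmorphM].
apply: (finite_length_over (phi := phi : k -> A^c) (g := g : 'I_n -> A^c) _ _ _ ak fgM).
- by move=> a b; apply: (rmorphD phi).
- by move=> a b; rewrite mulrC; apply: (rmorphM phi).
- move=> a; have [c ->] := gP a; exists c; apply: eq_bigr => i _; exact: phiC.
Qed.

(** * Vanishing of Ext and coreflexive modules *)
Section Rows.
Variable S : pzRingType.

Definition row_map n (M : lmodType S) (h : 'I_n -> {linear M -> S^o}) (x : M) : 'rV[S]_n :=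
  \row_i h i x.
Lemma row_map_linear n (M : lmodType S) (h : 'I_n -> {linear M -> S^o}) : linear (row_map h).
Proof. by move=> a x y; apply/rowP => i; rewrite !mxE linearP. Qed.
HB.instance Definition _ n (M : lmodType S) (h : 'I_n -> {linear M -> S^o}) :=
  GRing.isLinear.Build S M 'rV[S]_n *:%R (row_map h) (row_map_linear h).

Definition row_coord n (i : 'I_n) (c : 'rV[S]_n) : S^o := c 0 i.
Lemma row_coord_linear n (i : 'I_n) : linear (row_coord i).
Proof. by move=> a x y; rewrite /row_coord !mxE. Qed.
HB.instance Definition _ n (i : 'I_n) :=
  GRing.isLinear.Build S 'rV[S]_n S^o *:%R (row_coord i) (row_coord_linear i).

Definition row_comb (M : lmodType S) n (g : 'I_n -> M) (c : 'rV[S]_n) : M :=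
  \sum_i c 0 i *: g i.
Lemma row_comb_linear (M : lmodType S) n (g : 'I_n -> M) : linear (row_comb g).
Proof.
move=> a c d; rewrite /row_comb scaler_sumr -big_split; apply: eq_bigr => i _ /=.
by rewrite !mxE scalerDl scalerA.
Qed.
HB.instance Definition _ (M : lmodType S) n (g : 'I_n -> M) :=
  GRing.isLinear.Build S 'rV[S]_n M *:%R (row_comb g) (row_comb_linear g).

Lemma row_comb_delta (M : lmodType S) n (g : 'I_n -> M) i : row_comb g (delta_mx 0 i) = g i.
Proof.
rewrite /row_comb (bigD1 i) //= mxE !eqxx scale1r big1 ?addr0 // => j ji.
by rewrite mxE (negPf ji) andbF scale0r.
Qed.

Lemma linear_rV_ext (M : lmodType S) n (f g : {linear 'rV[S]_n -> M}) :
  (forall i, f (delta_mx 0 i) = g (delta_mx 0 i)) -> f =1 g.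
Proof.
move=> fg c; rewrite [c]row_sum_delta !linear_sum; apply: eq_bigr => i _.
by rewrite !linearZ fg.
Qed.

Lemma linear_rVE n (f : {linear 'rV[S]_n -> S^o}) c :
  f c = (c *m \col_j f (delta_mx 0 j)) 0 0.
Proof.
rewrite {1}[c]row_sum_delta linear_sum mxE; apply: eq_bigr => i _.
by rewrite linearZ mxE.
Qed.

Definition dot n (c : 'cV[S]_n) (y : 'rV[S]_n) : S^o := (y *m c) 0 0.
Lemma dot_linear n (c : 'cV[S]_n) : linear (dot c).
Proof. by move=> a x y; rewrite /dot mulmxDl -scalemxAl !mxE. Qed.
HB.instance Definition _ n (c : 'cV[S]_n) :=
  GRing.isLinear.Build S 'rV[S]_n S^o *:%R (dot c) (dot_linear c).

Lemma rV_projective n : projective 'rV[S]_n.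
Proof.
move=> M N p f sp; have [m mP] := choice (fun i => sp (f (delta_mx 0 i))).
exists (row_comb m); apply: (@linear_rV_ext N n (p \o row_comb m) f) => i /=.
by rewrite row_comb_delta mP.
Qed.

Lemma rV_fg_projective n : fg_projective 'rV[S]_n.
Proof. by split; [apply: rV_fg | apply: rV_projective]. Qed.

Lemma projective_retract (P Q : lmodType S) (s : {linear Q -> P}) (r : {linear P -> Q}) :
  cancel s r -> projective P -> projective Q.
Proof.
move=> sr pP M N p f sp; have [g gP] := pP M N p (f \o r) sp.
by exists (g \o s) => x /=; rewrite gP /= sr.
Qed.

Lemma fg_retract (P Q : lmodType S) (s : {linear Q -> P}) (r : {linear P -> Q}) :
  cancel s r -> finitely_generated P -> finitely_generated Q.
Proof. by move=> sr; apply: (fg_quotient (p := r)) => y; exists (s y). Qed.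

Lemma fg_projective_retract (P Q : lmodType S) (s : {linear Q -> P}) (r : {linear P -> Q}) :
  cancel s r -> fg_projective P -> fg_projective Q.
Proof. by move=> sr [fP pP]; split; [apply: fg_retract sr fP | apply: projective_retract sr pP]. Qed.

Lemma fg_projective_summand (P : lmodType S) : fg_projective P ->
  exists n (s : {linear P -> 'rV[S]_n}) (r : {linear 'rV[S]_n -> P}), cancel s r.
Proof. by move=> [/fgP[n [r sr]] pP]; have [s sP] := pP _ _ r idfun sr; exists n, s, r. Qed.

Lemma fg_projective_separated (P : lmodType S) (x : P) : fg_projective P ->
  (forall h : {linear P -> S^o}, h x = 0) -> x = 0.
Proof.
move=> /fg_projective_summand[n [s [r sr]]] hx; rewrite -[x]sr (_ : s x = 0) ?linear0 //.
by apply/rowP => i; rewrite mxE; apply: (hx (row_coord i \o s)).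
Qed.

End Rows.

Section Gprj.
Variable S : pzRingType.
Implicit Types G M L P Q X Y Z : lmodType S.

(** A form on the image of [l] is encoded as a form on [L] vanishing on the kernel of [l]. This lets
    differentials of complexes be used directly, without naming their images. *)
Definition extendable L M (l : {linear L -> M}) : Prop :=
  forall f : {linear L -> S^o}, (forall y, l y = 0 -> f y = 0) ->
    exists g : {linear M -> S^o}, forall y, g (l y) = f y.

Lemma extendable_projective L M (l : {linear L -> M}) Q (f : {linear L -> Q}) :
  extendable l -> fg_projective Q -> (forall y, l y = 0 -> f y = 0) ->
  exists g : {linear M -> Q}, forall y, g (l y) = f y.
Proof.
move=> el /fg_projective_summand[n [s [r sr]]] lf.
have [|g gP] := choice (fun i : 'I_n => _ : exists g : {linear M -> S^o},
    forall y, g (l y) = row_coord i (s (f y))).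
  by move=> i; apply: (el (row_coord i \o s \o f)) => y /lf /= ->; rewrite !linear0.
exists (r \o row_map g) => y /=; rewrite (_ : row_map g (l y) = s (f y)) //.
by apply/rowP => i; rewrite mxE gP.
Qed.

(* [Ext^1(G, S) = 0]; [l] is not required to be injective. *)
Definition ext1_vanishes G : Prop :=
  forall M L (l : {linear L -> M}) (p : {linear M -> G}), surjective p ->
    (forall x, p x = 0 <-> exists y, l y = x) -> extendable l.

(* [G] is the kernel of a map between projectives which is also exact after
   dualizing: the last condition says that [P / G] is torsionless. *)
Definition coreflexive G : Prop :=
  exists P (j : {linear G -> P}), [/\ fg_projective P, injective j, extendable j
    & forall y, (forall h : {linear P -> S^o}, (forall x, h (j x) = 0) -> h y = 0) ->
        exists x, j x = y].

Definition torsionless G : Prop :=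
  exists n (e : {linear G -> 'rV[S]_n}), injective e.

Lemma torsionless_fg_projective G P (e : {linear G -> P}) :
  fg_projective P -> injective e -> torsionless G.
Proof.
move=> /fg_projective_summand[n [s [r sr]]] ie.
by exists n, (s \o e); apply: inj_comp ie; apply: can_inj sr.
Qed.

Lemma torsionless_sub G L (i : {linear L -> G}) : injective i -> torsionless G -> torsionless L.
Proof. by move=> ii [n [e ie]]; exists n, (e \o i); apply: inj_comp ie ii. Qed.

Lemma coreflexive_torsionless G : coreflexive G -> torsionless G.
Proof. by move=> [P [j [fP ij _ _]]]; apply: torsionless_fg_projective fP ij. Qed.

Lemma projective_ext1 P : projective P -> ext1_vanishes P.
Proof.
move=> pP M L l p sp lp f lf; have [s sP] := pP _ _ p idfun sp.
have [||z [y ly <-]|g gP] := @linear_of_graph S M S^o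
    (fun x z => exists2 y, l y = x - s (p x) & f y = z).
- move=> x; have [y ly] : exists y, l y = x - s (p x).
    by apply/lp; rewrite linearB sP subrr.
  by exists (f y), y.
- move=> a x z x' z' [y ly <-] [y' ly' <-]; exists (a *: y + y'); last by rewrite linearP.
  by rewrite !linearP ly ly' scalerBr addrACA -scalerN -!linearP.
- by apply: lf; rewrite ly !linear0 addr0.
exists g => y; have [y' ly' <-] := gP (l y); apply/subr0_eq; rewrite -linearB lf //.
have ply : p (l y) = 0 by apply/lp; exists y.
by rewrite linearB ly' ply !linear0 addr0 subrr.
Qed.

Lemma projective_coreflexive P : fg_projective P -> coreflexive P.
Proof.
move=> fP; exists P, idfun; split=> // [f _|y _]; first by exists f.
by exists y.
Qed.

(** The pullback of [p] along [r] is an extension of [Y] with the same kernel. A form extends there,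
    and restricting along [x |-> (x, s (p x))] brings it back to [M]. *)
Lemma ext1_retract G Y (s : {linear G -> Y}) (r : {linear Y -> G}) :
  cancel s r -> ext1_vanishes Y -> ext1_vanishes G.
Proof.
move=> sr eY M L l p sp lp f lf.
(* pull [p] back along [r] *)
have hI : submodule (fun z : (M * Y)%type => p z.1 = r z.2).
  split=> [|a [x y] [x' y'] /= e e']; first by rewrite !linear0.
  by rewrite !linearP e e'.
have [N [i [ii iP]]] := sub_exists hI.
have [|u uP] := factor_mono (f := pair_map l \0) ii.
  by move=> y; apply/iP; rewrite /= (proj2 (lp _)) ?linear0 //; exists y.
have [|v vP] := factor_mono (f := pair_map idfun (s \o p)) ii.
  by move=> x; apply/iP; rewrite /= sr.
have [|||g gP] := eY N L u (snd \o i) _ _ f.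
- move=> y; have [x px] := sp (r y).
  have [z zP] := proj1 (iP (x, y)) px.
  by exists z; rewrite /= zP.
- move=> z; split=> [z2|[y <-]]; last by rewrite /= uP.
  have pi : p (i z).1 = r (i z).2 by apply/iP; exists z.
  have /lp[y ly] : p (i z).1 = 0 by rewrite pi [(i z).2]z2 linear0.
  exists y; apply: ii; rewrite uP [RHS]surjective_pairing /=.
  by congr (_, _); [exact: ly | rewrite [RHS]z2].
- move=> y uy; apply: lf; have := uP y; rewrite uy linear0 => /(congr1 fst) /= ->//.
exists (g \o v) => y; rewrite /= -gP; congr (g _); apply: ii; rewrite vP uP; congr (_, _) => /=.
by rewrite (proj2 (lp _)) ?linear0 //; exists y.
Qed.

(** The form is extended in two stages, through the preimage [N] of [X] in [M]: [M / N] is [Z], and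
    [N] modulo the image of [L] is [X]. *)
Lemma ext1_extension X Y Z (i : {linear X -> Y}) (q : {linear Y -> Z}) :
  short_exact i q -> ext1_vanishes X -> ext1_vanishes Z -> ext1_vanishes Y.
Proof.
move=> [ii sq iq] eX eZ M L l p sp lp f lf.
have hI : submodule (fun x => q (p x) = 0) by apply: (submodule_ker (q \o p)).
have [N [k [ik kP]]] := sub_exists hI.
have [|u uP] := factor_mono (f := l) ik.
  by move=> y; apply/kP; rewrite (proj2 (lp _)) ?linear0 //; exists y.
have [|v vP] := factor_mono (f := p \o k) ii.
  by move=> y; apply/iq; apply/kP; exists y.
have [|||g gP] := eX N L u v _ _ f.
- move=> x; have [m pm] := sp (i x).
  have [y ky] : exists y, k y = m by apply/kP; rewrite pm; apply/iq; exists x.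
  by exists y; apply: ii; rewrite vP /= ky.
- move=> y; split=> [vy|[z <-]].
    have [z lz] : exists z, l z = k y by apply/lp; have /= <- := vP y; rewrite vy linear0.
    by exists z; apply: ik; rewrite uP.
  by apply: ii; rewrite vP /= uP linear0; apply/lp; exists z.
- by move=> y uy; apply: lf; rewrite -uP uy linear0.
have [|||h hP] := eZ M N k (q \o p) _ _ g.
- by move=> z; have [y <-] := sq z; have [x <-] := sp y; exists x.
- by move=> x; rewrite -kP.
- by move=> y ky; rewrite (_ : y = 0) ?linear0 //; apply: ik; rewrite ky linear0.
by exists h => y; rewrite -uP hP gP.
Qed.

(** Horseshoe construction: [Ext^1(Z, S) = 0] extends [jX] to a map [a] on [Y], and [Y] embeds into
    [PX * PZ] by [a] and [jZ \o q]. *)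
Lemma coreflexive_extension X Y Z (i : {linear X -> Y}) (q : {linear Y -> Z}) :
  short_exact i q -> ext1_vanishes Z -> coreflexive X -> coreflexive Z -> coreflexive Y.
Proof.
move=> [ii sq iq] eZ [PX [jX [fX ijX eX sX]]] [PZ [jZ [fZ ijZ eZ' sZ]]].
have i0 x : i x = 0 -> x = 0 by move=> ix; apply: ii; rewrite ix linear0.
have eI : extendable i by apply: (eZ _ _ i q sq) => x; apply: iq.
have [a aP] : exists a : {linear Y -> PX}, forall x, a (i x) = jX x.
  by apply: extendable_projective => // x /i0 ->; rewrite linear0.
exists (PX * PZ)%type, (pair_map a (jZ \o q)).
have qi x : q (i x) = 0 by apply/iq; exists x.
have factor_q (f : {linear Y -> S^o}) : (forall x, f (i x) = 0) ->
    exists h : {linear PZ -> S^o}, forall y, h (jZ (q y)) = f y.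
  move=> fi; have [|h hP] := factor_epi (f := f) sq.
    by move=> y /iq[x <-].
  have [|h' h'P] := eZ' h; first by move=> z; rewrite -(linear0 jZ) => /ijZ ->; rewrite linear0.
  by exists h' => y; rewrite h'P hP.
split.
- exact: fg_projective_prod.
- move=> y y' [ay qy]; apply/subr0_eq.
  have [x ix] : exists x, i x = y - y'.
    by apply/iq; rewrite linearB (ijZ _ _ qy) subrr.
  rewrite -ix (_ : x = 0) ?linear0 //; apply: ijX.
  by rewrite -aP ix linearB ay subrr linear0.
- move=> f _; have [|h hP] := eX (f \o i).
    by move=> x; rewrite -(linear0 jX) => /ijX -> /=; rewrite !linear0.
  have [|h' h'P] := factor_q (f \- (h \o a)).
    by move=> x /=; rewrite aP hP subrr.
  by exists ((h \o fst) \+ (h' \o snd)) => y /=; rewrite h'P /= addrC subrK.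
- move=> [y1 y2] yP.
  have [z jz] : exists z, jZ z = y2.
    by apply: sZ => h hj; apply: (yP (h \o snd)) => x /=; apply: hj.
  have [y qy] := sq z.
  have [x jx] : exists x, jX x = y1 - a y.
    apply: sX => h hj.
    have [|h' h'P] := factor_q (h \o a); first by move=> x /=; rewrite aP.
    (* A form [h] killing [jX] makes [h \o a] factor through [Z] and extend to [h'] on [PZ]. Then
       [h - h'] kills [Y], hence also [(y1, y2)], which reads [h y1 = h (a y)]. *)
    have := yP ((h \o fst) \- (h' \o snd)) => /= e.
    rewrite linearB; apply: (etrans _ (e _)); last by move=> w; rewrite h'P subrr.
    by rewrite -jz -qy h'P.
  exists (y + i x); congr (_, _); first by rewrite linearD aP jx addrC subrK.
  by rewrite /= [q _]linearD qi addr0 qy jz.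
Qed.

Lemma coreflexive_retract G Y (s : {linear G -> Y}) (r : {linear Y -> G}) :
  cancel s r -> coreflexive Y -> coreflexive G.
Proof.
move=> sr [P [j [fP ij eP sP]]].
have j0 x : j x = 0 -> x = 0 by move=> jx; apply: ij; rewrite jx linear0.
exists P, (j \o s); split=> //.
- by apply: inj_comp ij (can_inj sr).
- move=> f _; have [|g gP] := eP (f \o r); first by move=> y /j0 ->; rewrite linear0.
  by exists g => y; rewrite /= gP /= sr.
- move=> y yP; have [z jz] : exists z, j z = y.
    by apply: sP => h hj; apply: yP => x /=.
  exists (r z); rewrite /= -jz; congr (j _); apply/eqP; rewrite -subr_eq0; apply/eqP/j0.
  (* The map [j (s r - 1)] on [Y] extends to an endomorphism [h] of [P]. Any form after [h] vanishes
     on [j s G], hence at [y], so [h y = 0], that is [j (s (r z)) = j z]. *)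
  have [|h hP] := extendable_projective (f := j \o ((s \o r) \- idfun)) eP fP.
    by move=> x /j0 ->; rewrite linear0.
  have /= <- := hP z; rewrite jz; apply: fg_projective_separated => // u.
  by apply: (yP (u \o h)) => x /=; rewrite hP /= sr subrr !linear0.
Qed.

Section FromComplex.
Variable G : lmodType S.
Hypothesis GP : gorenstein_projective G.

Lemma gorenstein_projective_presentation :
  exists (P0 P1 P2 P3 P4 : lmodType S) (d0 : {linear P0 -> P1}) (d1 : {linear P1 -> P2})
      (d2 : {linear P2 -> P3}) (d3 : {linear P3 -> P4}) (j : {linear G -> P3}),
    [/\ [/\ fg_projective P1, fg_projective P2, fg_projective P3 & fg_projective P4],
        [/\ forall x, d1 x = 0 <-> exists y, d0 y = x,
            forall x, d2 x = 0 <-> exists y, d1 y = x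
          & forall x, d3 x = 0 <-> exists y, d2 y = x],
        extendable d1, extendable d2
      & injective j /\ forall x, d3 x = 0 <-> exists y, j y = x].
Proof.
have [P [d [[fP dP eP] [i [j [ij jP]]]]]] := GP.
(* The later lemmas need three differentials to the left of the term containing [G]; indices are
   reached by adding 1 because the type of a differential mentions [i + 1]. *)
have [i' iE] : exists i', i = i' + 1 + 1 + 1 by exists (i - 1 - 1 - 1); rewrite !subrK.
subst i.
have ext k : extendable (d (k + 1)).
  by move=> f hf; apply/eP => x; apply: hf; apply/dP; exists x.
by exists (P i'), _, _, _, _, (d i'), (d _), (d _), (d _), j; split.
Qed.

Lemma gorenstein_projective_fg : finitely_generated G.
Proof.
have [P0 [P1 [P2 [P3 [P4 [d0 [d1 [d2 [d3 [j [[_ [f2 _] _ _] [_ _ e3] _ _ [ij jP]]]]]]]]]]]] :=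
  gorenstein_projective_presentation.
have [|g gP] := factor_mono (f := d2) ij.
  by move=> x; apply/jP/e3; exists x.
apply: (fg_quotient (p := g)) f2 => x.
have [y dy] : exists y, d2 y = j x by apply/e3/jP; exists x.
by exists y; apply: ij; rewrite gP.
Qed.

(** Lift the cover [g] of [G] by [P2] to [a] into [M]. Then [a \o d1] lands in the image of [l], and
    [f] becomes a form on [P1] killing the image of [d0]; dual exactness extends it to a form [h] on
    [P2]. *)
Lemma gorenstein_projective_ext1 : ext1_vanishes G.
Proof.
have [P0 [P1 [P2 [P3 [P4 [d0 [d1 [d2 [d3 [j [[f1 f2 _ _] [e1 e2 e3] x1 _ [ij jP]]]]]]]]]]]] :=
  gorenstein_projective_presentation.
have [|g gP] := factor_mono (f := d2) ij.
  by move=> x; apply/jP/e3; exists x.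
move=> M L l p sp lp f lf.
have [a aP] := (proj2 f2) _ _ p g sp.
have [L' [k [ik kP]]] := sub_exists (submodule_im l).
have [|t tP] := factor_mono (f := l) ik; first by move=> y; apply/kP; exists y.
have st : surjective t.
  by move=> z; have [y ly] := proj2 (kP (k z)) (ex_intro _ z erefl); exists y; apply: ik; rewrite tP.
have [|f' f'P] := factor_epi (f := f) st.
  by move=> y ty; apply: lf; rewrite -tP ty linear0.
have [|b bP] := factor_mono (f := a \o d1) ik.
  move=> x; apply/kP/lp; rewrite /= aP; apply: ij; rewrite gP linear0.
  by apply/e2; exists x.
have [|h hP] := x1 (f' \o b).
  move=> x /e1[y <-] /=; rewrite (_ : b (d0 y) = 0) ?linear0 //; apply: ik.
  by rewrite bP /= (proj2 (e1 _)) ?linear0 //; exists y.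
(* [M] is the sum of the image of [l] and that of [a]; the forms [f'] and [h] agree on the overlap,
   which comes from [P1], so they glue. *)
have [||z [u [v [e <-]]]|w wP] := @linear_of_graph S M S^o
    (fun x z => exists u v, x = k u + a v /\ f' u + h v = z).
- move=> x; have [v gv] : exists v, g v = p x.
    have [v dv] : exists v, d2 v = j (p x) by apply/e3/jP; exists (p x).
    by exists v; apply: ij; rewrite gP.
  have [u ku] : exists u, k u = x - a v by apply/kP/lp; rewrite linearB aP gv subrr.
  by exists (f' u + h v), u, v; rewrite ku subrK.
- move=> c x z x' z' [u [v [-> <-]]] [u' [v' [-> <-]]].
  by exists (c *: u + u'), (c *: v + v'); split; rewrite !linearP !scalerDr addrACA.
- have : d2 v = 0.
    rewrite -gP -aP (_ : a v = - k u) ?linearN; last by apply/eqP; rewrite -addr_eq0 addrC -e.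
    by rewrite (proj2 (lp _)) ?oppr0 ?linear0 //; apply/kP; exists u.
  move=> /e2[y dy]; rewrite -dy hP /=; rewrite -linearD (_ : u + b y = 0) ?linear0 //.
  by apply: ik; rewrite linearD bP /= dy linear0.
exists w => y; have [u [v [e <-]]] := wP (l y).
have : d2 v = 0.
  rewrite -gP -aP (_ : a v = l y - k u); last by rewrite e addrC addKr.
  by rewrite linearB !(proj2 (lp _)) ?subrr ?linear0 //; [apply/kP; exists u | exists y].
move=> /e2[x dx]; rewrite -dx hP /= -linearD -f'P; congr (f' _); apply: ik.
by rewrite linearD bP /= dx -e tP.
Qed.

Lemma gorenstein_projective_coreflexive : coreflexive G.
Proof.
have [P0 [P1 [P2 [P3 [P4 [d0 [d1 [d2 [d3 [j [[_ f2 f3 f4] [_ e2 e3] _ x2 [ij jP]]]]]]]]]]]] :=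
  gorenstein_projective_presentation.
have [|g gP] := factor_mono (f := d2) ij.
  by move=> x; apply/jP/e3; exists x.
exists P3, j; split=> //.
  move=> f _; have [|h hP] := x2 (f \o g).
    by move=> y dy /=; rewrite (_ : g y = 0) ?linear0 //; apply: ij; rewrite gP dy linear0.
  exists h => x; have [y dy] : exists y, d2 y = j x by apply/e3/jP; exists x.
  by rewrite -dy hP /=; congr (f _); apply: ij; rewrite gP.
move=> y yP; apply/jP; apply: fg_projective_separated => // h.
by apply: (yP (h \o d3)) => x /=; rewrite (proj2 (jP _)) ?linear0 //; exists x.
Qed.
End FromComplex.

End Gprj.

(** * Torsionless modules over 1-Gorenstein algebras *)
(* Dimension shifting: [Ext^1(L, R)] vanishes for [L] the image of [b]. *)
Lemma injdim1_extendable (R : pzRingType) (M1 M2 M3 : lmodType R)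
    (a : {linear M1 -> M2}) (b : {linear M2 -> M3}) :
  injdim_le 1 (R^o : lmodType R) -> (forall x, b x = 0 <-> exists y, a y = x) ->
  projective M3 -> extendable a.
Proof.
move=> [I [C [i [p [inI [ii sp ip] inC]]]]] ab pM3 f af.
have [N [k [ik kP]]] := sub_exists (submodule_im a).
have [|t tP] := factor_mono (f := a) ik; first by move=> y; apply/kP; exists y.
have st : surjective t.
  by move=> z; have [y ay] := proj2 (kP (k z)) (ex_intro _ z erefl); exists y; apply: ik; rewrite tP.
have [|f' f'P] := factor_epi (f := f) st.
  by move=> y ty; apply: af; rewrite -tP ty linear0.
(* [g] extends the form with values in [I]. Modulo the ring it factors through the image of [b],
   extends to [M3] since [C] is injective, and lifts to [I] since [M3] is projective; subtracting
   this lift puts the values back in the ring. *)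
have [g gP] := inI _ _ k (i \o f') ik.
have [N3 [k3 [ik3 k3P]]] := sub_exists (submodule_im b).
have [|t3 t3P] := factor_mono (f := b) ik3; first by move=> y; apply/k3P; exists y.
have st3 : surjective t3.
  by move=> z; have [y ay] := proj2 (k3P (k3 z)) (ex_intro _ z erefl); exists y; apply: ik3; rewrite t3P.
have [|c cP] := factor_epi (f := p \o g) st3.
  move=> x t3x; have /ab[y <-] : b x = 0 by rewrite -t3P t3x linear0.
  by rewrite /= -tP gP; apply/ip; exists (f' (t y)).
have [c' c'P] := inC _ _ k3 c ik3.
have [h hP] := pM3 _ _ p c' sp.
have [|w wP] := factor_mono (f := g \- (h \o b)) ii.
  by move=> x; apply/ip; rewrite linearB /= hP -t3P c'P cP subrr.
exists w => y; have bay : b (a y) = 0 by apply/ab; exists y.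
by apply: ii; rewrite wP /= bay linear0 subr0 -tP gP /= f'P.
Qed.

Lemma rV_submodule_rows (R : pzRingType) m (I : 'rV[R]_m -> Prop) :
  finite_length 'rV[R]_m -> submodule I ->
  exists l (Y : 'M[R]_(l, m)), forall c, I c <-> exists d : 'rV_l, c = d *m Y.
Proof.
move=> fm hI; have [l [g gP]] := finite_length_fg_submodule fm hI.
exists l, (\matrix_i g i) => c; rewrite gP.
have E (d : 'rV_l) : d *m \matrix_i g i = \sum_i d 0 i *: g i.
  by rewrite mulmx_sum_row; apply: eq_bigr => i _; rewrite rowK.
split=> [[d ->]|[d ->]]; last by exists (fun i => d 0 i).
by exists (\row_i d i); rewrite E; apply: eq_bigr => i _; rewrite mxE.
Qed.

Notation row_mulmx := (@mulmxr _ 1 _ _).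

Lemma linear_rV_mx (R : pzRingType) m n (f : {linear 'rV[R]_m -> 'rV[R]_n}) :
  exists X : 'M[R]_(m, n), forall c, f c = c *m X.
Proof. by exists (lin1_mx f) => c; rewrite mul_rV_lin1. Qed.

Lemma mulmx_trc (A : pzRingType) m n p (P : 'M[A]_(m, n)) (Q : 'M[A]_(n, p)) :
  (Q^T : 'M[A^c]_(p, n)) *m (P^T : 'M[A^c]_(n, m)) = (P *m Q)^T.
Proof. by rewrite trmx_mul_rev. Qed.

(* The dual of a map [x |-> x *m X^T] of free right modules is [c |-> c *m X]. *)
Section Gorenstein.
Variable A : pzRingType.
Local Notation S := (A^c).
Hypothesis finA : forall M : lmodType A, finitely_generated M -> finite_length M.
Hypothesis finS : forall M : lmodType S, finitely_generated M -> finite_length M.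
Hypothesis gorA : one_gorenstein A.

Lemma torsionless_syzygy (G : lmodType S) : finitely_generated G ->
  exists (P K : lmodType S) (k : {linear K -> P}) (p : {linear P -> G}),
    [/\ fg_projective P, finitely_generated K /\ torsionless K & short_exact k p].
Proof.
move=> /fgP[n [p sp]].
have [K [k [ik kP]]] := sub_exists (submodule_ker p).
exists 'rV[S]_n, K, k, p; split=> //; first exact: rV_fg_projective.
split; last by exists n, k.
by apply/finite_length_fg/(finite_length_sub ik)/finS/rV_fg.
Qed.

(** The rows of [Y] present [G], those of [X] generate its dual, and those of [Z] are the relations
    between the latter. Hence [Xt] induces the universal map [j] from [G] to a free module,
    injective as [G] is torsionless, and the cokernel is the image of [Zt]. *)
Lemma torsionless_cosyzygy (G : lmodType S) : finitely_generated G -> torsionless G ->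
  exists (P C : lmodType S) (j : {linear G -> P}) (q : {linear P -> C}),
    [/\ fg_projective P, finitely_generated C /\ torsionless C & short_exact j q].
Proof.
move=> /fgP[m [p sp]] [N [e ie]].
have finrV k := finA (rV_fg A k); have finrVc k := finS (rV_fg S k).
have [l [Y YP]] := rV_submodule_rows (finrVc m) (submodule_ker p).
have [n [X XP]] := rV_submodule_rows (finrV m) (submodule_ker (row_mulmx (Y^T : 'M[A]_(m, l)))).
have [r [Z ZP]] := rV_submodule_rows (finrV n) (submodule_ker (row_mulmx X)).
pose Xt : 'M[S]_(m, n) := X^T; pose Zt : 'M[S]_(n, r) := Z^T.
have XY : X *m (Y^T : 'M[A]_(m, l)) = 0.
  apply/row_matrixP => i; rewrite row_mul row0; apply/XP.
  by exists (delta_mx 0 i); rewrite rowE.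
have ZX : Z *m X = 0.
  apply/row_matrixP => i; rewrite row_mul row0; apply/ZP.
  by exists (delta_mx 0 i); rewrite rowE.
have YXt : Y *m Xt = 0 by have := mulmx_trc X (Y^T : 'M[A]_(m, l)); rewrite trmxK XY trmx0.
have XZt : Xt *m Zt = 0 by have := mulmx_trc Z X; rewrite ZX trmx0.
have [|j jP] := factor_epi (f := row_mulmx Xt) sp.
  by move=> x /YP[d ->] /=; rewrite -mulmxA YXt mulmx0.
have [C [k [ik kP]]] := sub_exists (submodule_im (row_mulmx Zt)).
have [|q qP] := factor_mono (f := row_mulmx Zt) ik; first by move=> y; apply: (proj1 (kP _)); exists y.
have sq : surjective q.
  by move=> z; have [y ay] := proj2 (kP (k z)) (ex_intro _ z erefl); exists y; apply: ik; rewrite qP.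
exists 'rV[S]_n, C, j, q; split; first exact: rV_fg_projective.
  by split; [apply: (fg_quotient sq (rV_fg _ _)) | exists r, k].
split=> //.
  (* [e \o p] is a matrix killed by [Y], hence it factors through [Xt] *)
  have [E EP] := linear_rV_mx (e \o p).
  have [D DE] : exists D : 'M[S]_(n, N), E = Xt *m D.
    have rowsE i : exists d : 'rV[A]_n, row i (E^T : 'M[A]_(N, m)) = d *m X.
      apply/XP; rewrite /= -row_mul; apply/rowP => t.
      have YE : Y *m E = 0.
        apply/row_matrixP => u; rewrite row_mul -EP /= row0.
        by rewrite (proj2 (YP _)) ?linear0 //; exists (delta_mx 0 u); rewrite rowE.
      have /(congr1 trmx) := mulmx_trc (E^T : 'M[A]_(N, m)) (Y^T : 'M[A]_(m, l)).
      by rewrite !trmxK YE trmx0 => <-; rewrite !mxE.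
    have [d dP] := choice rowsE.
    exists ((\matrix_i d i)^T); have := mulmx_trc (\matrix_i d i) X => ->.
    apply/trmx_inj; rewrite trmxK; apply/row_matrixP => i.
    by rewrite dP; apply: (etrans _ (esym (row_mul i (\matrix_i d i) X))); rewrite rowK.
  have ker0 x : j x = 0 -> x = 0.
    have [c <-] := sp x; rewrite jP /= => cX; apply: ie.
    by have /= -> := EP c; rewrite DE mulmxA cX mul0mx linear0.
  by move=> x y jxy; apply/subr0_eq/ker0; rewrite linearB jxy subrr.
move=> y; split=> [qy|[x <-]]; last first.
  have [c <-] := sp x; apply: ik.
  by rewrite jP qP /= -mulmxA XZt mulmx0 linear0.
have yZ : y *m Zt = 0 by have /= <- := qP y; rewrite qy linear0.
have Zy : Z *m (y^T : 'cV[A]_n) = 0.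
  apply/trmx_inj; rewrite trmx0.
  by have := mulmx_trc Z (y^T : 'cV[A]_n); rewrite trmxK => <-.
(* The column [y^T], killed by [Z], is a form on [A^n] vanishing on the kernel of [X]. The left
   injective dimension extends it along [X], which gives a preimage of [y]. *)
have [|c||g gP] := @injdim1_extendable A _ _ _ (row_mulmx X) (row_mulmx (Y^T : 'M[A]_(m, l)))
    _ _ (@rV_projective A l) (dot (y^T : 'cV[A]_n)).
- by case: gorA.
- by rewrite XP; split=> -[d dE]; exists d.
- by move=> c0 /ZP[d ->]; rewrite /= /dot -mulmxA Zy mulmx0 mxE.
have Xx : X *m (\col_i g (delta_mx 0 i)) = (y^T : 'cV[A]_n).
  apply/colP => i; have := gP (delta_mx 0 i).
  rewrite linear_rVE /= /dot -mulmxA -!rowE => gi.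
  by transitivity ((row i (X *m \col_i g (delta_mx 0 i))) 0 0); [rewrite [RHS]mxE | rewrite gi [LHS]mxE].
exists (p (\col_i g (delta_mx 0 i) : 'cV[A]_m)^T).
rewrite jP /=; have := mulmx_trc X (\col_i g (delta_mx 0 i)) => ->.
by rewrite Xx trmxK.
Qed.
End Gorenstein.


(* Provably [i + 1], but reducing on constructors, so that the differentials
   below can be defined by pattern matching. *)
Definition int_succ (i : int) : int :=
  match i with
  | Posz n => Posz n.+1
  | Negz 0 => Posz 0
  | Negz n.+1 => Negz n
  end.

Lemma int_succE : int_succ = (fun i => i + 1).
Proof.
apply/funext => -[n|[|n]] //=; first by rewrite -PoszD addn1.
by rewrite !NegzE -[n.+2]addn1 PoszD opprD subrK.
Qed.

(** * Splicing syzygies and cosyzygies into an acyclic complex *)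

Section Splice.
Variables (S : pzRingType) (T : lmodType S -> Prop).
Hypothesis syzygy : forall G, T G ->
  exists (P K : lmodType S) (k : {linear K -> P}) (p : {linear P -> G}),
    [/\ fg_projective P, T K & short_exact k p].
Hypothesis cosyzygy : forall G, T G ->
  exists (P C : lmodType S) (j : {linear G -> P}) (q : {linear P -> C}),
    [/\ fg_projective P, T C & short_exact j q].

(** The kernel is bundled with its proof of [T], so that a chosen syzygy can be fed back into the
    choice and iterated. *)
Record syz_data (G : lmodType S) := SyzData {
  syz_P : lmodType S; syz_K : {K : lmodType S | T K};
  syz_k : {linear sval syz_K -> syz_P}; syz_p : {linear syz_P -> G};
  syz_fg : fg_projective syz_P; syz_exact : short_exact syz_k syz_p }.

Record cosyz_data (G : lmodType S) := CosyzData {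
  cosyz_P : lmodType S; cosyz_C : {C : lmodType S | T C};
  cosyz_j : {linear G -> cosyz_P}; cosyz_q : {linear cosyz_P -> sval cosyz_C};
  cosyz_fg : fg_projective cosyz_P; cosyz_exact : short_exact cosyz_j cosyz_q }.

Lemma syz_ex (G : {G | T G}) : exists _ : syz_data (sval G), True.
Proof.
by case: G => G /= /syzygy[P [K [k [p [fP TK e]]]]]; exists (@SyzData G P (exist _ K TK) k p fP e).
Qed.

Lemma cosyz_ex (G : {G | T G}) : exists _ : cosyz_data (sval G), True.
Proof.
by case: G => G /= /cosyzygy[P [C [j [q [fP TC e]]]]]; exists (@CosyzData G P (exist _ C TC) j q fP e).
Qed.

Definition syz (G : {G | T G}) := projT1 (boolp.cid (syz_ex G)).
Definition cosyz (G : {G | T G}) := projT1 (boolp.cid (cosyz_ex G)).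

Variable G : {G | T G}.
Definition left_syz n : {G | T G} := iter n (fun H => syz_K (syz H)) G.
Definition right_syz n : {G | T G} := iter n (fun H => cosyz_C (cosyz H)) G.

Definition splice (i : int) : lmodType S :=
  match i with
  | Posz n => cosyz_P (cosyz (right_syz n))
  | Negz n => syz_P (syz (left_syz n))
  end.

Definition splice_d (i : int) : {linear splice i -> splice (int_succ i)} :=
  match i as i0 return {linear splice i0 -> splice (int_succ i0)} with
  | Posz n => cosyz_j (cosyz (right_syz n.+1)) \o cosyz_q (cosyz (right_syz n))
  | Negz 0 => cosyz_j (cosyz (right_syz 0)) \o syz_p (syz (left_syz 0))
  | Negz n.+1 => syz_k (syz (left_syz n)) \o syz_p (syz (left_syz n.+1))
  end.

Lemma short_exact_splice (Y Z P Q R : lmodType S) (p : {linear P -> Y}) (j : {linear Y -> Q})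
    (q : {linear Q -> Z}) (j' : {linear Z -> R}) x :
  surjective p -> short_exact j q -> injective j' ->
  j' (q x) = 0 <-> exists y, j (p y) = x.
Proof.
move=> sp [_ _ jq] ij'; split=> [|[y <-]].
  by rewrite -(linear0 j') => /ij'/jq[y <-]; have [z <-] := sp y; exists z.
by rewrite (proj2 (jq _)) ?linear0 //; exists (p y).
Qed.

Lemma splice_exact i x : splice_d (int_succ i) x = 0 <-> exists y, splice_d i y = x.
Proof.
case: i x => [n|[|[|n]]] x; rewrite /splice_d /=.
- apply: short_exact_splice; first by case: (cosyz_exact (cosyz (right_syz n))).
    exact: (cosyz_exact (cosyz (right_syz n.+1))).
  by case: (cosyz_exact (cosyz (right_syz n.+2))).
- apply: short_exact_splice; first by case: (syz_exact (syz (left_syz 0))).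
    exact: (cosyz_exact (cosyz (right_syz 0))).
  by case: (cosyz_exact (cosyz (right_syz 1))).
- apply: short_exact_splice; first by case: (syz_exact (syz (left_syz 1))).
    exact: (syz_exact (syz (left_syz 0))).
  by case: (cosyz_exact (cosyz (right_syz 0))).
- apply: short_exact_splice; first by case: (syz_exact (syz (left_syz n.+2))).
    exact: (syz_exact (syz (left_syz n.+1))).
  by case: (syz_exact (syz (left_syz n))).
Qed.

Lemma acyclic_splice : exists (P : int -> lmodType S) (d : forall i, {linear P i -> P (i + 1)}),
  [/\ forall i, fg_projective (P i),
      forall i (x : P (i + 1)), d (i + 1) x = 0 <-> exists y, d i y = x
    & exists (i : int) (j : {linear sval G -> P i}),
        injective j /\ forall x, d i x = 0 <-> exists y, j y = x].
Proof.
suff : exists (P : int -> lmodType S) (d : forall i, {linear P i -> P (int_succ i)}),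
  [/\ forall i, fg_projective (P i),
      forall i (x : P (int_succ i)), d (int_succ i) x = 0 <-> exists y, d i y = x
    & exists (i : int) (j : {linear sval G -> P i}),
        injective j /\ forall x, d i x = 0 <-> exists y, j y = x].
  by rewrite int_succE.
exists splice, splice_d; split.
- by case=> n; [apply: cosyz_fg | apply: syz_fg].
- exact: splice_exact.
exists (Posz 0), (cosyz_j (cosyz G)); have [ij _ jq] := cosyz_exact (cosyz G); split=> // x.
have [ij1 _ _] := cosyz_exact (cosyz (right_syz 1)).
rewrite -jq /=; split=> [|->]; last exact: linear0.
by rewrite -(linear0 (cosyz_j (cosyz (right_syz 1)))) => /ij1.
Qed.
End Splice.

Section Gorenstein.
Variable A : pzRingType.
Local Notation S := (A^c).
Hypothesis finA : forall M : lmodType A, finitely_generated M -> finite_length M.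
Hypothesis finS : forall M : lmodType S, finitely_generated M -> finite_length M.
Hypothesis gorA : one_gorenstein A.

Lemma torsionless_gorenstein_projective (G : lmodType S) :
  finitely_generated G -> torsionless G -> gorenstein_projective G.
Proof.
move=> fG tG; pose T (M : lmodType S) := finitely_generated M /\ torsionless M.
have [||P [d [fP dP [i [j jP]]]]] := @acyclic_splice S T _ _ (exist _ G (conj fG tG)).
- by move=> M [fM _]; apply: (torsionless_syzygy finS fM).
- by move=> M [fM tM]; apply: (torsionless_cosyzygy finA finS gorA fM tM).
exists P, d; split; last by exists i, j.
split=> // k f; split=> [fd|[g gf] x]; last first.
  by rewrite -gf (proj2 (dP k _)) ?linear0 //; exists x.
have [||||g gP] := @injdim1_extendable S _ _ _ (d (k + 1)) (d (k + 1 + 1)) _ _ _ f.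
- by case: gorA.
- exact: dP.
- by case: (fP (k + 1 + 1 + 1)).
- by move=> y /dP[x <-].
by exists g.
Qed.
End Gorenstein.

(** * Fitting's lemma and projective summands *)
Lemma inj_surj_bijective (T U : Type) (f : T -> U) : injective f -> surjective f -> bijective f.
Proof.
move=> fi fs; have [g gP] := choice fs.
by exists g => // x; apply: fi; rewrite gP.
Qed.

Section Endo.
Variable S : pzRingType.
Implicit Types M N K : lmodType S.

Lemma linear_inverse M N (f : {linear M -> N}) : injective f -> surjective f ->
  exists g : {linear N -> M}, cancel f g /\ cancel g f.
Proof.
move=> fi fs; have [|g gP] := factor_mono (f := idfun) fi; first by move=> y; apply: fs.
by exists g; split=> // x; apply: fi; rewrite gP.
Qed.

Fixpoint linear_iter M (f : {linear M -> M}) n : {linear M -> M} :=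
  if n is n'.+1 then f \o linear_iter f n' else idfun.

Lemma linear_iterSr M (f : {linear M -> M}) n x :
  linear_iter f n.+1 x = linear_iter f n (f x).
Proof. by elim: n => //= n ->. Qed.

Lemma linear_iterD M (f : {linear M -> M}) m n x :
  linear_iter f (m + n) x = linear_iter f m (linear_iter f n x).
Proof. by elim: m => //= m ->. Qed.

Lemma linear_iter_inj M (f : {linear M -> M}) n : injective f -> injective (linear_iter f n).
Proof. by move=> fi; elim: n => [//|n IHn] x y /= /fi/IHn. Qed.

Lemma linear_iter_surj M (f : {linear M -> M}) n : surjective f -> surjective (linear_iter f n).
Proof.
move=> fs; elim: n => [|n IHn] y; first by exists y.
by have [x <-] := fs y; have [z <-] := IHn x; exists z.
Qed.

Lemma iter_image_stable M (f : {linear M -> M}) : finite_length M ->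
  exists n, forall m x, exists y, linear_iter f n x = linear_iter f (n + m) y.
Proof.
move=> [l lM].
pose F (I : M -> Prop) := exists n, I = (fun y => exists x, linear_iter f n x = y).
have [||I [n ->] min] := @minimal_submodule S M F l (fun _ => True) _ _ lM.
- by move=> _ [n ->]; apply: submodule_im.
- by exists 0%N; apply/funext => y; apply/propext; split=> // _; exists y.
exists n => m x.
have [||y yE] := min _ (ex_intro _ (n + m)%N erefl) _ (linear_iter f n x).
- by move=> _ [z <-]; exists (linear_iter f m z); rewrite linear_iterD.
- by exists x.
by exists y.
Qed.

Lemma injective_endo_surjective M (f : {linear M -> M}) :
  finite_length M -> injective f -> surjective f.
Proof.
move=> fM fi x; have [n /(_ 1%N x)[y]] := iter_image_stable f fM.
by rewrite linear_iterD => /(linear_iter_inj fi) ->; exists y.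
Qed.

(** At a maximal kernel of an iterate [f^n], write [x] in the kernel of [f] as [f^n y]; then
    [f^(n+1) y = 0] already gives [f^n y = 0]. *)
Lemma surjective_endo_injective M (f : {linear M -> M}) :
  finite_length M -> surjective f -> injective f.
Proof.
move=> fM fs.
pose F (I : M -> Prop) := exists n, I = (fun x => linear_iter f n x = 0).
have [||I [n ->] max] := @maximal_element S M F (fun x => x = 0) fM.
- by move=> _ [n ->]; apply: submodule_ker.
- by exists 0%N.
have f0 x : f x = 0 -> x = 0.
  have [y <-] := linear_iter_surj n fs x => fy.
  apply: (max _ (ex_intro _ n.+1 erefl)) fy => z zE.
  by rewrite /= zE linear0.
by move=> x y fxy; apply/subr0_eq/f0; rewrite linearB fxy subrr.
Qed.

(** [K] is the stable image of the iterates, on which [f] restricts to an automorphism. The form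
    [p f i = 1] is chosen because, when [f] is a composite, it exhibits [K] as a summand of the
    module in the middle as well. *)
Lemma non_nilpotent_summand M (f : {linear M -> M}) : finite_length M ->
  (forall n, exists x, linear_iter f n x <> 0) ->
  exists (K : lmodType S) (i : {linear K -> M}) (p : {linear M -> K}),
    (exists z : K, z <> 0) /\ forall z, p (f (i z)) = z.
Proof.
move=> fM fn; have [n nP] := iter_image_stable f fM.
have [K [k [ik kP]]] := sub_exists (submodule_im (linear_iter f n)).
have [|c cP] := factor_mono (f := linear_iter f n) ik; first by move=> x; apply/kP; exists x.
have [|g gP] := factor_mono (f := f \o k) ik.
  move=> z /=; have [x <-] := proj2 (kP (k z)) (ex_intro _ z erefl).
  by apply/kP; exists (f x); rewrite -linear_iterSr.
have gs : surjective g.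
  move=> z; have [x xE] := proj2 (kP (k z)) (ex_intro _ z erefl).
  have [y yE] := nP 1%N x; exists (c y); apply: ik.
  by rewrite gP /= cP -xE yE addn1.
have fK := finite_length_sub ik fM.
have gi := surjective_endo_injective fK gs.
(* The exponent is [n+1]: the projection [c] applies [f] [n] times, and [p (f (i z))] contains one
   more. *)
have [h [gh _]] := linear_inverse (linear_iter_inj gi (n := n.+1)) (linear_iter_surj n.+1 gs).
exists K, k, (h \o c); split.
  have [x xE] := fn n; exists (c x) => cx; apply: xE.
  by rewrite -cP cx linear0.
move=> z /=; rewrite -[RHS]gh; congr (h _); apply: ik; rewrite cP -linear_iterSr.
elim: (n.+1) => //= m ->; exact: esym (gP _).
Qed.

Definition factors_projective M N (f : {linear M -> N}) : Prop :=
  exists (P : lmodType S) (h : {linear P -> N}) (g : {linear M -> P}),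
    fg_projective P /\ forall x, f x = h (g x).

(** Working form of having no projective summand: a module violating it splits off a nonzero one. *)
Definition radical_valued M : Prop :=
  forall (h : {linear M -> S^o}) x, h x \in @in_radical S S^o.

Lemma maximal_submodule_gen M (I : M -> Prop) x y : maximal_submodule I -> ~ I x ->
  exists a, I (y - a *: x).
Proof.
move=> [hI _ Imax] Ix.
pose J z := exists u v, [/\ I u, exists a : S, v = a *: x & z = u + v].
have hJ : submodule J by apply: submodule_add => //; apply: submodule_cyclic.
have [[u [_ [Iu [a ->] ->]]]|nJ] := pselect (J y); first by exists a; rewrite addrK.
case: Ix; apply: (Imax J) => //.
- by move=> u Iu; exists u, 0; rewrite addr0; split=> //; exists 0; rewrite scale0r.
- by exists y.
by exists 0, x; rewrite add0r; split=> //; [case: hI | exists 1; rewrite scale1r].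
Qed.

Section FiniteRing.
Hypothesis finS : forall M, finitely_generated M -> finite_length M.

Lemma regular_fg : finitely_generated (S^o : lmodType S).
Proof.
exists 1%N, (fun=> 1 : S^o) => x; exists (fun=> x).
by rewrite big_ord1 [_ *: _]mulr1.
Qed.

Lemma regular_fg_projective : fg_projective (S^o : lmodType S).
Proof.
split; first exact: regular_fg.
apply: (projective_retract (s := row_map (fun _ : 'I_1 => idfun)) (r := row_coord 0)).
  by move=> x; rewrite /= /row_coord mxE.
exact: rV_projective.
Qed.

(** If [h m] avoids a maximal left ideal [I], then [r * h m] is 1 modulo [I] for some [r]. Right
    multiplication by it is not nilpotent on [S]; it factors through [M], so its Fitting summand is
    one of both [S] and [M]. *)
Lemma non_radical_valued_summand M : ~ radical_valued M ->
  exists (K : lmodType S) (s : {linear K -> M}) (r : {linear M -> K}),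
    [/\ cancel s r, fg_projective K & exists z : K, z <> 0].
Proof.
move=> /existsNP[h /existsNP[m /negP/asboolPn/existsNP[I /not_implyP[mI Ihm]]]].
have [r Ir] := maximal_submodule_gen (1 : S^o) mI Ihm.
have [hI [x0 Ix0] _] := mI.
pose f : {linear S^o -> S^o} := h \o linear_mulr (r *: m).
have I1 : ~ I 1 by move=> I1; apply: Ix0; rewrite -[x0]mulr1; apply: (submoduleZ x0 hI I1).
have If n : I (1 - linear_iter f n 1).
  elim: n => [|n IHn]; first by rewrite subrr; case: hI.
  set e := linear_iter f n 1 in IHn *.
  have -> : 1 - linear_iter f n.+1 1 = (1 - e) + (e : S) *: (1 - r *: h m : S^o).
    have e1 : (e : S) *: (1 : S^o) = e := mulr1 (e : S).
    by rewrite scalerBr e1 addrA subrK /= /linear_mulr !linearZ.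
  by apply: (submoduleD hI) => //; apply: submoduleZ.
have [|K [i [p [K0 pfi]]]] := non_nilpotent_summand (f := f) (finS regular_fg).
  by move=> n; exists 1 => e0; apply: I1; have := If n; rewrite e0 subr0.
exists K, (linear_mulr (r *: m) \o i), (p \o h); split=> //.
apply: (fg_projective_retract (s := i) (r := p \o f)) regular_fg_projective.
exact: pfi.
Qed.

Lemma radical_valued_decomposition M : finite_length M ->
  exists (M0 : lmodType S) (i : {linear M0 -> M}) (p : {linear M -> M0})
    (Q : lmodType S) (t : {linear Q -> M}) (s : {linear M -> Q}),
    [/\ radical_valued M0, cancel i p, fg_projective Q
      & forall x, x = i (p x) + t (s x)].
Proof.
move: M; apply: finite_length_ind => M fM IH.
have [rM|/non_radical_valued_summand[K [s1 [r1 [sr fK [z z0]]]]]] := pselect (radical_valued M).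
  exists M, idfun, idfun, 'rV[S]_0, \0, \0; split=> //; first exact: rV_fg_projective.
  by move=> x /=; rewrite addr0.
have [N [i1 [ii1 i1P]]] := sub_exists (submodule_ker r1).
have [|p1 p1P] := factor_mono (f := idfun \- (s1 \o r1)) ii1.
  by move=> x; apply/i1P; rewrite linearB /= sr subrr.
have p1i x : p1 (i1 x) = x.
  have r1i : r1 (i1 x) = 0 by apply/i1P; exists x.
  by apply: ii1; rewrite p1P /= r1i linear0 subr0.
have [|M0 [i [p [Q [t [s [rM0 ip fQ dec]]]]]]] := IH N i1 ii1.
  move=> /(_ (s1 z))[x ix]; apply: z0; rewrite -(sr z) -ix.
  by apply/i1P; exists x.
exists M0, (i1 \o i), (p \o p1), (Q * K)%type, ((i1 \o t \o fst) \+ (s1 \o snd)), (pair_map (s \o p1) r1).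
split=> //=; first by move=> x /=; rewrite p1i ip.
  exact: fg_projective_prod.
by move=> x; rewrite addrA -linearD -dec p1P /= subrK.
Qed.

(** Nakayama: a maximal submodule [W] containing the image of [1 - f] would pull back along each
    coordinate to a maximal left ideal or to [S], so it would contain the image of [f] too. Thus
    [1 - f] is surjective, hence injective. *)
Lemma radical_endo_fixed n (f : {linear 'rV[S]_n -> 'rV[S]_n}) :
  (forall v c, f v 0 c \in @in_radical S S^o) -> forall v, f v = v -> v = 0.
Proof.
move=> fr v fv.
have frV := finS (rV_fg S n).
have gs : surjective ((idfun \- f) : {linear 'rV[S]_n -> 'rV[S]_n}).
  apply: contrapT => /existsNP[y0 Ny0].
  pose g : {linear 'rV[S]_n -> 'rV[S]_n} := idfun \- f.
  pose F (I : 'rV[S]_n -> Prop) := [/\ submodule I, forall x, I (g x) & exists x, ~ I x].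
  have [||W [hW gW [x0 Wx0]] Wmax] := @maximal_element S _ F (fun y => exists x, g x = y) frV.
  - by move=> J [].
  - by split; [apply: submodule_im | move=> x; exists x | exists y0].
  have mW : maximal_submodule W.
    split=> //; first by exists x0.
    by move=> J hJ WJ nJ; apply: (Wmax J); [split=> // x; apply: WJ | exact: WJ].
  apply: Wx0; rewrite -[x0](subrK (f x0)); apply: submoduleD => //; first exact: gW.
  rewrite [f x0]row_sum_delta; apply: (submodule_sum hW) => c.
  pose I (r : S^o) := W ((r : S) *: delta_mx 0 c).
  have hI : submodule I by apply: (submodule_preim (linear_mulr (delta_mx 0 c)) hW).
  have [IT|/existsNP[x Ix]] := pselect (forall r, I r); first exact: IT.
  have /asboolP fr0 := fr x0 c; apply: (fr0 I); split=> //; first by exists x.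
  move=> J hJ IJ [u Ju] r Jr; apply: contrapT => Ir.
  have [a aP] := maximal_submodule_gen (delta_mx 0 c) mW Ir.
  apply: Ju; rewrite -[u]mulr1; apply: (submoduleZ u hJ).
  rewrite -(subrK (a * r) 1); apply: (submoduleD hJ); last exact: (submoduleZ a hJ Jr).
  by apply: IJ; rewrite /I scalerBl scale1r -scalerA.
apply: (surjective_endo_injective frV gs).
by rewrite linear0 /= fv subrr.
Qed.

End FiniteRing.
End Endo.

(** * Modules generated by the radical *)
Section FfunMaps.
Variable S : pzRingType.
Implicit Types M N : lmodType S.

Definition ffun_coord n M (i : 'I_n) (v : {ffun 'I_n -> M}) : M := v i.
Lemma ffun_coord_linear n M (i : 'I_n) : linear (@ffun_coord n M i).
Proof. by move=> a u v; rewrite /ffun_coord !ffunE. Qed.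
HB.instance Definition _ n M (i : 'I_n) :=
  GRing.isLinear.Build S {ffun 'I_n -> M} M *:%R (ffun_coord i) (ffun_coord_linear i).

Definition ffun_single n M (i : 'I_n) (m : M) : {ffun 'I_n -> M} :=
  [ffun j => if j == i then m else 0].
Lemma ffun_single_linear n M (i : 'I_n) : linear (@ffun_single n M i).
Proof.
by move=> a u v; apply/ffunP => j; rewrite !ffunE; case: eqP => // _; rewrite scaler0 addr0.
Qed.
HB.instance Definition _ n M (i : 'I_n) :=
  GRing.isLinear.Build S M {ffun 'I_n -> M} *:%R (ffun_single i) (ffun_single_linear i).

Definition ffun_map n M N (a : 'I_n -> {linear N -> M}) (x : N) : {ffun 'I_n -> M} :=
  [ffun i => a i x].
Lemma ffun_map_linear n M N (a : 'I_n -> {linear N -> M}) : linear (ffun_map a).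
Proof. by move=> c u v; apply/ffunP => j; rewrite !ffunE linearP. Qed.
HB.instance Definition _ n M N (a : 'I_n -> {linear N -> M}) :=
  GRing.isLinear.Build S N {ffun 'I_n -> M} *:%R (ffun_map a) (ffun_map_linear a).

Definition ffun_sum n M N (b : 'I_n -> {linear M -> N}) (v : {ffun 'I_n -> M}) : N :=
  \sum_i b i (v i).
Lemma ffun_sum_linear n M N (b : 'I_n -> {linear M -> N}) : linear (ffun_sum b).
Proof.
move=> c u v; rewrite /ffun_sum scaler_sumr -big_split; apply: eq_bigr => i _ /=.
by rewrite !ffunE linearP.
Qed.
HB.instance Definition _ n M N (b : 'I_n -> {linear M -> N}) :=
  GRing.isLinear.Build S {ffun 'I_n -> M} N *:%R (ffun_sum b) (ffun_sum_linear b).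

Lemma ffun_sum_single n M (v : {ffun 'I_n -> M}) : v = \sum_i ffun_single i (v i).
Proof.
apply/ffunP => j; rewrite sum_ffunE (bigD1 j) //= ffunE eqxx big1 ?addr0 // => i ij.
by rewrite ffunE eq_sym (negPf ij).
Qed.

Lemma in_addP M N : in_add M N <->
  exists n (a : 'I_n -> {linear N -> M}) (b : 'I_n -> {linear M -> N}),
    forall x, x = \sum_i b i (a i x).
Proof.
split=> [[n [X [f [g fg gf]]]]|[n [a [b ab]]]].
  have gl : linear g by move=> c u v; apply: (can_inj fg); rewrite linearP !gf.
  pose g' : {linear {ffun 'I_n -> M} -> (N * X)%type} := HB.pack g (GRing.isLinear.Build S _ _ *:%R g gl).
  exists n, (fun i => ffun_coord i \o f \o pair_map idfun \0),
    (fun i => fst \o g' \o ffun_single i) => x /=.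
  rewrite -(linear_sum fst) -(linear_sum g') -ffun_sum_single.
  by rewrite (_ : g' (f _) = g (f (x, 0))) // fg.
pose r : {linear _ -> N} := ffun_sum b; pose s : {linear N -> _} := ffun_map a.
have rs x : r (s x) = x.
  by rewrite [RHS]ab; apply: eq_bigr => i _; rewrite ffunE.
have [X [k [ik kP]]] := sub_exists (submodule_ker r).
exists n, X, ((s \o fst) \+ (k \o snd)).
have rk x : r (k x) = 0 by apply/kP; exists x.
apply: inj_surj_bijective => [[x y] [x' y'] /= e|v].
  have xx : x = x'.
    by have := congr1 r e; rewrite !linearD !rs !rk !addr0.
  by congr (_, _) => //; apply: ik; move: e; rewrite xx => /addrI.
have [y ky] : exists y, k y = v - s (r v).
  by apply/kP; rewrite linearB rs subrr.
by exists (r v, y); rewrite /= ky addrC subrK.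
Qed.

Lemma in_add_glue M N N1 N2 (u1 : {linear N1 -> N}) (v1 : {linear N -> N1})
    (u2 : {linear N2 -> N}) (v2 : {linear N -> N2}) :
  (forall x, x = u1 (v1 x) + u2 (v2 x)) -> in_add M N1 -> in_add M N2 -> in_add M N.
Proof.
move=> dec /in_addP[n1 [a1 [b1 ab1]]] /in_addP[n2 [a2 [b2 ab2]]]; apply/in_addP.
exists (n1 + n2)%N,
  (fun i => match split i return {linear N -> M} with inl j => a1 j \o v1 | inr j => a2 j \o v2 end),
  (fun i => match split i return {linear M -> N} with inl j => u1 \o b1 j | inr j => u2 \o b2 j end) => x.
rewrite {1}[x]dec {1}[v1 x]ab1 {1}[v2 x]ab2 big_split_ord !linear_sum.
have sl (i : 'I_n1) : split (lshift n2 i) = inl i := unsplitK (inl i).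
have sr (i : 'I_n2) : split (rshift n1 i) = inr i := unsplitK (inr i).
by congr (_ + _); apply: eq_bigr => i _; rewrite ?sl ?sr.
Qed.

Local Notation generator := (radical (S^o : lmodType S) * S^o)%type.

Lemma in_add_fg_projective N : fg_projective N -> in_add generator N.
Proof.
move=> /fg_projective_summand[n [s [r sr]]]; apply/in_addP.
exists n, (fun i => pair_map \0 (row_coord i \o s)), (fun i => linear_mulr (r (delta_mx 0 i)) \o snd).
move=> x; rewrite -{1}[x]sr [s x]row_sum_delta linear_sum; apply: eq_bigr => i _.
by rewrite linearZ.
Qed.

Lemma in_add_torsionless N : in_add generator N -> torsionless N.
Proof.
move=> /in_addP[n [a [b ab]]].
pose e := pair_map (row_map (fun i => (\val : {linear radical (S^o : lmodType S) -> S^o}) \o fst \o a i))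
                   (row_map (fun i => snd \o a i)).
apply: (@torsionless_fg_projective S N ('rV[S]_n * 'rV[S]_n)%type e).
  by apply: fg_projective_prod; apply: rV_fg_projective.
move=> x y [/rowP e1 /rowP e2]; rewrite [x]ab [y]ab; apply: eq_bigr => i _; congr (b i _).
rewrite [LHS]surjective_pairing [RHS]surjective_pairing; congr (_, _).
  by apply: val_inj; have := e1 i; rewrite !mxE.
by have := e2 i; rewrite !mxE.
Qed.

Definition stably_regular : Prop :=
  forall (G H : lmodType S) (f : {linear G -> H}),
    gorenstein_projective G -> gorenstein_projective H ->
    exists u : {linear H -> G}, factors_projective (f \- (f \o u \o f)).

(* The key computation: if [i : G0 -> rad^n] is stably regular, [i = i u i]
   modulo projectives, then [j (1 - u i) = phi j] where [j] is the approximation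
   of [G0] and [phi] has its image in the radical; hence [u i] is injective. *)
Lemma gorenstein_projective_in_add (G : lmodType S) :
  (forall M : lmodType S, finitely_generated M -> finite_length M) ->
  (forall M : lmodType S, finitely_generated M -> torsionless M -> gorenstein_projective M) ->
  stably_regular -> gorenstein_projective G -> in_add generator G.
Proof.
move=> finS tlG reg gG.
have fG := gorenstein_projective_fg gG.
have [G0 [i0 [p0 [Q [t [s [rG0 ip fQ dec]]]]]]] := radical_valued_decomposition finS (finS _ fG).
apply: (in_add_glue dec); last exact: in_add_fg_projective.
have fG0 := fg_retract ip fG.
have tG0 : torsionless G0.
  apply: torsionless_sub (can_inj ip) _.
  exact/coreflexive_torsionless/gorenstein_projective_coreflexive.
have [P [j' [fP ij' eP _]]] := gorenstein_projective_coreflexive (tlG _ fG0 tG0).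
have [n [sP [rP srP]]] := fg_projective_summand fP.
have jc0 (c : 'I_n) : exists f : {linear G0 -> radical (S^o : lmodType S)},
    forall x, \val (f x) = row_coord c (sP (j' x)).
  apply: (factor_mono (i := \val) (f := row_coord c \o sP \o j')); first exact: val_inj.
  move=> x; have h : row_coord c (sP (j' x)) \in @in_radical S S^o.
    exact: (rG0 (row_coord c \o sP \o j') x).
  by exists (MkRadical h).
have [jc jcP] := choice jc0.
pose U := {ffun 'I_n -> radical (S^o : lmodType S)}.
pose k : {linear U -> 'rV[S]_n} :=
  row_map (fun c => (\val : {linear radical (S^o : lmodType S) -> S^o}) \o ffun_coord c).
have ik : injective k.
  move=> v w /rowP kvw; apply/ffunP => c; apply: val_inj.
  by have := kvw c; rewrite !mxE.
have fU : finitely_generated U.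
  exact/finite_length_fg/(finite_length_sub ik)/finS/rV_fg.
have tU : torsionless U by exists n, k.
pose i : {linear G0 -> U} := ffun_map jc.
have ki x : k (i x) = sP (j' x).
  by apply/rowP => c; rewrite mxE /= /ffun_coord ffunE jcP.
have [u [P' [b [a [fP' uP]]]]] := reg G0 U i (tlG _ fG0 tG0) (tlG _ fU tU).
have [|a' a'P] := extendable_projective (f := a) eP fP'.
  by move=> y; rewrite -(linear0 j') => /ij' ->; rewrite linear0.
have inj_ui : injective (u \o i).
  have ker0 x : u (i x) = 0 -> x = 0.
    move=> uix; apply: ij'; apply: (can_inj srP); rewrite !linear0.
    apply: (radical_endo_fixed finS (f := k \o b \o a' \o rP)).
      by move=> v c; rewrite mxE; apply: valP.
    rewrite /= srP a'P -ki; congr (k _).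
    by have /= <- := uP x; rewrite uix linear0 subr0.
  by move=> x y /= e; apply/subr0_eq/ker0; rewrite !linearB e subrr.
have [w [wK _]] := linear_inverse inj_ui (injective_endo_surjective (finS _ fG0) inj_ui).
apply/in_addP; exists n, (fun c => pair_map (jc c) \0), (fun c => w \o u \o ffun_single c \o fst).
move=> x; rewrite -[LHS]wK /= -!linear_sum; congr (w (u _)).
by rewrite [LHS]ffun_sum_single; apply: eq_bigr => c _; rewrite ffunE.
Qed.

End FfunMaps.

(** * Injective modules *)
Definition partial_graph (R : pzRingType) (N I : lmodType R) (G : N * I -> Prop) : Prop :=
  submodule G /\ forall u, G (0, u) -> u = 0.

(* The condition in Baer's criterion; a map from a left ideal is given by its graph. *)
Definition baer (R : pzRingType) (I : lmodType R) : Prop :=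
  forall G : (R^o : lmodType R) * I -> Prop, partial_graph G ->
    exists y : I, forall r u, G (r, u) -> u = (r : R) *: y.

(** Single-valuedness is a condition on each element of a graph, so Zorn applies in the form
    [maximal_submodule_in]. A maximal graph is total: Baer's condition on the ideal of all [r] with
    [r n] in the domain provides a value at [n]. *)
Lemma baer_extension (R : pzRingType) (N I : lmodType R) (G : N * I -> Prop) :
  baer I -> partial_graph G ->
  exists g : {linear N -> I}, forall n u, G (n, u) -> u = g n.
Proof.
move=> bI [hG G0].
pose ok (z : (N * I)%type) := z.1 = 0 -> z.2 = 0.
have [|W [hW GW Wok Wmax]] := @maximal_submodule_in R (N * I)%type G ok hG.
  by move=> [n u] Gnu /= n0; apply: G0; rewrite -n0.
have W0 u : W (0, u) -> u = 0 by move=> /Wok; apply.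
have tot n : exists u, W (n, u).
  pose D (z : (R^o : lmodType R) * I) := W (linear_mulr n z.1, z.2).
  have [|y yP] := bI D.
    split; first exact: (submodule_preim (pair_map (linear_mulr n \o fst) snd) hW).
    by move=> u; rewrite /D /= linear0; apply: W0.
  exists y; pose J z := exists w v, [/\ W w, exists a : R, v = a *: (n, y) & z = w + v].
  have hJ : submodule J by apply: submodule_add => //; apply: submodule_cyclic.
  apply: (Wmax J) => //.
  - by move=> w Ww; exists w, 0; rewrite addr0; split=> //; exists 0; rewrite scale0r.
  - move=> _ [[w1 w2] [_ [Ww [r ->] ->]]] /= e.
    have w1E : w1 = - r *: n by apply/eqP; rewrite scaleNr -addr_eq0; apply/eqP; exact: e.
    have := yP (- r : R^o) w2; rewrite /D /= /linear_mulr -w1E => -> //.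
    by rewrite scaleNr addNr.
  by exists 0, (n, y); rewrite add0r; split=> //; [case: hW | exists 1; rewrite scale1r].
have [||g gP] := @linear_of_graph R N I (fun n u => W (n, u)) tot.
- by move=> a x y x' y' h h'; case: hW => _ hW'; apply: (hW' a (_, _) (_, _) h h').
- exact: W0.
exists g => n u /GW Wnu; apply/subr0_eq/W0.
by have := submoduleB hW Wnu (gP n); rewrite [_ - _](_ : _ = (n - n, u - g n)) // subrr.
Qed.

Lemma baer_injective (R : pzRingType) (I : lmodType R) : baer I -> injective_module I.
Proof.
move=> bI M N i f ii.
pose G (z : (N * I)%type) := exists x, (i x, f x) = z.
have [|g gP] := baer_extension (G := G) bI.
  split; first exact: (submodule_im (pair_map i f)).
  by move=> u [x [ix <-]]; rewrite (_ : x = 0) ?linear0 //; apply: ii; rewrite ix linear0.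
by exists g => x; apply/esym/gP; exists x.
Qed.

(** * The injective cogenerator Q/Z *)

Section RationalsModIntegers.
Import Order.TTheory Num.Theory.

Local Notation intmod V := (zmodule V : lmodType int).

Lemma divisible_cogenerator : exists D : lmodType int, baer D /\
  forall (V : zmodType) (x : V), x <> 0 ->
    exists h : {linear intmod V -> D}, h x <> 0.
Proof.
have hZ : submodule (fun q : intmod rat => exists m : int, q = m%:~R).
  split=> [|a _ _ [m ->] [n ->]]; first by exists 0.
  by exists (a * m + n); rewrite scalezrE mulrzDr -mulrzA mulrC.
have [D [p [sp pP]]] := quot_exists hZ.
exists D.
have bD : baer D.
  move=> G [hG G0].
  (* A nonzero ideal of the integers is generated by its least positive element [d]; dividing a
     representative of the value at [d] by [d] gives the required element of Q/Z. *)
  pose T n := `[< (0 < n)%N /\ exists u, G (n%:Z : int^o, u) >].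
  have [exT|nT] := pselect (exists n, T n); last first.
    exists 0 => r u Gru; rewrite scaler0; apply: G0.
    have [r0|r0] := eqVneq r 0; first by rewrite -r0.
    case: nT; exists `|r|%N; apply/asboolP; split; first by rewrite absz_gt0.
    have [s sE] : exists s : int, `|r|%N%:Z = s * r.
      by exists (sgz r); rewrite -abszEsg.
    by exists (s *: u); rewrite sE; apply: (submoduleZ s hG Gru).
  case: (ex_minnP exT) => d /asboolP[d0 [u Gdu]] dmin.
  have [q pq] := sp u.
  have dq : (d%:Z)%:~R != 0 :> rat by rewrite intr_eq0 eqz_nat -lt0n.
  exists (p (q / (d%:Z)%:~R : rat)) => r v Grv.
  have duE : d%:Z *: p (q / (d%:Z)%:~R : rat) = u.
    by rewrite -linearZ -pq scalezrE -mulrzr mulfVK.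
  have Gm : G ((r %% d)%Z : int^o, v - (r %/ d)%Z *: u).
    have := submoduleB hG Grv (submoduleZ (r %/ d)%Z hG Gdu).
    by congr (G (_, _)); rewrite /= {1}(divz_eq r d) addrAC [_ *: _](_ : _ = (r %/ d)%Z * d) ?subrr ?add0r.
  have dz : d%:Z != 0 by rewrite eqz_nat -lt0n.
  have rd0 : (r %% d)%Z = 0.
    apply/eqP/negPn/negP => rd.
    have : T `|(r %% d)%Z|%N.
      apply/asboolP; split; first by rewrite absz_gt0.
      by exists (v - (r %/ d)%Z *: u); rewrite gez0_abs ?modz_ge0.
    move=> /dmin; rewrite leqNgt => /negP; apply.
    by rewrite -ltz_nat gez0_abs ?modz_ge0 // ltz_pmod // ltz_nat.
  move: Gm; rewrite rd0 => /G0/subr0_eq ->.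
  by rewrite -duE scalerA [in RHS](divz_eq r d) rd0 addr0.
split=> // V x x0.
(* [d] is the order of [x], or 2 when the order is infinite: then any [d > 1] would do, since [1/d]
   is nonzero in Q/Z. *)
have [d [d1 dP]] : exists d : nat, (1 < d)%N /\ forall m : int, x *~ m = 0 -> (d %| m)%Z.
  pose T n := (0 < n)%N && (x *+ n == 0).
  have [exT|nT] := pselect (exists n, T n).
    case: (ex_minnP exT) => d /andP[d0 /eqP xd] dmin; exists d; split.
      case: d d0 xd {dmin} => [|[|]] // _; by rewrite mulr1n.
    move=> m xm; have dz : d%:Z != 0 by rewrite eqz_nat -lt0n.
    have xmd : x *~ (m %% d)%Z = 0.
      by rewrite /modz mulrzBr xm -mulrzA_C -[x *~ d]/(x *+ d) xd mul0rz subr0.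
    apply/dvdz_mod0P/eqP/negPn/negP => md.
    have /dmin : T `|(m %% d)%Z|%N.
      rewrite /T absz_gt0 md /=; apply/eqP.
      by rewrite -[x *+ _]/(x *~ `|(m %% d)%Z|%N) gez0_abs ?modz_ge0.
    rewrite leqNgt => /negP; apply.
    by rewrite -ltz_nat gez0_abs ?modz_ge0 // ltz_pmod // ltz_nat.
  exists 2%N; split=> // m xm; have [->|m0] := eqVneq m 0; first exact: dvdz0.
  case: nT; exists `|m|%N; rewrite /T absz_gt0 m0 /=; apply/eqP.
  by rewrite -[x *+ _]/(x *~ `|m|%N) abszEsg -mulrzA_C xm mul0rz.
have dq : (d%:Z)%:~R != 0 :> rat by rewrite intr_eq0 eqz_nat -lt0n ltnW.
pose t : D := p ((d%:Z)%:~R^-1 : rat).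
have dt : d%:Z *: t = 0.
  by rewrite -linearZ; apply/pP; exists 1; rewrite scalezrE -mulrzr mulVf.
pose G (z : intmod V * D) := exists m : int, z = m *: (x : intmod V, t).
have [|h hP] := baer_extension (G := G) bD.
  split; first exact: submodule_cyclic.
  move=> u [m [/esym xm ->]]; have /dvdzP[k ->] := dP m xm.
  by rewrite -scalerA dt scaler0.
exists h; rewrite -(hP x t); last by exists 1; rewrite scale1r.
move=> /pP[m mE]; move: d1; rewrite ltnNge => /negP; apply.
have : (d%:Z %| 1)%Z.
  apply/dvdzP; exists m; apply/eqP; rewrite -(eqr_int rat) intrM -mE mulVf //.
by rewrite dvdz1 absz_nat => /eqP ->.
Qed.
End RationalsModIntegers.


(* The product over [T] of copies of [Hom_Z(R, D)], where [R] acts on the left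
   through right multiplication on the source. *)
Section Coinduced.
Variables (R : pzRingType) (T : Type) (D : zmodType).

Record coinduced : Type := Coinduced {
  coind_val :> T -> R -> D;
  coind_add : forall x s s', coind_val x (s + s') = coind_val x s + coind_val x s'
}.

HB.instance Definition _ := gen_eqMixin coinduced.
HB.instance Definition _ := gen_choiceMixin coinduced.

Lemma coind_ext (f g : coinduced) : (forall x s, f x s = g x s) -> f = g.
Proof.
case: f => f fD; case: g => g gD /= fg.
have e : f = g by apply/funext => x; apply/funext => s.
by subst g; rewrite (Prop_irrelevance fD gD).
Qed.

Program Definition coind0 := Coinduced (coind_val := fun _ _ => 0) _.
Next Obligation. by rewrite addr0. Qed.
Program Definition coindD (f g : coinduced) := Coinduced (coind_val := fun x s => f x s + g x s) _.
Next Obligation. by rewrite !coind_add addrACA. Qed.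
Program Definition coindN (f : coinduced) := Coinduced (coind_val := fun x s => - f x s) _.
Next Obligation. by rewrite !coind_add opprD. Qed.
Program Definition coindZ r (f : coinduced) := Coinduced (coind_val := fun x s => f x (s * r)) _.
Next Obligation. by rewrite mulrDl coind_add. Qed.

Lemma coindA : associative coindD.
Proof. by move=> f g h; apply: coind_ext => x s /=; rewrite addrA. Qed.
Lemma coindC : commutative coindD.
Proof. by move=> f g; apply: coind_ext => x s /=; rewrite addrC. Qed.
Lemma coind0D : left_id coind0 coindD.
Proof. by move=> f; apply: coind_ext => x s /=; rewrite add0r. Qed.
Lemma coindND : left_inverse coind0 coindN coindD.
Proof. by move=> f; apply: coind_ext => x s /=; rewrite addNr. Qed.
HB.instance Definition _ := GRing.isZmodule.Build coinduced coindA coindC coind0D coindND.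

Lemma coind_scaleA a b v : coindZ a (coindZ b v) = coindZ (a * b) v.
Proof. by apply: coind_ext => x s /=; rewrite mulrA. Qed.
Lemma coind_scale1 : left_id 1 coindZ.
Proof. by move=> f; apply: coind_ext => x s /=; rewrite mulr1. Qed.
Lemma coind_scaleDr : right_distributive coindZ +%R.
Proof. by move=> a f g; apply: coind_ext. Qed.
Lemma coind_scaleDl v : {morph coindZ^~ v : a b / a + b}.
Proof. by move=> a b; apply: coind_ext => x s /=; rewrite mulrDr coind_add. Qed.
HB.instance Definition _ := GRing.Zmodule_isLmodule.Build R coinduced
  coind_scaleA coind_scale1 coind_scaleDr coind_scaleDl.

Lemma coind_val0 x s : (0 : coinduced) x s = 0. Proof. by []. Qed.
End Coinduced.

Lemma coind_valMz (R : pzRingType) (T : Type) (D : lmodType int) (f : coinduced R T D) x s a :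
  f x (s *~ a) = a *: f x s.
Proof.
have fB : zmod_morphism (f x : R -> D).
  by move=> u v; apply: (addIr (f x v)); rewrite -coind_add !subrK.
pose g : {additive R -> D} := HB.pack (f x : R -> D) (GRing.isZmodMorphism.Build _ _ (f x : R -> D) fB).
by have /= -> := raddfMz g a s; rewrite -scaler_int intz.
Qed.

(** Adjunction: a linear map into the coinduced module is determined by its values at 1, which are
    additive maps into [D], one for each index in [T]. Extending these over [R] suffices. *)
Lemma coinduced_baer (R : pzRingType) (T : Type) (D : lmodType int) :
  baer D -> baer (coinduced R T D).
Proof.
move=> bD G [hG G0].
have ext (x : T) : exists g : {linear (zmodule R : lmodType int) -> D},
    forall r u, G (r, u) -> u x 1 = g r.
  pose H (z : (zmodule R : lmodType int) * D) := exists2 u : coinduced R T D, G (z.1, u) & u x 1 = z.2.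
  have [|g gP] := baer_extension (G := H) bD.
    split; last by move=> d [u /= /G0 -> <-].
    split; first by exists 0 => //; case: hG.
    move=> a [r d] [r' d'] [u Gu /= <-] [u' Gu' /= <-].
    exists ((a%:~R : R) *: u + u').
      have := submoduleD hG (submoduleZ (a%:~R : R) hG Gu) Gu'.
      congr (G (_, _)); rewrite /=; congr (_ + _).
      by rewrite scalezrE -mulrzl.
    change (u x (1 * a%:~R) + u' x 1 = a *: u x 1 + u' x 1).
    by rewrite mul1r coind_valMz.
  by exists g => r u Gru; apply: gP; exists u.
have [g gP] := choice ext.
have gadd x s s' : g x (s + s') = g x s + g x s' by rewrite linearD.
exists (Coinduced gadd) => r u Gru; apply: coind_ext => x s.
have /(gP x) := submoduleZ s hG Gru.
by rewrite -[u in LHS]/(u) /= => <-; rewrite -{1}[s]mul1r.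
Qed.

(** The index set is [R] itself: the component at [x] is built from a character not vanishing at
    [x], so every nonzero element is detected by its own component. *)
Lemma enough_injectives (R : pzRingType) :
  exists (I : lmodType R) (i : {linear R^o -> I}), baer I /\ injective i.
Proof.
have [D [bD Dcog]] := divisible_cogenerator.
have hx (x : R) : exists h : {linear (zmodule R : lmodType int) -> D}, x <> 0 -> h x <> 0.
  have [->|/eqP x0] := eqVneq x 0; first by exists \0.
  by have [h hP] := Dcog R x x0; exists h.
have [h hP] := choice hx.
have eadd (r : R) x s s' : h x ((s + s') * r) = h x (s * r) + h x (s' * r).
  by rewrite mulrDl -linearD.
pose e (r : R^o) : coinduced R R D := Coinduced (eadd r).
have el : linear e.
  move=> a r r'; apply: coind_ext => x s /=.
  by rewrite [a *: r](_ : _ = (a : R) * r) // mulrDr mulrA -linearD.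
pose i : {linear R^o -> coinduced R R D} := HB.pack e (GRing.isLinear.Build R _ _ *:%R e el).
exists (coinduced R R D), i; split; first exact: coinduced_baer.
have i0 r : i r = 0 -> r = 0.
  move=> ir; apply: contrapT => r0; apply: (hP r r0).
  have := congr1 (fun f : coinduced R R D => f r 1) ir.
  by rewrite coind_val0 /= mul1r.
by move=> r r' irr; apply/subr0_eq/i0; rewrite linearB irr subrr.
Qed.

(** Baer's condition is checked for [C = I / R]. Lift a map from a left ideal to [C] to a map from a
    free cover to [I]; on relations its values lie in [R]. The hypothesis extends this form to the
    cover, and subtracting the extension leaves a map from the ideal to [I], where Baer's condition
    holds. *)
Lemma injdim1_criterion (R : pzRingType) :
  (forall M : lmodType R, finitely_generated M -> finite_length M) ->
  (forall n m l (a : {linear 'rV[R]_n -> 'rV[R]_m}) (b : {linear 'rV[R]_m -> 'rV[R]_l}),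
     (forall x, b x = 0 <-> exists y, a y = x) -> extendable a) ->
  injdim_le 1 (R^o : lmodType R).
Proof.
move=> finR ext; have [I [i [bI ii]]] := enough_injectives R.
have [C [p [sp pP]]] := quot_exists (submodule_im i).
exists I, C, i, p; split; [exact: baer_injective | by split | apply: baer_injective].
move=> G [hG G0].
have hJ : submodule (fun r : R^o => exists u, G (r, u)).
  split=> [|a r r' [u Gu] [u' Gu']]; first by exists 0; case: hG.
  by exists (a *: u + u'); case: hG => _ h; apply: (h a (_, _) (_, _)).
have fR : finite_length (R^o : lmodType R).
  apply: finR; exists 1%N, (fun=> 1 : R^o) => x; exists (fun=> x).
  by rewrite big_ord1 [_ *: _]mulr1.
have [m [g gP]] := finite_length_fg_submodule fR hJ.
have u0 j : exists u, G (g j, u).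
  apply/gP.
  exists (fun k => (k == j)%:R); rewrite (bigD1 j) //= eqxx scale1r big1 ?addr0 // => k kj.
  by rewrite (negPf kj) scale0r.
have [u uP] := choice u0; have [v vP] := choice (fun j => sp (u j)).
pose b : {linear 'rV[R]_m -> 'rV[R]_1} := row_map (fun=> row_comb g).
have b0 c : b c = 0 -> row_comb g c = 0.
  by move=> /rowP/(_ 0); rewrite !mxE.
have Guc c : G (row_comb g c, p (row_comb v c)).
  have -> : (row_comb g c, p (row_comb v c)) = \sum_j c 0 j *: (g j, u j).
    rewrite [RHS]surjective_pairing !linear_sum /=; congr (_, _) => //.
    by apply: eq_bigr => j _; rewrite linearZ vP.
  by apply: submodule_sum => // j; apply: submoduleZ.
have [n [X XP]] := rV_submodule_rows (finR _ (rV_fg R m)) (submodule_ker b).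
have [|f fP] := factor_mono (f := row_comb v \o row_mulmx X) ii.
  move=> d; apply/pP; apply: G0.
  have := Guc (row_mulmx X d); rewrite [row_comb g _]b0 //.
  by apply/XP; exists d.
have [|d dX|h hP] := ext n m 1%N (row_mulmx X) b _ f.
- by move=> c; rewrite XP; split=> -[d dE]; exists d.
- by apply: ii; rewrite fP /= -[d *m X]/(row_mulmx X d) dX !linear0.
pose psi : {linear 'rV[R]_m -> I} := row_comb v \- (i \o h).
pose H (z : (R^o : lmodType R) * I) := exists c, (row_comb g c, psi c) = z.
have [|y yP] := bI H.
  split; first exact: (submodule_im (pair_map (row_comb g) psi)).
  move=> w [c [gc <-]]; have [d ->] : exists d : 'rV_n, c = d *m X.
    by apply/XP; apply/rowP => k; rewrite !mxE.
  rewrite /psi /= (_ : h (d *m X) = f d); last by rewrite -hP.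
  by rewrite fP /= subrr.
exists (p y) => r w Grw.
have [c rE] : exists c : 'rV[R]_m, r = row_comb g c.
  have /gP[c ->] : exists w, G (r, w) by exists w.
  by exists (\row_j c j); apply: eq_bigr => j _; rewrite mxE.
have -> : w = p (row_comb v c).
  apply/subr0_eq/G0; have := submoduleB hG Grw (Guc c).
  by congr (G (_, _)); rewrite /= rE subrr.
rewrite -linearZ -(yP r (psi c)); last by exists c; rewrite rE.
rewrite /psi linearB /= [X in _ - X](_ : _ = 0) ?subr0 //.
by apply/pP; exists (h c).
Qed.

(** * Homological consequences of radical generation *)
Section RadicalGeneration.
Variable S : pzRingType.
Hypothesis finS : forall M : lmodType S, finitely_generated M -> finite_length M.
Local Notation rad := (radical (S^o : lmodType S)).

Definition ext1_coreflexive (G : lmodType S) := ext1_vanishes G /\ coreflexive G.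

Lemma ext1_coreflexive_retract (G Y : lmodType S) (s : {linear G -> Y}) (r : {linear Y -> G}) :
  cancel s r -> ext1_coreflexive Y -> ext1_coreflexive G.
Proof. by move=> sr [eY cY]; split; [apply: ext1_retract sr eY | apply: coreflexive_retract sr cY]. Qed.

Lemma ext1_coreflexive_extension (X Y Z : lmodType S) (i : {linear X -> Y}) (q : {linear Y -> Z}) :
  short_exact i q -> ext1_coreflexive X -> ext1_coreflexive Z -> ext1_coreflexive Y.
Proof.
move=> ex [eX cX] [eZ cZ]; split; first exact: ext1_extension ex eX eZ.
exact: coreflexive_extension ex eZ cX cZ.
Qed.

Lemma ext1_coreflexive_projective (P : lmodType S) : fg_projective P -> ext1_coreflexive P.
Proof. by move=> fP; split; [apply: projective_ext1; case: fP | apply: projective_coreflexive]. Qed.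

Lemma ext1_coreflexive_prod (X Z : lmodType S) :
  ext1_coreflexive X -> ext1_coreflexive Z -> ext1_coreflexive (X * Z)%type.
Proof.
apply: (ext1_coreflexive_extension (i := pair_map idfun \0) (q := snd)); split.
- by move=> x x' [].
- by move=> z; exists (0, z).
- by move=> [x z]; split=> [/= ->|[y <-]//]; exists x.
Qed.

(* [e] is taken in a left ideal [L] minimal for [L + I = S]; by minimality the
   intersection of [L] and [I] lies in every maximal left ideal. *)
Lemma maximal_submodule_complement (I : S^o -> Prop) : maximal_submodule I ->
  exists e : S, I (1 - e) /\ forall x : S, I x -> (x * e : S^o) \in @in_radical S S^o.
Proof.
move=> mI; have [hI _ _] := mI.
pose F (L : S^o -> Prop) := submodule L /\ exists e, L e /\ I (1 - e).
have [n ln] := finS (regular_fg S).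
have [||L [hL [e [Le Ie]]] Lmin] := @minimal_submodule S S^o F n (fun _ => True) _ _ ln.
- by move=> L [].
- by split=> //; exists 1; split=> //; rewrite subrr; case: hI.
exists e; split=> // x Ix; apply/asboolP => I' mI'; have [hI' _ _] := mI'.
have Lxe : L (x * e : S^o) := submoduleZ x hL Le.
have Ixe : I (x * e : S^o).
  have -> : (x * e : S^o) = x - x *: (1 - e : S^o).
    by rewrite scalerBr [x *: (1 : S^o)]mulr1 opprB addrC subrK.
  exact: (submoduleB hI Ix (submoduleZ x hI Ie)).
apply: contrapT => I'xe; have [a I'a] := maximal_submodule_gen (e : S^o) mI' I'xe.
apply: I'xe; apply: (proj2 (_ : L (x * e : S^o) /\ I' (x * e : S^o))).
apply: (Lmin (fun z => L z /\ I' z)) => //; last by move=> z [].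
split; first exact: submoduleI.
exists (e - a *: (x * e : S^o)); split; first split=> //.
  by apply: submoduleB => //; apply: submoduleZ.
by rewrite opprB addrCA addrC; apply: submoduleD => //; apply: submoduleZ.
Qed.

Hypothesis rad_good : ext1_coreflexive rad.

(** Write [x = x e + x (1 - e)]: on [I] the first term lies in the radical, and [1 - e] lies in [I].
    So [x |-> (x e, x)] makes [I] a retract of [rad * S]. *)
Lemma maximal_submodule_good (I : S^o -> Prop) (N : lmodType S) (k : {linear N -> S^o}) :
  maximal_submodule I -> injective k -> (forall x, I x <-> exists y, k y = x) ->
  ext1_coreflexive N.
Proof.
move=> mI ik kP; have [e [Ie Ierad]] := maximal_submodule_complement mI; have [hI _ _] := mI.
have [|f fP] := factor_mono (i := (\val : {linear rad -> S^o})) (f := linear_mulr (e : S^o) \o k) val_inj.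
  move=> x; have h : (k x * e : S^o) \in @in_radical S S^o by apply: Ierad; apply/kP; exists x.
  by exists (MkRadical h).
pose h : {linear (rad * S^o)%type -> S^o} :=
  ((\val : {linear rad -> S^o}) \o fst) \+ (linear_mulr (1 - e : S^o) \o snd).
have [|g gP] := factor_mono (f := h) ik.
  move=> [r y]; apply/kP; apply: submoduleD => //=; last exact: submoduleZ.
  by have /asboolP rI := valP r; apply: (rI I).
apply: (ext1_coreflexive_retract (s := pair_map f k) (r := g)).
  move=> x; apply: ik; rewrite gP /=; have /= -> := fP x; rewrite /linear_mulr.
  by rewrite scalerBr [_ *: (1 : S^o)]mulr1 addrC subrK.
by apply: ext1_coreflexive_prod => //; apply: ext1_coreflexive_projective; apply: regular_fg_projective.
Qed.

(* Induction from above on submodules of a free module, adding one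
   composition factor [S / J] at a time: [0 -> J -> N + S -> N1 -> 0]. *)
Lemma torsionless_good (G : lmodType S) : torsionless G -> ext1_coreflexive G.
Proof.
move=> [n [e ie]].
have frV := finS (rV_fg S n).
pose good (I : 'rV[S]_n -> Prop) := forall (N : lmodType S) (k : {linear N -> 'rV[S]_n}),
  injective k -> (forall x, I x <-> exists y, k y = x) -> ext1_coreflexive N.
suff allgood I : submodule I -> good I by apply: (allgood _ (submodule_im e)) ie _.
move=> hI0; apply: contrapT => bad0.
pose F I := submodule I /\ ~ good I.
have [||{I hI0 bad0}I [hI badI] Imax] := @maximal_element S _ F I frV.
- by move=> J [].
- by [].
have goodT : good (fun _ => True).
  move=> N k ik kP; have [|s [ks sk]] := linear_inverse ik; first by move=> y; apply/kP.
  by apply: (ext1_coreflexive_retract ks); apply: ext1_coreflexive_projective; apply: rV_fg_projective.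
pose F1 J := [/\ submodule J, forall x, I x -> J x & exists2 x, J x & ~ I x].
have F1T : F1 (fun _ => True).
  split=> //; apply: contrapT => nx; apply: badI => N k ik kP; apply: (goodT N k ik) => x.
  by rewrite -kP; split=> // _; apply: contrapT => Ix; apply: nx; exists x.
have [l lrV] := frV.
have [|I1 [hI1 II1 [x I1x Ix]] I1min] := @minimal_submodule S _ F1 l _ _ F1T lrV.
  by move=> J [].
have goodI1 : good I1 by apply: contrapT => bad; apply: Ix; apply: (Imax I1).
have span y : I1 y -> forall r : S, ~ I (r *: x) -> exists a : S, I (y - a *: (r *: x)).
  move=> I1y r Irx.
  pose J z := exists u v, [/\ I u, exists a : S, v = a *: (r *: x) & z = u + v].
  have [||u [_ [Iu [a ->] ->]]] := I1min J _ _ y I1y; last by exists a; rewrite addrK.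
    split; first by apply: submodule_add => //; apply: submodule_cyclic.
      by move=> u Iu; exists u, 0; rewrite addr0; split=> //; exists 0; rewrite scale0r.
    exists (r *: x) => //; exists 0, (r *: x); rewrite add0r.
    by split=> //; [case: hI | exists 1; rewrite scale1r].
  move=> _ [u [_ [Iu [a ->] ->]]]; apply: submoduleD => //; first exact: II1.
  by do 2 apply: submoduleZ => //.
(* [I1 / I] is simple and generated by [x], and [J] is the annihilator of that generator, hence a
   maximal left ideal. *)
pose J (r : S^o) := I (linear_mulr x r).
have hJ : submodule J by apply: submodule_preim.
have mJ : maximal_submodule J.
  split=> //; first by exists 1; rewrite /J /linear_mulr scale1r.
  move=> J' hJ' JJ' [s J's] r J'r; apply: contrapT => Jr.
  have [a aP] := span x I1x r Jr.
  apply: J's; rewrite -[s]mulr1; apply: (submoduleZ s hJ').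
  rewrite -(subrK (a * r) 1); apply: (submoduleD hJ'); last exact: (submoduleZ a hJ' J'r).
  by apply: JJ'; rewrite /J /linear_mulr scalerBl scale1r -scalerA.
have [NJ [kJ [ikJ kJP]]] := sub_exists hJ.
have [N1 [k1 [ik1 k1P]]] := sub_exists hI1.
apply: badI => N k ik kP.
have [|c cP] := factor_mono (f := linear_mulr x \o kJ) ik.
  by move=> z; apply/kP; apply/kJP; exists z.
pose q0 : {linear (N * S^o)%type -> 'rV[S]_n} := (k \o fst) \+ (linear_mulr x \o snd).
have [|q qP] := factor_mono (f := q0) ik1.
  move=> [a r]; apply/k1P; apply: submoduleD => //=; last exact: submoduleZ.
  by apply: II1; apply/kP; exists a.
apply: (ext1_coreflexive_retract (s := pair_map idfun \0) (r := fst) (Y := (N * S^o)%type)) => //.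
apply: (ext1_coreflexive_extension (i := pair_map c (\- kJ)) (q := q)).
- split.
  + by move=> z z' [_ /oppr_inj/ikJ].
  + move=> z; have I1z : I1 (k1 z) by apply/k1P; exists z.
    have [|a Ia] := span _ I1z 1; first by rewrite scale1r.
    move: Ia; rewrite scale1r => /kP[y ky].
    by exists (y, a); apply: ik1; rewrite qP /= ky /linear_mulr subrK.
  + move=> [y r]; split=> [qyr|[z <-]]; last first.
      apply: ik1; rewrite qP linear0 /= cP /= -linearD subrr linear0 //.
    have e0 : k y + linear_mulr x r = 0 by have /= <- := qP (y, r); rewrite qyr linear0.
    have [z zE] : exists z, kJ z = - r.
      apply/kJP; rewrite /J linearN; apply: submoduleN => //; apply/kP.
      exists (- y); apply/eqP; rewrite linearN eq_sym -addr_eq0 addrC; exact/eqP.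
    exists z; congr (_, _); last by rewrite /= zE opprK.
    by apply: ik; rewrite cP /= zE linearN; apply/eqP; rewrite eq_sym -addr_eq0 e0.
- exact: maximal_submodule_good mJ ikJ kJP.
- exact: goodI1 ik1 k1P.
Qed.
End RadicalGeneration.


Lemma image_factor (R : pzRingType) (M N : lmodType R) (f : {linear M -> N}) :
  exists (L : lmodType R) (p : {linear M -> L}) (i : {linear L -> N}),
    [/\ surjective p, injective i & forall x, f x = i (p x)].
Proof.
have [L [i [ii iP]]] := sub_exists (submodule_im f).
have [|p pP] := factor_mono (f := f) ii; first by move=> x; apply/iP; exists x.
exists L, p, i; split=> // z.
by have [x xE] := proj2 (iP (i z)) (ex_intro _ z erefl); exists x; apply: ii; rewrite pP.
Qed.

(** * Injective dimension on both sides *)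

Section LeftRight.
Variable A : pzRingType.
Local Notation S := (A^c).
Hypothesis finA : forall M : lmodType A, finitely_generated M -> finite_length M.
Hypothesis finS : forall M : lmodType S, finitely_generated M -> finite_length M.
Hypothesis good : forall G : lmodType S, torsionless G -> ext1_coreflexive G.

Lemma right_injdim1 : injdim_le 1 (S^o : lmodType S).
Proof.
apply: injdim1_criterion => // n m l a b ab.
have [G [p [i [sp ii pE]]]] := image_factor b.
have [eG _] : ext1_coreflexive G by apply: good; exists l, i.
apply: (eG _ _ a p sp) => x; rewrite -ab pE.
by split=> [->|px]; [rewrite linear0 | apply: ii; rewrite px linear0].
Qed.

Lemma mul_tr_eq0 m n p (P : 'M[A]_(m, n)) (Q : 'M[A]_(n, p)) :
  P *m Q = 0 <-> (Q^T : 'M[S]_(p, n)) *m (P^T : 'M[S]_(n, m)) = 0.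
Proof.
rewrite mulmx_trc; split=> [->|e]; first by rewrite trmx0.
by apply/trmx_inj; rewrite e trmx0.
Qed.

(* The image [G] of the transposed matrix [Xt] has two approximations: [j], of
   which the cokernel is to be shown torsionless, and [i], given by coreflexivity. *)
Lemma left_injdim1 : injdim_le 1 (A^o : lmodType A).
Proof.
apply: injdim1_criterion => // n m l a b ab.
have [X XE] := linear_rV_mx a; have [Y YE] := linear_rV_mx b.
have kerY (c : 'rV_m) : c *m Y = 0 -> exists d : 'rV_n, c = d *m X.
  by rewrite -YE => /ab[d <-]; exists d; rewrite XE.
have XY : X *m Y = 0.
  apply/row_matrixP => i; rewrite row_mul row0 -YE; apply/ab.
  by exists (delta_mx 0 i); rewrite XE rowE.
move=> f fa; pose y' : 'cV[A]_n := \col_i f (delta_mx 0 i).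
have kerX (c : 'rV_n) : c *m X = 0 -> c *m y' = 0.
  move=> cX; apply/matrixP => i k; rewrite !ord1 [RHS]mxE -linear_rVE.
  by apply: fa; rewrite XE.
pose Xt : 'M[S]_(m, n) := X^T; pose Yt : 'M[S]_(l, m) := Y^T; pose y : 'rV[S]_n := y'^T.
have [G [p [j [sp ij jp]]]] := image_factor (row_mulmx Xt).
have [_ [P [i [fP ii ei si]]]] : ext1_coreflexive G by apply: good; exists n, j.
have j0 x : j x = 0 -> x = 0 by move=> jx; apply: ij; rewrite jx linear0.
have i0 x : i x = 0 -> x = 0 by move=> ix; apply: ii; rewrite ix linear0.
(* A form on [G], pulled back to the free module, is a column killed by [Yt]; exactness on the left
   side makes its transpose a multiple of [X], which is the extension. *)
have ej : extendable j.
  move=> h _; pose c : 'cV[S]_m := \col_k h (p (delta_mx 0 k)).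
  have hpE x : h (p x) = (x *m c) 0 0 := linear_rVE (h \o p) x.
  have Yc : Yt *m c = 0.
    apply/row_matrixP => u; apply/rowP => k; rewrite ord1 row_mul [row u Yt]rowE -hpE [RHS]mxE mxE.
    rewrite (_ : p _ = 0) ?linear0 //; apply: j0; rewrite -jp /= -mulmxA.
    by rewrite (proj1 (mul_tr_eq0 X Y) XY) mulmx0.
  have [d dE] : exists d : 'rV[A]_n, (c^T : 'rV[A]_m) = d *m X.
    by apply/kerY/mul_tr_eq0; rewrite trmxK.
  exists (dot (d^T : 'cV[S]_n)) => x; have [z <-] := sp x.
  rewrite hpE -jp /= /dot -mulmxA; congr ((_ *m _) _ _).
  by rewrite mulmx_trc -dE trmxK.
(* [al] and [be] compare the two approximations of [G]. Since [1 - be al] kills [G] and [y] is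
   killed by every form that kills [G], membership of [y] in [G] can be tested inside [P], where
   coreflexivity decides it. *)
have [al alP] : exists al : {linear 'rV[S]_n -> P}, forall x, al (j x) = i x.
  by apply: (extendable_projective ej fP) => x /j0 ->; rewrite linear0.
have [be beP] : exists be : {linear P -> 'rV[S]_n}, forall x, be (i x) = j x.
  by apply: (extendable_projective ei (rV_fg_projective S n)) => x /i0 ->; rewrite linear0.
have hy (h : {linear 'rV[S]_n -> S^o}) : (forall x, h (j x) = 0) -> h y = 0.
  move=> hj; pose c : 'cV[S]_n := \col_k h (delta_mx 0 k).
  have hE x : h x = (x *m c) 0 0 := linear_rVE h x.
  have Xc : Xt *m c = 0.
    apply/row_matrixP => u; apply/rowP => k; rewrite ord1 row_mul -hE [row u Xt]rowE.
    by rewrite -[delta_mx 0 u *m Xt]/(row_mulmx Xt (delta_mx 0 u)) jp hj !mxE.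
  rewrite hE; suff -> : y *m c = 0 by rewrite mxE.
  have : (c^T : 'rV[A]_n) *m y' = 0 by apply/kerX/mul_tr_eq0; rewrite trmxK.
  by move/mul_tr_eq0; rewrite trmxK.
have [g ig] : exists g, i g = al y.
  by apply: si => h hi; apply: (hy (h \o al)) => x /=; rewrite alP hi.
have yE : y = j g.
  rewrite -beP ig; apply/eqP; rewrite -subr_eq0; apply/eqP/rowP => k; rewrite [RHS]mxE.
  apply: (hy (row_coord k \o (idfun \- (be \o al)))) => x /=.
  by rewrite alP beP subrr linear0.
have [x px] := sp g.
have yX : y' = X *m (x^T : 'cV[A]_m).
  apply/trmx_inj; have := mulmx_trc X (x^T : 'cV[A]_m); rewrite trmxK => <-.
  by rewrite -[LHS]/y yE -px -jp.
exists (dot (x^T : 'cV[A]_m)) => c.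
by rewrite [RHS]linear_rVE -/y' yX XE /= /dot mulmxA.
Qed.

Lemma one_gorenstein_of_good : one_gorenstein A.
Proof. by split; [apply: left_injdim1 | apply: right_injdim1]. Qed.
End LeftRight.

(** * Regularity of the stable category *)
Section FactorsProjective.
Variable S : pzRingType.
Implicit Types L M N P Q : lmodType S.

Lemma factors_projective_ext M N (f g : {linear M -> N}) :
  f =1 g -> factors_projective f -> factors_projective g.
Proof. by move=> fg [P [h [k [fP fE]]]]; exists P, h, k; split=> // x; rewrite -fg. Qed.

Lemma factors_projective_compl L M N (f : {linear M -> N}) (g : {linear L -> M}) :
  factors_projective f -> factors_projective (f \o g).
Proof. by move=> [P [h [k [fP fE]]]]; exists P, h, (k \o g); split=> // x /=. Qed.

Lemma factors_projectiveD M N (f g : {linear M -> N}) :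
  factors_projective f -> factors_projective g -> factors_projective (f \+ g).
Proof.
move=> [P [h [k [fP fE]]]] [Q [h' [k' [fQ gE]]]].
exists (P * Q)%type, ((h \o fst) \+ (h' \o snd)), (pair_map k k').
by split; [apply: fg_projective_prod | move=> x /=; rewrite fE gE].
Qed.

Lemma factors_through_fg_projective M N P (h : {linear P -> N}) (g : {linear M -> P}) :
  fg_projective P -> factors_projective (h \o g).
Proof. by move=> fP; exists P, h, g. Qed.

Lemma torsionless_prod M N : torsionless M -> torsionless N -> torsionless (M * N)%type.
Proof.
move=> [m [e ie]] [n [e' ie']].
apply: (@torsionless_fg_projective S _ ('rV[S]_m * 'rV[S]_n)%type (pair_map (e \o fst) (e' \o snd))).
  by apply: fg_projective_prod; apply: rV_fg_projective.
by move=> [x y] [x' y'] [/ie -> /ie' ->].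
Qed.

Lemma fg_prod M N : finitely_generated M -> finitely_generated N -> finitely_generated (M * N)%type.
Proof.
move=> /fgP[m [p sp]] /fgP[n [q sq]].
have [fg _] := fg_projective_prod (rV_fg_projective S m) (rV_fg_projective S n).
apply: (fg_quotient (p := pair_map (p \o fst) (q \o snd))) fg => -[x y].
by have [u <-] := sp x; have [v <-] := sq y; exists (u, v).
Qed.
End FactorsProjective.

Section StableCategoryRegular.
Variable S : pzRingType.
Implicit Types G H K L M N P Q : lmodType S.
Local Notation generator := (radical (S^o : lmodType S) * S^o)%type.
Hypothesis finS : forall M, finitely_generated M -> finite_length M.
Hypothesis tlG : forall M, finitely_generated M -> torsionless M -> gorenstein_projective M.
Hypothesis generated : forall M, gorenstein_projective M -> in_add generator M.

Lemma fg_sub M N (i : {linear N -> M}) :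
  injective i -> finitely_generated M -> finitely_generated N.
Proof. by move=> ii fM; apply/finite_length_fg/(finite_length_sub ii)/finS. Qed.

Lemma torsionless_ext1 M : finitely_generated M -> torsionless M -> ext1_vanishes M.
Proof. by move=> fM tM; apply/gorenstein_projective_ext1/tlG. Qed.

(* The components [L -> rad] and [L -> S] of the maps expressing [L] as a
   summand extend to [K], and the extensions of the former stay in [rad]. *)
Lemma radical_valued_split K L G (l : {linear L -> K}) (p : {linear K -> G}) :
  radical_valued K -> short_exact l p -> ext1_vanishes G -> in_add generator L ->
  exists r : {linear K -> L}, cancel l r.
Proof.
move=> rK [il sp lp] eG /in_addP[n [a [b ab]]].
have el : extendable l by apply: (eG _ _ l p sp) => x; apply: lp.
have l0 y : l y = 0 -> y = 0 by move=> ly; apply: il; rewrite ly linear0.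
have ext i : exists a' : {linear K -> generator}, forall y, a' (l y) = a i y.
  have [|g gP] := el ((\val : {linear radical (S^o : lmodType S) -> S^o}) \o fst \o a i).
    by move=> y /l0 ->; rewrite linear0.
  have [|h hP] := el (snd \o a i); first by move=> y /l0 ->; rewrite linear0.
  have [|g' g'P] := factor_mono (i := (\val : {linear radical (S^o : lmodType S) -> S^o})) (f := g) val_inj.
    by move=> x; exists (MkRadical (rK g x)).
  exists (pair_map g' h) => y; rewrite [RHS]surjective_pairing; congr (_, _); last exact: hP.
  by apply: val_inj; rewrite g'P gP.
have [a' a'P] := choice ext.
exists (ffun_sum b \o ffun_map a') => y /=.
by rewrite [RHS]ab; apply: eq_bigr => i _; rewrite ffunE a'P.
Qed.

(** The image of [e] is torsionless, so the kernel splits off, and [e] is injective on the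
    complement [K2]. *)
Lemma radical_valued_coimage K N (e : {linear K -> N}) :
  finitely_generated K -> torsionless K -> radical_valued K -> torsionless N ->
  exists K2 (s : {linear K2 -> K}) (r : {linear K -> K2}),
    injective (e \o s) /\ forall x, e x = e (s (r x)).
Proof.
move=> fK tK rK tN.
have [G [p [i [sp ii pE]]]] := image_factor e.
have [L [l [il lP]]] := sub_exists (submodule_ker p).
have fL := fg_sub il fK; have tL := torsionless_sub il tK.
have fG := fg_quotient sp fK; have tG := torsionless_sub ii tN.
have [r rl] := radical_valued_split rK (And3 il sp lP) (torsionless_ext1 fG tG) (generated (tlG fL tL)).
have [K2 [s [ins sP]]] := sub_exists (submodule_ker r).
have [|r2 r2P] := factor_mono (f := idfun \- (l \o r)) ins.
  by move=> x; apply/sP; rewrite linearB /= rl subrr.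
have el y : e (l y) = 0 by rewrite pE (proj2 (lP _)) ?linear0 //; exists y.
exists K2, s, r2; split; last by move=> x; rewrite r2P /= linearB el subr0.
have ker0 z : e (s z) = 0 -> z = 0.
  rewrite pE -(linear0 i) => /ii/lP[w lw]; apply: ins; rewrite linear0 -lw.
  suff -> : w = 0 by rewrite linear0.
  by rewrite -[w]rl lw; apply/sP; exists z.
by move=> z z' /= ez; apply/subr0_eq/ker0; rewrite !linearB ez subrr.
Qed.

(* [f] belongs to the radical of the category of modules. *)
Definition radical_map N H (f : {linear N -> H}) : Prop :=
  forall K (i : {linear K -> N}) (p : {linear H -> K}),
    (forall z, p (f (i z)) = z) -> forall z : K, z = 0.

Lemma radical_map_nilpotent N H (f : {linear N -> H}) (g : {linear H -> N}) :
  finitely_generated N -> radical_map f -> exists n, forall x, linear_iter (g \o f) n x = 0.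
Proof.
move=> fN rf; apply: contrapT => nn.
have [|K [i [p [[z z0] pP]]]] := non_nilpotent_summand (f := g \o f) (finS fN).
  move=> n; apply: contrapT => nx; apply: nn; exists n => x.
  by apply: contrapT => x0; apply: nx; exists x.
by apply: z0; apply: (rf K i (p \o g)).
Qed.

Lemma radical_map_factors_projective N : finite_length N -> torsionless N ->
  forall H (f : {linear N -> H}), finitely_generated H -> torsionless H ->
    radical_map f -> factors_projective f.
Proof.
move: N; apply: finite_length_ind => N flN IH tN H f fH tH rf.
have fN := finite_length_fg flN.
have IH' N1 (i : {linear N1 -> N}) : injective i -> ~ surjective i ->
    factors_projective (f \o i).
  move=> ii ni; apply: (IH N1 i ii ni (torsionless_sub ii tN) H) => //.
  by move=> K k p pP; apply: (rf K (i \o k) p).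
apply: contrapT => nf.
have [n [pi spi]] := proj1 (fgP H) fH.
pose F := 'rV[S]_n; have fF : fg_projective F := rV_fg_projective S n.
pose d : {linear (N * F)%type -> H} := (f \o fst) \- (pi \o snd).
have [C [k [ik kP]]] := sub_exists (submodule_ker d).
have kE c : f (k c).1 = pi (k c).2 by apply/subr0_eq/(proj2 (kP (k c))); exists c.
pose e : {linear C -> N} := fst \o k.
have se : surjective e.
  move=> x; have [y py] := spi (f x).
  have [c ck] : exists c, k c = (x, y) by apply/kP; rewrite /d /= py subrr.
  by exists c; rewrite /e /= ck.
have fC : finitely_generated C by apply: (fg_sub ik); apply: fg_prod => //; apply: rV_fg.
have tC : torsionless C.
  by apply: (torsionless_sub ik); apply: torsionless_prod => //; exists n, idfun.
have [C0 [i0 [p0 [Q [t [s [rC0 ip fQ dec]]]]]]] := radical_valued_decomposition finS (finS fC).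
have [K2 [s2 [r2 [ie2 e2P]]]] := @radical_valued_coimage _ _ (e \o i0)
  (fg_retract ip fC) (torsionless_sub (can_inj ip) tC) rC0 tN.
pose e2 : {linear K2 -> N} := e \o i0 \o s2.
have ne2 : ~ surjective e2.
  (* An isomorphism [e2] would give a section of [C -> N], that is, a lift of [f] through the
     projective [F]. *)
  move=> se2; have [g [_ e2g]] := linear_inverse (f := e2) ie2 se2.
  apply: nf; apply: factors_projective_ext (factors_through_fg_projective pi (snd \o k \o i0 \o s2 \o g) fF).
  by move=> x /=; rewrite -kE; congr (f _); apply: (e2g x).
have fe2 : factors_projective e2.
  (* Induction applies to [e2] itself, with target [N], provided it is a radical map. Otherwise [N]
     is the sum of a nonzero proper summand [K] and the kernel of [p], also proper; [f] is stably
     zero on both by induction, hence on [N]. *)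
  apply: (IH K2 e2 ie2 ne2 (torsionless_sub (i := e2) ie2 tN) N) => //.
  move=> K i p pP z; apply: contrapT => z0; apply: nf.
  pose m : {linear K -> N} := e2 \o i.
  have im : injective m by apply: (can_inj (g := p)) => w; apply: pP.
  have nm : ~ surjective m by move=> sm; apply: ne2 => x; have [y <-] := sm x; exists (i y).
  have [N2 [k2 [ik2 k2P]]] := sub_exists (submodule_ker p).
  have nk2 : ~ surjective k2.
    by move=> /(_ (m z))[w wE]; apply: z0; rewrite -(pP z) -[e2 (i z)]wE; apply/k2P; exists w.
  have [|c cP] := factor_mono (f := idfun \- (m \o p)) ik2.
    by move=> x; apply/k2P; rewrite linearB; apply/eqP; rewrite subr_eq0; apply/eqP/esym; exact: pP.
  apply: factors_projective_ext (factors_projectiveD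
    (factors_projective_compl p (IH' _ _ im nm)) (factors_projective_compl c (IH' _ _ ik2 nk2))).
  by move=> x /=; rewrite cP -linearD /= addrC subrK.
have [P [h [g [fP gE]]]] : factors_projective e.
  apply: factors_projective_ext (factors_projectiveD
    (factors_projective_compl (r2 \o p0) fe2) (factors_through_fg_projective (e \o t) s fQ)).
  by move=> x; rewrite [in RHS](dec x) [RHS]linearD /= -[(k (i0 (s2 _))).1]e2P.
have sd : surjective d.
  move=> y; have [u pu] := spi (- y); exists (0, u).
  by rewrite /d /= linear0 pu opprK add0r.
have ek : extendable k by apply: (torsionless_ext1 fH tH sd) => x; apply: kP.
(* The factorization [e = h g] extends from [C] to [N * F] because [Ext^1(H, S) = 0]. The defect
   [fst - h th] kills [C], so it factors as [ga d]; on [N] this reads [1 - h a = ga f], which is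
   nilpotent because [f] is radical. Thus [h a] is an automorphism and [N] is projective. *)
have [|th thP] := extendable_projective (f := g) ek fP.
  by move=> y ky; rewrite (_ : y = 0) ?linear0 //; apply: ik; rewrite ky linear0.
have [|ga gaP] := factor_epi (f := fst \- (h \o th)) sd.
  by move=> x /kP[c <-] /=; rewrite thP -gE subrr.
have [m mP] := radical_map_nilpotent ga fN rf.
pose a : {linear N -> P} := th \o pair_map idfun \0.
have haE x : h (a x) = x - ga (f x).
  have := gaP (x, 0); rewrite /d /= linear0 subr0 => ->.
  by rewrite opprB addrCA subrr addr0.
have iha : injective (h \o a).
  have ker0 x : h (a x) = 0 -> x = 0.
    rewrite haE => /subr0_eq xE; rewrite -(mP x).
    by elim: m {mP} => //= m <-.
  by move=> x y /= xy; apply/subr0_eq/ker0; rewrite !linearB xy subrr.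
have [w [wK _]] := linear_inverse iha (injective_endo_surjective flN iha).
apply: nf; apply: factors_projective_ext (factors_through_fg_projective (f \o w \o h) a fP).
by move=> x /=; congr (f _); apply: wK.
Qed.

(** A map outside the radical is an isomorphism on some nonzero summand [K]; induction handles the
    complement [G1]. *)
Lemma torsionless_stably_regular G : finite_length G -> torsionless G ->
  forall H (f : {linear G -> H}), finitely_generated H -> torsionless H ->
    exists u : {linear H -> G}, factors_projective (f \- (f \o u \o f)).
Proof.
move: G; apply: finite_length_ind => G flG IH tG H f fH tH.
have [rf|nrf] := pselect (radical_map f).
  exists \0; apply: factors_projective_ext (radical_map_factors_projective flG tG fH tH rf).
  by move=> x /=; rewrite linear0 subr0.
have [K [i [p [pfi [z z0]]]]] : exists K (i : {linear K -> G}) (p : {linear H -> K}),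
    (forall z, p (f (i z)) = z) /\ exists z : K, z <> 0.
  apply: contrapT => nex; apply: nrf => K i p pfi z; apply: contrapT => z0.
  by apply: nex; exists K, i, p; split=> //; exists z.
have [G1 [k [ik kP]]] := sub_exists (submodule_ker (p \o f)).
have nk : ~ surjective k.
  by move=> /(_ (i z))[w wE]; apply: z0; rewrite -(pfi z) -wE; apply/kP; exists w.
have [|r rP] := factor_mono (f := idfun \- (i \o p \o f)) ik.
  by move=> x; apply/kP; rewrite linearB /= pfi subrr.
have [u1 fu1] := IH G1 k ik nk (torsionless_sub ik tG) H (f \o k) fH tH.
(* [i p] inverts [f] on [K]. With [x - i p f x = k (r x)], the defect of the corrected [u] is that
   of [u1] for [f k], composed with [r]. *)
exists ((i \o p) \+ (k \o u1 \o (idfun \- (f \o i \o p)))).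
apply: factors_projective_ext (factors_projective_compl r fu1) => x /=.
rewrite rP /=; set y := i (p (f x)).
by rewrite ![f (x - y)]linearB [f (y + _)]linearD opprD addrA.
Qed.

End StableCategoryRegular.

(** * Approximation by Gorenstein projective modules *)

Section ContravariantlyFinite.
Variable S : pzRingType.
Implicit Types G H K L M N P Q : lmodType S.
Hypothesis finS : forall M, finitely_generated M -> finite_length M.
Hypothesis tlG : forall M, finitely_generated M -> torsionless M -> gorenstein_projective M.
Hypothesis cosyz : forall M, finitely_generated M -> torsionless M ->
  exists (P C : lmodType S) (j : {linear M -> P}) (q : {linear P -> C}),
    [/\ fg_projective P, finitely_generated C /\ torsionless C & short_exact j q].

(* If [0 -> K -> P -> M -> 0] is a presentation and [0 -> K -> Q -> K' -> 0] an
   approximation of the syzygy, then [0 -> Q -> P + K' -> M -> 0] is exact. *)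
Lemma contravariantly_finite : gprj_contravariantly_finite S.
Proof.
move=> M fM; have [n [pi spi]] := proj1 (fgP M) fM.
pose P := 'rV[S]_n; have fP : fg_projective P := rV_fg_projective S n.
have [K [k [ik kP]]] := sub_exists (submodule_ker pi).
have fK : finitely_generated K by apply/finite_length_fg/(finite_length_sub ik)/finS/rV_fg.
have [Q [K' [j [q [fQ [fK' tK'] [ij sq jq]]]]]] := cosyz fK (ex_intro _ n (ex_intro _ k ik)).
have eK' : ext1_vanishes K' by apply/gorenstein_projective_ext1/tlG.
have ej : extendable j by apply: (eK' _ _ j q sq) => x; apply: jq.
have [|t tP] := extendable_projective (f := k) ej fP.
  by move=> y jy; rewrite (_ : y = 0) ?linear0 //; apply: ij; rewrite jy linear0.
have pik x : pi (k x) = 0 by apply/kP; exists x.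
have [|mu muP] := factor_epi (f := pi \o t) sq.
  by move=> y /jq[x <-] /=; rewrite tP pik.
pose G := (P * K')%type; pose phi : {linear G -> M} := (pi \o fst) \+ (mu \o snd).
exists G, phi; split.
  apply: tlG; first by apply: fg_prod => //; case: fP.
  by apply: torsionless_prod => //; exists n, idfun.
move=> G' g gG'; have eG' := gorenstein_projective_ext1 gG'.
(* The pullback [Y] of [phi] and [g] is an extension of [G'] by the projective [Q]; as
   [Ext^1(G', S) = 0] it splits, and the splitting is the lift of [g]. *)
pose d : {linear (G * G')%type -> M} := (phi \o fst) \- (g \o snd).
have [Y [y [iy yP]]] := sub_exists (submodule_ker d).
have [|c cP] := factor_mono (f := pair_map (pair_map t (\- q)) \0 : {linear Q -> (G * G')%type}) iy.
  by move=> x; apply/yP; rewrite /d /phi /= linearN muP /= subrr linear0 subr0.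
have sY : surjective (snd \o y).
  move=> x; have [u pu] := spi (g x).
  have [z zE] : exists z, y z = ((u, 0), x).
    by apply/yP; rewrite /d /phi /= pu linear0 addr0 subrr.
  by exists z; rewrite /= zE.
have cE z : (snd \o y) z = 0 -> exists x, c x = z.
  move=> /= z2; have : d (y z) = 0 by apply/yP; exists z.
  rewrite /d /phi /= z2 linear0 subr0 => e0.
  have [u qu] := sq (- (y z).1.2).
  have [w kw] : exists w, k w = (y z).1.1 - t u.
    by apply/kP; rewrite linearB -[pi (t u)]muP qu linearN opprK.
  exists (u + j w); apply: iy; rewrite cP [RHS]surjective_pairing z2; congr (_, _).
  rewrite [RHS]surjective_pairing; congr (_, _).
    by rewrite linearD tP kw addrC subrK.
  by rewrite /= linearD qu (proj2 (jq _)) ?addr0 ?opprK //; exists w.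
have [||r rP] := extendable_projective (f := (idfun : {linear Q -> Q})) (eG' _ _ c (snd \o y) sY _) fQ.
- move=> z; split=> [/cE//|[x <-]]; by rewrite /= cP.
- move=> x cx; have := cP x; rewrite cx linear0 => -[tx /esym/eqP].
  rewrite oppr_eq0 => /eqP/jq[w wx]; rewrite -wx (_ : w = 0) ?linear0 //.
  by apply: ik; rewrite -tP wx -tx linear0.
have [|||h hP] := @linear_of_graph S G' G
    (fun x v => exists z, [/\ r z = 0, (y z).2 = x & (y z).1 = v]).
- move=> x; have [z zx] := sY x; exists (y (z - c (r z))).1, (z - c (r z)); split=> //.
    by rewrite linearB rP subrr.
  by rewrite linearB cP /= subr0.
- move=> a x v x' v' [z [rz <- <-]] [z' [rz' <- <-]]; exists (a *: z + z').
  by rewrite !linearP rz rz' scaler0 addr0.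
- move=> v [z [rz z2 <-]]; have [x xz] := cE z z2.
  by move: rz; rewrite -xz rP /= => ->; rewrite !linear0.
exists h => x; have [z [_ <- <-]] := hP x.
by apply/subr0_eq; apply: (proj2 (yP (y z))); exists z.
Qed.
End ContravariantlyFinite.

(** * Finitely presented functors *)
Lemma additive_of_graph (U V : zmodType) (R : U -> V -> Prop) :
  (forall x, exists y, R x y) ->
  (forall x y x' y', R x y -> R x' y' -> R (x - x') (y - y')) ->
  (forall y, R 0 y -> y = 0) ->
  exists g : {additive U -> V}, forall x, R x (g x).
Proof.
move=> tot sub fun0; have [g gP] := choice tot.
have gB : zmod_morphism g.
  move=> x y; apply/subr0_eq/fun0.
  by have := sub _ _ _ _ (gP (x - y)) (sub _ _ _ _ (gP x) (gP y)); rewrite subrr.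
pose h : {additive U -> V} := HB.pack g (GRing.isZmodMorphism.Build U V g gB).
by exists h.
Qed.

(** Von Neumann regularity, for a ring with several objects. *)
Definition regular (C : preadditive) : Prop :=
  forall (X Y : C) (f : phom X Y), exists u : phom Y X, f = pcomp f (pcomp u f).

Definition has_biproducts (C : preadditive) : Prop :=
  forall X Y : C, exists (Z : C) (i1 : phom X Z) (i2 : phom Y Z) (p1 : phom Z X) (p2 : phom Z Y),
    [/\ pcomp p1 i1 = pid X, pcomp p2 i2 = pid Y, pcomp p1 i2 = 0, pcomp p2 i1 = 0
      & pcomp i1 p1 + pcomp i2 p2 = pid Z].

Section Preadditive.
Variable C : preadditive.
Implicit Types (X Y Z W : C) (F G H : cofunctor C).

Lemma pcomp0r X Y Z (f : phom Y Z) : pcomp f (0 : phom X Y) = 0.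
Proof. by apply: (addIr (pcomp f 0)); rewrite -pcompDr !add0r. Qed.
Lemma pcomp0l X Y Z (f : phom X Y) : pcomp (0 : phom Y Z) f = 0.
Proof. by apply: (addIr (pcomp 0 f)); rewrite -pcompDl !add0r. Qed.
Lemma pcompBr X Y Z (f : phom Y Z) (g h : phom X Y) : pcomp f (g - h) = pcomp f g - pcomp f h.
Proof. by apply: (addIr (pcomp f h)); rewrite -pcompDr !subrK. Qed.
Lemma pcompBl X Y Z (g h : phom Y Z) (f : phom X Y) : pcomp (g - h) f = pcomp g f - pcomp h f.
Proof. by apply: (addIr (pcomp h f)); rewrite -pcompDl !subrK. Qed.

Definition nt_zero F G : nattrans F G :=
  {| nt_app := fun X => \0; nt_natural := fun X Y f y => esym (raddf0 (cf_map G f)) |}.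

Lemma nt_add_natural F G (a b : nattrans F G) X Y (f : phom X Y) (y : F Y) :
  (a X \+ b X) (cf_map F f y) = cf_map G f ((a Y \+ b Y) y).
Proof. by rewrite /= !nt_natural raddfD. Qed.
Definition nt_add F G (a b : nattrans F G) : nattrans F G :=
  {| nt_app := fun X => a X \+ b X; nt_natural := nt_add_natural a b |}.

Lemma nt_sub_natural F G (a b : nattrans F G) X Y (f : phom X Y) (y : F Y) :
  (a X \- b X) (cf_map F f y) = cf_map G f ((a Y \- b Y) y).
Proof. by rewrite /= !nt_natural raddfB. Qed.
Definition nt_sub F G (a b : nattrans F G) : nattrans F G :=
  {| nt_app := fun X => a X \- b X; nt_natural := nt_sub_natural a b |}.

Definition post_comp X Y (f : phom X Y) Z (g : phom Z X) : phom Z Y := pcomp f g.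
Lemma post_comp_zmod_morphism X Y (f : phom X Y) Z : zmod_morphism (@post_comp X Y f Z).
Proof. by move=> g h; apply: pcompBr. Qed.
HB.instance Definition _ X Y (f : phom X Y) Z :=
  GRing.isZmodMorphism.Build (phom Z X) (phom Z Y) (@post_comp X Y f Z)
    (@post_comp_zmod_morphism X Y f Z).
Lemma rep_map_natural X Y (f : phom X Y) Z W (g : phom Z W) (y : phom W X) :
  @post_comp X Y f Z (cf_map (representable X) g y) = cf_map (representable Y) g (@post_comp X Y f W y).
Proof. exact: pcompA. Qed.
Definition rep_map X Y (f : phom X Y) : nattrans (representable X) (representable Y) :=
  @NatTrans C (representable X) (representable Y) (fun Z => @post_comp X Y f Z)
    (rep_map_natural f).

Lemma yoneda Y F (t : nattrans (representable Y) F) Z (y : representable Y Z) :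
  t Z y = cf_map F (y : phom Z Y) (t Y (pid Y)).
Proof. by rewrite -nt_natural; congr (t Z _); rewrite /= /pre_comp pcomp1l. Qed.

Lemma yoneda_rep Y Y' (t : nattrans (representable Y) (representable Y')) Z (y : representable Y Z) :
  t Z y = pcomp (t Y (pid Y)) y.
Proof. exact: yoneda. Qed.

Lemma representable_finitely_presented Y : finitely_presented (representable Y).
Proof.
exists Y, Y, (nt_zero _ _), (nt_id _); split=> [Z y|Z y]; first by exists y.
by split=> [/= ->|[x <-]//]; exists 0.
Qed.

Section Cokernel.
Local Open Scope quotient_scope.
Variables (X Y : C) (f : phom X Y).

Definition in_image Z : {pred phom Z Y} := fun y => `[< exists x, y = pcomp f x >].
Lemma in_image_zmod_closed Z : zmod_closed (@in_image Z).
Proof.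
split=> [|_ _ /asboolP[x ->] /asboolP[y ->]]; apply/asboolP.
  by exists 0; rewrite pcomp0r.
by exists (x - y); rewrite pcompBr.
Qed.
HB.instance Definition _ Z :=
  GRing.isZmodClosed.Build (phom Z Y) (@in_image Z) (@in_image_zmod_closed Z).

Definition coker_ob Z : zmodType := Quotient.quot (@in_image Z).
Definition coker_pi Z (y : phom Z Y) : coker_ob Z := \pi_(Quotient.quot (@in_image Z)) y.
Lemma coker_pi_zmod_morphism Z : zmod_morphism (@coker_pi Z).
Proof.
have piD y y' : coker_pi (y + y' : phom Z Y) = coker_pi y + coker_pi y'.
  exact: Quotient.pi_add.
by move=> y y'; apply: (addIr (coker_pi y')); rewrite -piD !subrK.
Qed.
HB.instance Definition _ Z := GRing.isZmodMorphism.Build (phom Z Y) (coker_ob Z)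
  (@coker_pi Z) (@coker_pi_zmod_morphism Z).
Lemma coker_pi0 Z (y : phom Z Y) : coker_pi y = 0 <-> exists x, y = pcomp f x.
Proof.
rewrite -(raddf0 (@coker_pi Z)); split=> [/eqP|h].
  by rewrite -Quotient.idealrBE subr0 => /asboolP.
by apply/eqP; rewrite -Quotient.idealrBE subr0; apply/asboolP.
Qed.
Lemma coker_piW Z (u : coker_ob Z) : exists y, u = coker_pi y.
Proof. by exists (repr u); rewrite /coker_pi reprK. Qed.
Lemma coker_reprK Z (y : phom Z Y) : exists x, repr (coker_pi y) - y = pcomp f x.
Proof. by apply/coker_pi0; rewrite raddfB /= {1}/coker_pi reprK subrr. Qed.

Section Desc.
Variables (Z : C) (V : zmodType) (t : {additive phom Z Y -> V}).
Hypothesis tf : forall x, t (pcomp f x) = 0.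
Definition coker_lift (u : coker_ob Z) : V := t (repr u).
Lemma coker_liftE y : coker_lift (coker_pi y) = t y.
Proof.
by have [x xE] := coker_reprK y; apply/subr0_eq; rewrite -raddfB xE tf.
Qed.
Lemma coker_lift_zmod_morphism : zmod_morphism coker_lift.
Proof.
move=> u v; have [y ->] := coker_piW u; have [z ->] := coker_piW v.
by rewrite -raddfB !coker_liftE raddfB.
Qed.
Definition coker_desc : {additive coker_ob Z -> V} := HB.pack coker_lift
  (GRing.isZmodMorphism.Build (coker_ob Z) V coker_lift coker_lift_zmod_morphism).
End Desc.

Lemma coker_map_vanish Z W (g : phom Z W) x : (@coker_pi Z \o pre_comp g) (pcomp f x) = 0.
Proof. by apply/coker_pi0; exists (pcomp x g); rewrite /pre_comp pcompA. Qed.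
Definition coker_map Z W (g : phom Z W) : {additive coker_ob W -> coker_ob Z} :=
  coker_desc (t := @coker_pi Z \o pre_comp g) (coker_map_vanish g).
Lemma coker_mapE Z W (g : phom Z W) y : coker_map g (coker_pi y) = coker_pi (pcomp y g).
Proof. exact: coker_liftE (coker_map_vanish g) y. Qed.

Lemma coker_map1 Z u : coker_map (pid Z) u = u.
Proof. by have [y ->] := coker_piW u; rewrite coker_mapE pcomp1r. Qed.
Lemma coker_mapM Z W V (g : phom W V) (h : phom Z W) u :
  coker_map (pcomp g h) u = coker_map h (coker_map g u).
Proof. by have [y ->] := coker_piW u; rewrite !coker_mapE pcompA. Qed.
Lemma coker_mapD Z W (g h : phom Z W) u : coker_map (g + h) u = coker_map g u + coker_map h u.
Proof. by have [y ->] := coker_piW u; rewrite !coker_mapE pcompDr raddfD. Qed.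

Definition coker : cofunctor C :=
  {| cf_ob := coker_ob; cf_map := coker_map; cf_map1 := coker_map1;
     cf_mapM := coker_mapM; cf_mapD := coker_mapD |}.

Definition coker_proj : nattrans (representable Y) coker :=
  @NatTrans C (representable Y) coker (fun Z => @coker_pi Z)
    (fun Z W g y => esym (coker_mapE g y)).

Lemma coker_finitely_presented : finitely_presented coker.
Proof.
exists X, Y, (rep_map f), coker_proj; split=> [Z u|Z y].
  by have [y ->] := coker_piW u; exists y.
by rewrite coker_pi0; split=> -[x e]; exists x.
Qed.

Section DescNat.
Variables (F : cofunctor C) (t : nattrans (representable Y) F).
Hypothesis tf : forall Z (x : phom Z X), t Z (pcomp f x) = 0.
Lemma coker_nt_natural Z W (g : phom Z W) u :
  coker_desc (@tf Z) (cf_map coker g u) = cf_map F g (coker_desc (@tf W) u).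
Proof.
have [y ->] := coker_piW u; rewrite [cf_map coker g _]coker_mapE.
by rewrite ![coker_desc _ _]coker_liftE //; apply: (nt_natural t g y).
Qed.
Definition coker_nt : nattrans coker F :=
  @NatTrans C coker F (fun Z => coker_desc (@tf Z)) coker_nt_natural.
Lemma coker_ntE Z y : coker_nt Z (coker_pi y) = t Z y.
Proof. exact: coker_liftE. Qed.
End DescNat.
End Cokernel.

Definition rep_retract F : Prop :=
  exists Y (s : nattrans F (representable Y)) (b : nattrans (representable Y) F),
    forall Z x, b Z (s Z x) = x.

(* If [f = f u f] then [1 - f u] splits the presentation [coker f]. *)
Lemma finitely_presented_retract F : regular C -> finitely_presented F -> rep_retract F.
Proof.
move=> reg [X [Y [a [b [sb eb]]]]].
pose f : phom X Y := a X (pid X).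
have aE Z (x : phom Z X) : a Z x = pcomp f x by apply: yoneda_rep.
have [u fu] := reg X Y f.
pose e (Z : C) (y : phom Z Y) := y - pcomp f (pcomp u y).
have eB Z (y y' : phom Z Y) : e Z (y - y') = e Z y - e Z y'.
  by rewrite /e !pcompBr !opprB addrACA [RHS]addrACA; congr (_ + _); apply: addrC.
have ex Z : exists g : {additive F Z -> phom Z Y}, forall x, exists2 y, b Z y = x & e Z y = g x.
  have [|||g gP] := @additive_of_graph (F Z) (phom Z Y) (fun x z => exists2 y, b Z y = x & e Z y = z).
  - by move=> x; have [y <-] := sb Z x; exists (e Z y), y.
  - move=> x z x' z' [y <- <-] [y' <- <-]; exists (y - y'); first exact: raddfB.
    exact: eB.
  - move=> z [y /eb[x <-] <-]; rewrite /e aE.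
    by rewrite [pcomp u _]pcompA pcompA -fu subrr.
  by exists g.
pose s Z := sval (boolp.cid (ex Z)).
have sP Z x : exists2 y, b Z y = x & e Z y = s Z x := svalP (boolp.cid (ex Z)) x.
have bf Z (x : phom Z X) : b Z (pcomp f x) = 0 by apply/eb; exists x; rewrite aE.
have be Z y : b Z (e Z y) = b Z y by rewrite raddfB bf subr0.
have e0 Z y : b Z y = 0 -> e Z y = 0.
  by move=> /eb[x <-]; rewrite /e aE [pcomp u _]pcompA pcompA -fu subrr.
have sb' Z y : s Z (b Z y) = e Z y.
  have [y' by' <-] := sP Z (b Z y); apply/subr0_eq.
  by rewrite -eB; apply: e0; rewrite raddfB by' subrr.
have snat Z W (g : phom Z W) (x : F W) : s Z (cf_map F g x) = cf_map (representable Y) g (s W x).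
  have [y <-] := sb W x; rewrite -nt_natural !sb' /e /= /pre_comp pcompBl.
  by rewrite !pcompA.
exists Y, (@NatTrans C F (representable Y) s snat), b => Z x /=.
by have [y <-] := sb Z x; rewrite sb' be.
Qed.

End Preadditive.


Section ModCategory.
Variable C : preadditive.
Implicit Types (F G H : fp_functor C).

Lemma nt_compE (F G H : cofunctor C) (b : nattrans G H) (a : nattrans F G) X x :
  nt_comp b a X x = b X (a X x).
Proof. by []. Qed.

(* The cokernel of [Hom(-, f)] is projective, so its presentation splits. *)
Lemma projective_objects_regular :
  (forall P : mod_category C, projective_object P) -> regular C.
Proof.
move=> proj X Y f.
pose F : fp_functor C := FpFunctor (coker_finitely_presented f).
pose HY : fp_functor C := FpFunctor (representable_finitely_presented Y).
have [|s sP] := proj F HY F (coker_proj f) (nt_id F).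
  move=> G g h gh; apply: nattrans_ext => Z u; have [y ->] := coker_piW u.
  exact: (congr1 (fun t : nattrans HY G => t Z y) gh).
have sK u : coker_pi f (s Y u) = u := congr1 (fun t : nattrans F F => t Y u) sP.
pose e : phom Y Y := s Y (coker_pi f (pid Y)).
have [u uE] : exists u, pid Y - e = pcomp f u.
  by apply/coker_pi0; rewrite raddfB /= sK subrr.
have ef : s X (coker_pi f f) = pcomp e f.
  rewrite -[RHS](nt_natural s f (coker_pi f (pid Y))).
  by rewrite [cf_map F f _]coker_mapE pcomp1l.
have pif : coker_pi f f = 0 by apply/coker_pi0; exists (pid X); rewrite pcomp1r.
by exists u; rewrite pcompA -uE pcompBl pcomp1l -ef pif raddf0 subr0.
Qed.

Section Semisimple.
Hypothesis reg : regular C.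
Hypothesis bip : has_biproducts C.
Variable X0 : C.

Lemma fp_retract F : rep_retract F.
Proof. by apply: finitely_presented_retract => //; apply: fp_prop. Qed.

(** The image of [e] is the cokernel of [1 - e]. On the representable containing [F] the
    corresponding idempotent is [ep], a morphism of [C], so this cokernel is finitely presented. *)
Lemma idempotent_splits (F : cofunctor C) Y (s : nattrans F (representable Y))
    (b : nattrans (representable Y) F) (e : nattrans F F) :
  (forall Z x, b Z (s Z x) = x) -> (forall Z x, e Z (e Z x) = e Z x) ->
  exists (K : fp_functor C) (k : nattrans K F) (r : nattrans F K),
    (forall Z x, k Z (r Z x) = e Z x) /\ (forall Z x, r Z (k Z x) = x).
Proof.
move=> bs ee.
pose ep : phom Y Y := s Y (e Y (b Y (pid Y))).
have epE Z (y : phom Z Y) : pcomp ep y = s Z (e Z (b Z y)).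
  exact: esym (yoneda_rep (nt_comp s (nt_comp e b)) y).
have tf Z x : nt_comp e b Z (pcomp (pid Y - ep) x) = 0.
  by rewrite pcompBl pcomp1l raddfB epE /= bs ee subrr.
exists (FpFunctor (coker_finitely_presented (pid Y - ep))), (coker_nt tf),
  (nt_comp (coker_proj (pid Y - ep)) (nt_comp s e)).
have kE Z y : coker_nt tf Z (coker_pi _ y) = e Z (b Z y) := coker_ntE tf y.
split=> Z x; first by rewrite !nt_compE [LHS]kE bs ee.
have [y ->] := coker_piW x.
rewrite !nt_compE [X in e Z X]kE ee -epE.
apply/subr0_eq; rewrite -raddfB; apply/coker_pi0; exists (- y).
by rewrite pcompBl pcomp1l -[- y]sub0r pcompBr pcomp0r !sub0r opprK addrC.
Qed.

Lemma fp_idempotent_splits F (e : nattrans F F) : (forall Z x, e Z (e Z x) = e Z x) ->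
  exists (K : fp_functor C) (k : nattrans K F) (r : nattrans F K),
    (forall Z x, k Z (r Z x) = e Z x) /\ (forall Z x, r Z (k Z x) = x).
Proof. by have [Y [s [b bs]]] := fp_retract F; apply: idempotent_splits bs. Qed.

(** Through the retractions [f] becomes a map of representables, hence by Yoneda a morphism [ph] of
    [C]; its quasi-inverse is transported back. *)
Lemma fp_regular F G (f : nattrans F G) :
  exists u : nattrans G F, forall Z x, f Z (u Z (f Z x)) = f Z x.
Proof.
have [Y [s [b bs]]] := fp_retract F; have [Y' [s' [b' bs']]] := fp_retract G.
pose ph : phom Y Y' := s' Y (f Y (b Y (pid Y))).
have phE Z (y : phom Z Y) : pcomp ph y = s' Z (f Z (b Z y)).
  exact: esym (yoneda_rep (nt_comp s' (nt_comp f b)) y).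
have [u uE] := reg ph.
exists (nt_comp b (nt_comp (rep_map u) s')) => Z x /=.
rewrite -[LHS]bs' -phE -{1}[x]bs -phE /post_comp.
by rewrite [pcomp u _]pcompA pcompA -uE phE bs' bs.
Qed.

Lemma fp_zero : exists Z0 : fp_functor C, forall Z (x : Z0 Z), x = 0.
Proof.
exists (FpFunctor (coker_finitely_presented (pid X0))) => Z u.
have [y ->] := coker_piW u; apply/coker_pi0; exists y.
by rewrite pcomp1l.
Qed.

(** Cut out of the representable of a biproduct in [C] by the idempotent that combines the two
    retractions. *)
Lemma fp_biproduct F G : exists (K : fp_functor C) (i1 : nattrans F K) (i2 : nattrans G K)
    (p1 : nattrans K F) (p2 : nattrans K G),
  [/\ forall Z x, p1 Z (i1 Z x) = x, forall Z x, p2 Z (i2 Z x) = x,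
      forall Z x, p1 Z (i2 Z x) = 0, forall Z x, p2 Z (i1 Z x) = 0
    & forall Z x, i1 Z (p1 Z x) + i2 Z (p2 Z x) = x].
Proof.
have [Y [s [b bs]]] := fp_retract F; have [Y' [s' [b' bs']]] := fp_retract G.
have [W [j1 [j2 [q1 [q2 [q1j1 q2j2 q1j2 q2j1 jq]]]]]] := bip Y Y'.
pose i1 := nt_comp (rep_map j1) s; pose i2 := nt_comp (rep_map j2) s'.
pose p1 := nt_comp b (rep_map q1); pose p2 := nt_comp b' (rep_map q2).
have pi11 Z x : p1 Z (i1 Z x) = x by rewrite /= /post_comp pcompA q1j1 pcomp1l bs.
have pi22 Z x : p2 Z (i2 Z x) = x by rewrite /= /post_comp pcompA q2j2 pcomp1l bs'.
have pi12 Z x : p1 Z (i2 Z x) = 0 by rewrite /= /post_comp pcompA q1j2 pcomp0l raddf0.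
have pi21 Z x : p2 Z (i1 Z x) = 0 by rewrite /= /post_comp pcompA q2j1 pcomp0l raddf0.
pose e := nt_add (nt_comp i1 p1) (nt_comp i2 p2).
have eE Z x : e Z x = i1 Z (p1 Z x) + i2 Z (p2 Z x) by [].
have [||K [k [r [kr rk]]]] := @idempotent_splits (representable W) W (nt_id _) (nt_id _) e.
- by [].
- by move=> Z x; rewrite !eE !raddfD pi11 pi12 pi21 pi22 !raddf0 addr0 add0r.
have e1 Z x : e Z (i1 Z x) = i1 Z x by rewrite eE pi11 pi21 raddf0 addr0.
have e2 Z x : e Z (i2 Z x) = i2 Z x by rewrite eE pi22 pi12 raddf0 add0r.
exists K, (nt_comp r i1), (nt_comp r i2), (nt_comp p1 k), (nt_comp p2 k).
split=> Z x; rewrite !(nt_compE p1, nt_compE p2, nt_compE r).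
- by rewrite kr e1 pi11.
- by rewrite kr e2 pi22.
- by rewrite kr e2 pi12.
- by rewrite kr e1 pi21.
by rewrite -(raddfD (r Z)) -eE -kr rk rk.
Qed.

Lemma zero_objectP (Z0 : fp_functor C) :
  (forall Z (x : Z0 Z), x = 0) -> zero_object (C := mod_category C) Z0.
Proof.
move=> Z00 F; split; [exists (nt_zero F Z0) | exists (nt_zero Z0 F)]; split=> // t _.
  by apply: nattrans_ext => Z x; exact: etrans (Z00 Z _) (esym (Z00 Z _)).
by apply: nattrans_ext => Z x; rewrite [x in LHS](Z00 Z x) [x in RHS](Z00 Z x) !raddf0.
Qed.

Lemma zero_morphismP F G (f : nattrans F G) :
  zero_morphism (C := mod_category C) f <-> forall Z x, f Z x = 0.
Proof.
split=> [[Z0 [h [g [zZ0 ->]]]] Z x|f0].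
  have [_ [t [_ tuniq]]] := zZ0 Z0.
  have idE : nt_id Z0 = nt_zero Z0 Z0.
    exact: etrans (esym (tuniq (nt_id Z0) I)) (tuniq (nt_zero Z0 Z0) I).
  have -> : ccomp h g = nt_comp h (nt_comp (nt_id Z0) g) by apply: nattrans_ext.
  by rewrite idE /= raddf0.
have [Z0 Z00] := fp_zero.
exists Z0, (nt_zero Z0 G), (nt_zero F Z0); split; first exact: zero_objectP.
by apply: nattrans_ext => Z x; rewrite f0.
Qed.

(** With [f u f = f], the kernel of [f] is the image of the idempotent [1 - u f]; dually, [1 - f u]
    gives the cokernel. *)
Lemma fp_kernel F G (f : nattrans F G) :
  exists (K : mod_category C) (k : nattrans (K : fp_functor C) F), is_kernel (C := mod_category C) k f.
Proof.
have [u fuf] := fp_regular f.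
have [|K [k [r [kr rk]]]] := fp_idempotent_splits (e := nt_sub (nt_id F) (nt_comp u f)).
  by move=> Z x; rewrite /= (raddfB (f Z)) fuf subrr raddf0 subr0.
exists K, k; split=> [|W w /zero_morphismP fw].
  apply/zero_morphismP => Z x; rewrite /= -[x in k Z x]rk kr /=.
  by rewrite raddfB fuf subrr.
exists (nt_comp r w); split=> [|t <-].
  apply: nattrans_ext => Z x; rewrite /= kr /=; have /= -> := fw Z x.
  by rewrite raddf0 subr0.
by apply: nattrans_ext => Z x; rewrite /= rk.
Qed.

Lemma fp_cokernel F G (f : nattrans F G) :
  exists (Q : mod_category C) (q : nattrans G (Q : fp_functor C)), is_cokernel (C := mod_category C) q f.
Proof.
have [u fuf] := fp_regular f.
have [|K [k [r [kr rk]]]] := fp_idempotent_splits (e := nt_sub (nt_id G) (nt_comp f u)).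
  by move=> Z x; rewrite /= (raddfB (u Z)) (raddfB (f Z)) fuf subrr subr0.
exists K, r; split=> [|W w /zero_morphismP wf].
  apply/zero_morphismP => Z x; rewrite /= -[r Z _]rk kr /= fuf subrr.
  exact: raddf0.
exists (nt_comp w k); split=> [|t <-].
  apply: nattrans_ext => Z x; rewrite /= kr /= raddfB; have /= -> := wf Z (u Z x).
  by rewrite subr0.
by apply: nattrans_ext => Z x; rewrite /= rk.
Qed.

(** Cancelling in [f u f = f] makes every epimorphism split, whence all objects are projective; a
    monomorphism is the kernel of [1 - f u], and an epimorphism the cokernel of [1 - u f]. *)
Lemma mod_category_semisimple : semisimple_abelian (mod_category C).
Proof.
have epi_split (X Y : mod_category C) (p : nattrans (X : fp_functor C) (Y : fp_functor C)) :
    epimorphism (C := mod_category C) p ->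
    exists u : nattrans (Y : fp_functor C) (X : fp_functor C), nt_comp p u = nt_id Y.
  move=> ep; have [u pup] := fp_regular p; exists u; apply: (ep Y).
  by apply: nattrans_ext => Z x; apply: pup.
split; last first.
  move=> P X Y p f /epi_split[u pu]; exists (nt_comp u f).
  by rewrite /= nt_compA pu nt_comp1l.
split.
- by have [Z0 Z00] := fp_zero; exists Z0; apply: zero_objectP.
- move=> F G; have [K [i1 [i2 [p1 [p2 [p11 p22 p12 p21 ip]]]]]] := fp_biproduct F G.
  exists K, p1, p2 => W f g; exists (nt_add (nt_comp i1 f) (nt_comp i2 g)); split.
    by split; apply: nattrans_ext => Z x; rewrite /= raddfD ?p11 ?p12 ?p21 ?p22 ?addr0 ?add0r.
  by move=> t [<- <-]; apply: nattrans_ext => Z x; rewrite /= ip.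
- move=> F G; have [K [i1 [i2 [p1 [p2 [p11 p22 p12 p21 ip]]]]]] := fp_biproduct F G.
  exists K, i1, i2 => W f g; exists (nt_add (nt_comp f p1) (nt_comp g p2)); split.
    by split; apply: nattrans_ext => Z x; rewrite /= ?p11 ?p12 ?p21 ?p22 raddf0 ?addr0 ?add0r.
  by move=> t [<- <-]; apply: nattrans_ext => Z x; rewrite /= -raddfD ip.
- by move=> F G f; apply: fp_kernel.
- by move=> F G f; apply: fp_cokernel.
- move=> F G f mf; have [u fuf] := fp_regular f.
  exists G, (nt_sub (nt_id G) (nt_comp f u)); split.
    by apply/zero_morphismP => Z x; rewrite /= fuf subrr.
  move=> W w /zero_morphismP fw; exists (nt_comp u w); split=> [|t tE]; last first.
    apply: mf; rewrite tE; apply: nattrans_ext => Z x /=.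
    by have /= /subr0_eq <- := fw Z x.
  by apply: nattrans_ext => Z x /=; have /= /subr0_eq <- := fw Z x.
- move=> F G f ef; have [u fuf] := fp_regular f.
  exists F, (nt_sub (nt_id F) (nt_comp u f)); split.
    by apply/zero_morphismP => Z x; rewrite /= raddfB fuf subrr.
  move=> W w /zero_morphismP wf; exists (nt_comp w u).
  have wE : nt_comp (nt_comp w u) f = w.
    apply: nattrans_ext => Z x /=; have /= := wf Z x; rewrite raddfB.
    by move/subr0_eq.
  by split=> // t tE; apply: ef; rewrite [LHS]wE [RHS]tE.
Qed.
End Semisimple.
End ModCategory.

(** * The stable category of Gorenstein projective modules *)
Section StableBridge.
Variable S : pzRingType.

Lemma stable_class_eq (M N : lmodType S) (f g : {linear M -> N}) :
  stable_class f = stable_class g <-> factors_projective (f \- g).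
Proof. by rewrite stable_classP; split=> /asboolP. Qed.

Lemma regular_stably_regular : regular (stable_gprj S) -> stably_regular S.
Proof.
move=> reg G H f gG gH.
have [u] := reg (Gprj gG) (Gprj gH) (stable_class f).
have [u' ->] := stable_classW u; rewrite /= !stable_compE => /stable_class_eq fu.
by exists u'.
Qed.

Lemma stably_regular_regular : stably_regular S -> regular (stable_gprj S).
Proof.
move=> reg G H f; have [f' fE] := stable_classW (f : stable_hom G H).
have [u fu] := reg G H f' (gprj_prop G) (gprj_prop H).
by exists (stable_class u); rewrite fE /= !stable_compE; apply/stable_class_eq.
Qed.

Lemma stable_class0 (M N : lmodType S) : stable_class (\0 : {linear M -> N}) = 0.
Proof.
apply: (addIr (stable_class \0)); rewrite -stable_classD add0r.
by congr stable_class; apply: lhom_ext => x /=; rewrite addr0.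
Qed.

Lemma stable_gprj_biproducts :
  (forall G H : lmodType S, gorenstein_projective G -> gorenstein_projective H ->
     gorenstein_projective (G * H)%type) ->
  has_biproducts (stable_gprj S).
Proof.
move=> prod G H; exists (Gprj (prod _ _ (gprj_prop G) (gprj_prop H))).
exists (stable_class (pair_map idfun \0)), (stable_class (pair_map \0 idfun)).
exists (stable_class fst), (stable_class snd).
rewrite /= !stable_compE -!stable_class0 -stable_classD.
split; congr stable_class; apply: lhom_ext => // -[x y] /=.
by congr (_, _); rewrite /= ?addr0 ?add0r.
Qed.
End StableBridge.

Theorem proposition5p1 (A : pzRingType) (hA : artin_algebra A) :
  (one_gorenstein A /\ omega_G_algebra A)
  <->
  (forall M : lmodType A^c, finitely_generated M ->
     (gorenstein_projective M <->
      in_add (radical ((A^c)^o : lmodType A^c) * (A^c)^o)%type M)).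
Proof.
have [finA finS] := artin_algebra_finite_length hA.
split=> [[gor [_ [_ proj]]] M fM|gen].
  have tlG := torsionless_gorenstein_projective finA finS gor.
  have reg := regular_stably_regular (projective_objects_regular proj).
  split=> [gM|/in_add_torsionless tM]; last exact: tlG.
  exact: gorenstein_projective_in_add finS tlG reg gM.
have rad_fg : finitely_generated (radical ((A^c)^o : lmodType A^c)).
  apply/finite_length_fg/(finite_length_sub (i := \val)); first exact: val_inj.
  exact/finS/regular_fg.
have rad_gprj : gorenstein_projective (radical ((A^c)^o : lmodType A^c)).
  apply/gen => //; apply/in_addP.
  exists 1%N, (fun=> pair_map idfun \0), (fun=> fst) => x.
  by rewrite big_ord1.
have good := torsionless_good finS
  (conj (gorenstein_projective_ext1 rad_gprj) (gorenstein_projective_coreflexive rad_gprj)).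
have gor : one_gorenstein A := one_gorenstein_of_good finA finS good.
have tlG := torsionless_gorenstein_projective finA finS gor.
have fgG := @gorenstein_projective_fg A^c.
have tlOf G (gG : gorenstein_projective G) := coreflexive_torsionless (gorenstein_projective_coreflexive gG).
have generated M (gM : gorenstein_projective M) := proj1 (gen M (fgG M gM)) gM.
split=> //; split.
  apply: (contravariantly_finite finS tlG) => M fM tM.
  exact: (torsionless_cosyzygy finA finS gor fM tM).
apply: mod_category_semisimple.
- apply: stably_regular_regular => G H f gG gH.
  apply: (torsionless_stably_regular finS tlG generated);
    by [apply/finS/fgG | apply: tlOf | apply: fgG].
- apply: stable_gprj_biproducts => G H gG gH; apply: tlG.
    by apply: fg_prod; apply: fgG.
  by apply: torsionless_prod; apply: tlOf.
(* The zero functor is built from some object of the stable category; the zero module provides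
   one. *)
have r0 : gorenstein_projective 'rV[A^c]_0.
  by apply: tlG; [apply: rV_fg | exists 0%N, idfun].
exact: (Gprj r0).
Qed.
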